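(* Consider $N$ robotic agents rigidly grasping an object in the workspace $\mathcal{W}$, with unknown coupled dynamics $\widetilde{M}(\overline{x})\ddot{x}_O+\widetilde{C}(\overline{x},\dot{\overline{x}})\dot{x}_O+\widetilde{h}(\overline{x},\dot{\overline{x}})+\widetilde{w}(\overline{x},t)=G^{T}(\overline{x})\overline{u}$ as described in the context. Let $t_0\ge 0$, let $\mathcal{A}(\overline{q}(t_0))\in\pi_j$ for some $j\in\{1,\dots,R\}$, let $\pi_{j'}\in\mathcal{D}(\pi_j)$ be an adjacent region, and let $\delta t_{j,j'}\in\mathbb{R}_{\ge0}$ be a predefined arbitrary constant with associated desired trajectory $x_d=[p_d^T,\eta_d^T]^T$ as in the context. Then the distributed control protocol $$u_i=-c_i\,g_v\,J_{O_i}^{-T}(\overline{x})P_v^{-1}(t)R_v(\xi_v)\varepsilon_v(\xi_v),\qquad i\in\{1,\dots,N\},$$ with all quantities and design parameters selected as in the context, guarantees that $\pi_j\rightarrow\pi_{j'}$ with time duration $\delta t_{j,j'}$, that is, along the closed-loop trajectory $\mathcal{A}(\overline{q}(t_0+\delta t_{j,j'}))\in\pi_{j'}$ and $p_s\in\pi_j\cup\pi_{j'}$ for all $p_s\in\mathcal{S}_{\overline{q}(t)}$ and all $t\in[t_0,t_0+\delta t_{j,j'}]$, with all closed-loop signals (in particular $\overline{u}$) being bounded. Thus it establishes a transition relation between $\pi_j$ and $\pi_{j'}$ for the coupled object-agents system.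
   Context: **Notation.** $\mathbb{T}^3$ is the 3-torus and $\mathbb{M}=\mathbb{R}^3\times\mathbb{T}^3$. $S(a)$ is the skew-symmetric matrix with $S(a)b=a\times b$. $d$ is the Euclidean distance in $\mathbb{R}^3$. $\mathcal{B}(c,r)$ is the ball in $\mathbb{R}^3$ with center $c$ and radius $r$. $(a)_k$, $k\in\{x,y,z\}$, are the coordinates of $a\in\mathbb{R}^3$. **Kinematics.** Agent $i$ has joint variables $q_i(t)\in\mathbb{R}^{\mathfrak{n}_i}$, $\mathfrak{n}_i\ge 6$; $\overline{q}=[q_1^T,\dots,q_N^T]^T\in\mathbb{R}^{\mathfrak{n}}$ with $\mathfrak{n}=\sum_i\mathfrak{n}_i$. The pose of the object's center of mass is $x_O(\overline q)=[p_O^T,\eta_O^T]^T\in\mathbb{M}$ and that of the $i$-th end-effector is $x_{E_i}(\overline q)=[p_{E_i}^T,\eta_{E_i}^T]^T\in\mathbb{M}$ (position and Euler angles in an inertial frame). Angular velocities are $\omega_O=J_O(\eta_O)\dot\eta_O$ and $\omega_{E_i}=J_{E_i}(\eta_{E_i})\dot\eta_{E_i}$, with $J_O,J_{E_i}$ smooth $3\times 3$ matrix functions. Grasps are rigid: $p_{E_i}=p_O+R_O(\eta_O)p^{O}_{E_i/O}$ with $R_O$ the object's rotation matrix and $p^O_{E_i/O}$ constant, $\eta_{E_i}=\eta_O+\alpha_i$ with $\alpha_i$ constant, and $\omega_{E_i}=\omega_O$. Hence $x_{E_i}=f_{O_i}(x_O)$ for a function $f_{O_i}:\mathbb{M}\to\mathbb{M}$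 and $\dot x_{E_i}=J_{O_i}\dot x_O$ with $$J_{O_i}=\begin{bmatrix} I_{3} & S(p_O-p_{E_i})J_O(\eta_O)\\ 0 & J_{E_i}^{-1}(\eta_{E_i})J_O(\eta_O)\end{bmatrix}.$$ The agents and the object are assumed away from kinematic and representation singularities, so $J_O^{-1},J_{E_i}^{-1}$ are well defined and smooth and $J_{O_i}$ is invertible. **Dynamics.** Object: $M_O(x_O)\ddot x_O+C_O(x_O,\dot x_O)\dot x_O+g_O(x_O)+w_O(t)=\lambda_O$. Agents: $M_i(x_{E_i})\ddot x_{E_i}+C_i(x_{E_i},\dot x_{E_i})\dot x_{E_i}+g_i(x_{E_i})+f_i(x_{E_i},\dot x_{E_i})+w_i(t)+\lambda_i=u_i$, with control input $u_i\in\mathbb{R}^6$. $M_O,M_i$ are positive definite, all vector fields are continuous and unknown, and $w_O,w_i$ are bounded. The forces satisfy $\lambda_O=G^T\overline\lambda$, where $\overline\lambda=[\lambda_1^T,\dots,\lambda_N^T]^T$ and $G(\overline x)=[J_{O_1}^T,\dots,J_{O_N}^T]^T$. Put $\overline x_E=[x_{E_1}^T,\dots,x_{E_N}^T]^T$, $\overline x=[x_O^T,\overline x_E^T]^T$, $\overline u=[u_1^T,\dots,u_N^T]^T$, and let $\overline M,\overline C$ (block diagonal) and $\overline g,\overline f,\overline w$ (stacked) collect the agents' terms. Then the coupled dynamics hold with $\widetilde M=M_O+G^T\overline MG$, $\widetilde C=C_O+G^T\overline M\dot G+G^T\overline CG$, $\widetilde h=g_O+G^T\overline g+G^T\overline f$,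 $\widetilde w=w_O+G^T\overline w$. **Workspace partition.** $\mathcal{S}_{\overline q}\subset\mathcal{W}$ is the set of points physically belonging to the agents or the object at configuration $\overline q$. The constant $\hat L$ satisfies $\hat L\ge\sup_{\overline q\in\mathbb{R}^{\mathfrak n},\,p_s\in\mathcal{S}_{\overline q}}d(p_s,p_O(\overline q))$, and $l_0>0$ is an arbitrary constant. The bounded workspace $\mathcal{W}\subset\mathbb{R}^3$ is partitioned into $R$ cubes $\Pi=\{\pi_1,\dots,\pi_R\}$ with centers $p^c_{\pi_j}$: $$\pi_j=\{p\in\mathcal{W}: (p)_k\in[(p^c_{\pi_j})_k-\hat L-l_0,\ (p^c_{\pi_j})_k+\hat L+l_0),\ \forall k\in\{x,y,z\}\},$$ pairwise disjoint, with $d(p^c_{\pi_{j+1}},p^c_{\pi_j})=2\hat L+2l_0$ for $j\in\{1,\dots,R-1\}$ and $(p^c_{\pi_j})_z=\hat L+l_0$ for all $j$. Adjacent regions: $\mathcal{D}(\pi_j)=\{\pi_{j'}\in\Pi: d(p^c_{\pi_j},p^c_{\pi_{j'}})=2\hat L+2l_0\}$. **System in a region.** $\mathcal{A}(\overline q)\in\pi_j$ means: (i) $p_s\in\pi_j$ for all $p_s\in\mathcal{S}_{\overline q}$, and (ii) $d(p_O(\overline q),p^c_{\pi_j})<l_0$. **Transition.** If $\mathcal{A}(\overline q(t_0))\in\pi_j$, there is a transition $\pi_j\to\pi_{j'}$ with time duration $\delta t_{j,j'}\ge0$ iff there is a bounded control trajectory $\overline u$ in the coupled dynamics such that $\mathcal{A}(\overline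 q(t_0+\delta t_{j,j'}))\in\pi_{j'}$ and $p_s\in\pi_j\cup\pi_{j'}$ for all $p_s\in\mathcal{S}_{\overline q(t)}$, $t\in[t_0,t_0+\delta t_{j,j'}]$. **Desired trajectory.** $p_d:[t_0,\infty)\to\mathbb{R}^3$ is smooth, moves along the line segment from $p^c_{\pi_j}$ to $p^c_{\pi_{j'}}$, with $p_d(t_0)=p^c_{\pi_j}$, $p_d(t)=p^c_{\pi_{j'}}$ for all $t\ge t_0+\delta t_{j,j'}$, and the open ball $\mathcal{B}(p_d(t),\hat L+l_0)\subset\pi_j\cup\pi_{j'}$ for all $t\ge t_0$. $\eta_d:[t_0,\infty)\to\mathbb{T}^3$ is a smooth desired orientation trajectory; $x_d=[p_d^T,\eta_d^T]^T$ has bounded derivative. **Control protocol.** For $k\in\{1,\dots,6\}$: - Pose error $e_s=[e_{s_1},\dots,e_{s_6}]^T=x_O-x_d$. Performance functions $\rho_{s_k}(t)=(\rho^0_{s_k}-\rho^\infty_{s_k})e^{-l_{s_k}(t-t_0)}+\rho^\infty_{s_k}$ with $\rho^0_{s_k}=l_0$ for $k\in\{1,2,3\}$, $\rho^0_{s_k}>|e_{s_k}(t_0)|$ for $k\in\{4,5,6\}$, and $\rho^0_{s_k}>\rho^\infty_{s_k}>0$, $l_{s_k}>0$ for all $k$. - $\xi_{s_k}=\rho_{s_k}^{-1}(t)e_{s_k}$, $\varepsilon_{s_k}(\xi_{s_k})=\ln\frac{1+\xi_{s_k}}{1-\xi_{s_k}}$, reference velocity $\dot x^*_d=[\dot x^*_{d_1},\dots,\dot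 x^*_{d_6}]^T$ with $\dot x^*_{d_k}=-g_{s_k}\varepsilon_{s_k}(\xi_{s_k})$, $g_{s_k}>0$. - Velocity error $e_v=\dot x_O-\dot x^*_d$. Performance functions $\rho_{v_k}(t)=(\rho^0_{v_k}-\rho^\infty_{v_k})e^{-l_{v_k}(t-t_0)}+\rho^\infty_{v_k}$ with $\rho^0_{v_k}>|e_{v_k}(t_0)|$, $\rho^0_{v_k}>\rho^\infty_{v_k}>0$, $l_{v_k}>0$. - $P_v=\mathrm{diag}(\rho_{v_1},\dots,\rho_{v_6})$, $\xi_v=P_v^{-1}(t)e_v$, $R_v(\xi_v)=\mathrm{diag}\big(\tfrac{2}{1-\xi_{v_1}^2},\dots,\tfrac{2}{1-\xi_{v_6}^2}\big)$, $\varepsilon_v(\xi_v)=\big[\ln\tfrac{1+\xi_{v_1}}{1-\xi_{v_1}},\dots,\ln\tfrac{1+\xi_{v_6}}{1-\xi_{v_6}}\big]^T$. - $g_v>0$, and load sharing coefficients $0\le c_i\le1$ with $\sum_{i=1}^Nc_i=1$.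
   Formalization: The formal theorem also assumes that at arrival time t_0+δt the squares of the three position performance functions ρ_{s_1},ρ_{s_2},ρ_{s_3} sum to at most l_0²; otherwise |e_{s_k}|<ρ_{s_k} only gives d(p_O,p^c_{π_j'})<√3·l_0 and condition (ii) of A(q)∈π_j' can fail. *)

(* Defs.v *)
From mathcomp Require Import all_boot all_order all_algebra.
From mathcomp Require Import all_classical all_reals all_analysis.

Set Implicit Arguments.
Unset Strict Implicit.
Unset Printing Implicit Defensive.

Import Order.TTheory GRing.Theory Num.Theory.
Import numFieldNormedType.Exports.

#[global] Open Scope classical_set_scope.
#[global] Open Scope ring_scope.

(* Orientations.  The torus T^3 is represented by its universal cover: an
   orientation is a column eta : 'cV_3 of angles, and a function on T^3 (or on
   R^3 x T^3) is a function of the angles that is 2 pi-periodic in each of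
   them.  The pose maps x_O, x_{E_i} and the desired orientation eta_d are
   angle-valued lifts, so the orientation errors are real numbers. *)

Section Euclidean.
Variable R : realType.
Implicit Types a b : 'cV[R]_3.

Definition enorm a : R := Num.sqrt (\sum_i a i 0 ^+ 2).

Definition edist a b : R := enorm (a - b).

(* The matrix S(a) of the cross product, S(a) b = a x b. *)
Definition skew a : 'M[R]_3 :=
  let x := a (inord 0) 0 in let y := a (inord 1) 0 in let z := a (inord 2) 0 in
  \matrix_(i, j)
    nth 0 (nth [::] [:: [:: 0; - z; y]; [:: z; 0; - x]; [:: - y; x; 0]] i) j.

(* Symmetry is deliberately not part of the notion. *)
Definition pos_def n (M : 'M[R]_n) : Prop :=
  forall v : 'cV[R]_n, v != 0 -> 0 < (v^T *m M *m v) 0 0.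

End Euclidean.

Section Smooth.
Variables (R : realType) (V W : normedModType R).

Fixpoint of_class_C (n : nat) (f : V -> W) : Prop :=
  match n with
  | 0 => continuous f
  | m.+1 => (forall x, differentiable f x) /\
            (forall v, of_class_C m (fun x => 'D_v f x))
  end.

Definition smooth (f : V -> W) : Prop := forall n, of_class_C n f.

End Smooth.

Section Poses.
Variable R : realType.

Definition position (x : 'cV[R]_(3 + 3)) : 'cV[R]_3 := usubmx x.
Definition angles (x : 'cV[R]_(3 + 3)) : 'cV[R]_3 := dsubmx x.

Definition turn (k : 'I_3) : 'cV[R]_3 := (2 * pi) *: delta_mx k 0.

Definition torus_fun (T : Type) (F : 'cV[R]_3 -> T) : Prop :=
  forall eta k, F (eta + turn k) = F eta.

Definition pose_fun (T : Type) (F : 'cV[R]_(3 + 3) -> T) : Prop :=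
  forall x k, F (x + col_mx 0 (turn k)) = F x.

End Poses.

Section System.
Variables (R : realType) (N : nat) (nq : 'I_N -> nat).

(* The joint vector qbar of all the agents is a column of length
   \sum_i nq i, and every six-vector is a column of length 3 + 3. *)
Record manip_system := ManipSystem {
  xO : 'cV[R]_(\sum_i nq i) -> 'cV[R]_(3 + 3);
  xE : 'I_N -> 'cV[R]_(\sum_i nq i) -> 'cV[R]_(3 + 3);
  JO : 'cV[R]_3 -> 'M[R]_3;
  JE : 'I_N -> 'cV[R]_3 -> 'M[R]_3;
  RO : 'cV[R]_3 -> 'M[R]_3;
  pEO : 'I_N -> 'cV[R]_3;
  alphaE : 'I_N -> 'cV[R]_3;
  MO : 'cV[R]_(3 + 3) -> 'M[R]_(3 + 3);
  CO : 'cV[R]_(3 + 3) -> 'cV[R]_(3 + 3) -> 'M[R]_(3 + 3);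
  gO : 'cV[R]_(3 + 3) -> 'cV[R]_(3 + 3);
  wO : R -> 'cV[R]_(3 + 3);
  Mag : 'I_N -> 'cV[R]_(3 + 3) -> 'M[R]_(3 + 3);
  Cag : 'I_N -> 'cV[R]_(3 + 3) -> 'cV[R]_(3 + 3) -> 'M[R]_(3 + 3);
  gag : 'I_N -> 'cV[R]_(3 + 3) -> 'cV[R]_(3 + 3);
  fag : 'I_N -> 'cV[R]_(3 + 3) -> 'cV[R]_(3 + 3) -> 'cV[R]_(3 + 3);
  wag : 'I_N -> R -> 'cV[R]_(3 + 3);
  body : 'cV[R]_(\sum_i nq i) -> set 'cV[R]_3
}.

Variable s : manip_system.
Implicit Types (x v : 'cV[R]_(3 + 3)) (t : R) (i : 'I_N).

Definition fO i x : 'cV[R]_(3 + 3) :=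
  col_mx (position x + RO s (angles x) *m pEO s i) (angles x + alphaE s i).

Definition rigid_grasp (q : 'cV[R]_(\sum_i nq i)) : Prop :=
  forall i, xE s i q = fO i (xO s q).

Definition JOi i x : 'M[R]_(3 + 3) :=
  block_mx 1%:M (skew (position x - position (fO i x)) *m JO s (angles x))
           0 (invmx (JE s i (angles (fO i x))) *m JO s (angles x)).

Definition grasp_map x : 'M[R]_(\sum_(i < N) (3 + 3), 3 + 3) :=
  \mxcol_i JOi i x.

(* By the chain rule this is the time derivative of G along a motion passing
   through the pose x with velocity v. *)
Definition grasp_map_dot x v : 'M[R]_(\sum_(i < N) (3 + 3), 3 + 3) :=
  'D_v grasp_map x.

Definition Mbar x : 'M[R]_(\sum_(i < N) (3 + 3)) :=
  \mxdiag_i Mag s i (fO i x).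
Definition Cbar x v : 'M[R]_(\sum_(i < N) (3 + 3)) :=
  \mxdiag_i Cag s i (fO i x) (JOi i x *m v).
Definition gbar x : 'cV[R]_(\sum_(i < N) (3 + 3)) :=
  \mxcol_i gag s i (fO i x).
Definition fbar x v : 'cV[R]_(\sum_(i < N) (3 + 3)) :=
  \mxcol_i fag s i (fO i x) (JOi i x *m v).
Definition wbar t : 'cV[R]_(\sum_(i < N) (3 + 3)) := \mxcol_i wag s i t.

Definition Mtilde x : 'M[R]_(3 + 3) :=
  MO s x + (grasp_map x)^T *m Mbar x *m grasp_map x.
Definition Ctilde x v : 'M[R]_(3 + 3) :=
  CO s x v + (grasp_map x)^T *m Mbar x *m grasp_map_dot x v
  + (grasp_map x)^T *m Cbar x v *m grasp_map x.
Definition htilde x v : 'cV[R]_(3 + 3) :=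
  gO s x + (grasp_map x)^T *m gbar x + (grasp_map x)^T *m fbar x v.
Definition wtilde x t : 'cV[R]_(3 + 3) :=
  wO s t + (grasp_map x)^T *m wbar t.

Record manip_system_ok : Prop := ManipSystemOk {
  nq_ge6 : forall i, (6 <= nq i)%N;
  JO_torus : torus_fun (JO s);
  JE_torus : forall i, torus_fun (JE s i);
  RO_torus : torus_fun (RO s);
  MO_pose : pose_fun (MO s);
  CO_pose : forall v, pose_fun ((CO s)^~ v);
  gO_pose : pose_fun (gO s);
  Mag_pose : forall i, pose_fun (Mag s i);
  Cag_pose : forall i v, pose_fun ((Cag s i)^~ v);
  gag_pose : forall i, pose_fun (gag s i);
  fag_pose : forall i v, pose_fun ((fag s i)^~ v);
  JO_smooth : smooth (JO s);
  JE_smooth : forall i, smooth (JE s i);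
  RO_smooth : smooth (RO s);
  RO_orth : forall eta, RO s eta *m (RO s eta)^T = 1%:M;
  RO_det : forall eta, \det (RO s eta) = 1;
  (* omega_O = J_O etadot is the angular velocity, Rdot = S(omega_O) R *)
  RO_kinematics : forall eta etadot : 'cV[R]_3,
    'D_etadot (RO s) eta = skew (JO s eta *m etadot) *m RO s eta;
  (* omega_{E_i} = omega_O, where eta_{E_i} = eta_O + alpha_i makes the Euler
     angle rates of the object and of the end-effector equal *)
  grasp_omega : forall i (eta etadot : 'cV[R]_3),
    JE s i (eta + alphaE s i) *m etadot = JO s eta *m etadot;
  MO_pos : forall x, pos_def (MO s x);
  Mag_pos : forall i x, pos_def (Mag s i x);
  MO_cont : continuous (MO s);
  CO_cont : continuous (fun z : 'cV[R]_(3 + 3) * 'cV[R]_(3 + 3) => CO s z.1 z.2);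
  gO_cont : continuous (gO s);
  Mag_cont : forall i, continuous (Mag s i);
  Cag_cont : forall i,
    continuous (fun z : 'cV[R]_(3 + 3) * 'cV[R]_(3 + 3) => Cag s i z.1 z.2);
  gag_cont : forall i, continuous (gag s i);
  fag_cont : forall i,
    continuous (fun z : 'cV[R]_(3 + 3) * 'cV[R]_(3 + 3) => fag s i z.1 z.2);
  wO_cont : {within [set t | 0 <= t], continuous (wO s)};
  wag_cont : forall i, {within [set t | 0 <= t], continuous (wag s i)};
  wO_bounded : [bounded wO s t | t in [set t | 0 <= t]];
  wag_bounded : forall i, [bounded wag s i t | t in [set t | 0 <= t]]
}.

(* The time interval [t0, tau), where tau may be +oo. *)
Definition horizon (t0 : R) (tau : \bar R) : set R :=
  [set t | t0 <= t /\ (t%:E < tau)%E].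

(* x, v and u are the signals x_O, its velocity and ubar.  The derivatives at
   t0 itself are one-sided; they are accounted for by the continuity of x and
   v on [t0, tau). *)
Definition coupled_motion (t0 : R) (tau : \bar R)
    (x v : R -> 'cV[R]_(3 + 3)) (u : R -> 'cV[R]_(\sum_(i < N) (3 + 3))) :
    Prop :=
  [/\ {within horizon t0 tau, continuous x},
      {within horizon t0 tau, continuous v} &
      forall t, t0 < t -> (t%:E < tau)%E ->
        [/\ is_derive t 1 x (v t), derivable v t 1 &
            Mtilde (x t) *m 'D_1 v t + Ctilde (x t) (v t) *m v t
            + htilde (x t) (v t) + wtilde (x t) t
            = (grasp_map (x t))^T *m u t]].

(* A joint-space trajectory of the grasping agents whose object motion obeys
   the coupled dynamics with input u. *)
Definition joint_motion (t0 : R) (tau : \bar R)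
    (q : R -> 'cV[R]_(\sum_i nq i)) (v : R -> 'cV[R]_(3 + 3))
    (u : R -> 'cV[R]_(\sum_(i < N) (3 + 3))) : Prop :=
  [/\ {within horizon t0 tau, continuous q},
      forall t, horizon t0 tau t -> rigid_grasp (q t) &
      coupled_motion t0 tau (xO s \o q) v u].

(* Representation singularities are at the zeros of the determinants; mu
   bounds them away from zero. *)
Definition nonsingular_pose (mu : R) x : Prop :=
  mu <= `|\det (JO s (angles x))| /\
  forall i, mu <= `|\det (JE s i (angles (fO i x)))|.

End System.

Section Workspace.
Variable R : realType.

Record workspace := Workspace {
  ws_set : set 'cV[R]_3;
  nreg : nat;
  center : 'I_nreg -> 'cV[R]_3;
  Lhat : R;
  l0 : R
}.

Variable W : workspace.
Implicit Types j : 'I_(nreg W).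

Definition region j : set 'cV[R]_3 :=
  [set p | ws_set W p /\ forall k,
     center j k 0 - Lhat W - l0 W <= p k 0 < center j k 0 + Lhat W + l0 W].

Definition adjacent_regions j j' : Prop :=
  edist (center j) (center j') = 2 * Lhat W + 2 * l0 W.

Record workspace_ok : Prop := WorkspaceOk {
  l0_gt0 : 0 < l0 W;
  ws_bounded : bounded_set (ws_set W);
  ws_partition : partition setT region (ws_set W);
  consecutive_dist : forall j j', j' = j.+1 :> nat ->
    edist (center j') (center j) = 2 * Lhat W + 2 * l0 W;
  center_z : forall j, center j (inord 2) 0 = Lhat W + l0 W
}.

Variables (N : nat) (nq : 'I_N -> nat) (s : manip_system R nq).

Record body_ok : Prop := BodyOk {
  body_ws : forall q, body s q `<=` ws_set W;
  Lhat_sup : forall q p, body s q p -> edist p (position (xO s q)) <= Lhat W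
}.

(* A(q) \in pi_j *)
Definition in_region (q : 'cV[R]_(\sum_i nq i)) j : Prop :=
  body s q `<=` region j /\ edist (position (xO s q)) (center j) < l0 W.

(* The transition pi_j -> pi_j' with time duration dt, from the configuration
   q0 and the object velocity v0 at time t0. *)
Definition transition (t0 : R) (q0 : 'cV[R]_(\sum_i nq i))
    (v0 : 'cV[R]_(3 + 3)) j j' (dt : R) : Prop :=
  in_region q0 j /\
  exists tau u q v,
    [/\ ((t0 + dt)%:E < tau)%E,
        [bounded u t | t in horizon t0 tau],
        joint_motion s t0 tau q v u,
        q t0 = q0 /\ v t0 = v0 &
        in_region (q (t0 + dt)) j' /\
        forall t, t0 <= t <= t0 + dt ->
          body s (q t) `<=` region j `|` region j'].

End Workspace.

Section Protocol.
Variables (R : realType) (N : nat).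

Definition desired_pose (pd etad : R -> 'cV[R]_3) (t : R) : 'cV[R]_(3 + 3) :=
  col_mx (pd t) (etad t).

(* Smooth functions on [t0, +oo) are given as restrictions of smooth functions
   on the line, and only their values from t0 on matter. *)
Record desired_ok (W : workspace R) (j j' : 'I_(nreg W)) (t0 dt : R)
    (pd etad : R -> 'cV[R]_3) : Prop := DesiredOk {
  pd_smooth : smooth pd;
  etad_smooth : smooth etad;
  pd_segment : forall t, t0 <= t -> exists2 a : R, 0 <= a <= 1 &
    pd t = center j + a *: (center j' - center j);
  pd_start : pd t0 = center j;
  pd_end : forall t, t0 + dt <= t -> pd t = center j';
  pd_ball : forall t, t0 <= t ->
    [set p | edist p (pd t) < Lhat W + l0 W] `<=` region j `|` region j';
  xd_bounded : [bounded 'D_1 (desired_pose pd etad) t | t in [set t | t0 <= t]]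
}.

Record control_params := ControlParams {
  rho_s0 : 'I_(3 + 3) -> R;
  rho_sinf : 'I_(3 + 3) -> R;
  l_s : 'I_(3 + 3) -> R;
  g_s : 'I_(3 + 3) -> R;
  rho_v0 : 'I_(3 + 3) -> R;
  rho_vinf : 'I_(3 + 3) -> R;
  l_v : 'I_(3 + 3) -> R;
  g_v : R;
  share : 'I_N -> R
}.

Definition perf (rho0 rhoinf l t0 t : R) : R :=
  (rho0 - rhoinf) * expR (- l * (t - t0)) + rhoinf.

Definition log_ratio (z : R) : R := ln ((1 + z) / (1 - z)).

Variables (nq : 'I_N -> nat) (s : manip_system R nq) (c : control_params).
Variables (t0 : R) (xd : R -> 'cV[R]_(3 + 3)).
Implicit Types (t : R) (x v : 'cV[R]_(3 + 3)) (k : 'I_(3 + 3)).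

Definition rho_s k t : R := perf (rho_s0 c k) (rho_sinf c k) (l_s c k) t0 t.
Definition rho_v k t : R := perf (rho_v0 c k) (rho_vinf c k) (l_v c k) t0 t.

Definition e_s t x : 'cV[R]_(3 + 3) := x - xd t.
Definition xi_s t x : 'cV[R]_(3 + 3) :=
  \col_k ((rho_s k t)^-1 * e_s t x k 0).
Definition eps_s t x : 'cV[R]_(3 + 3) := \col_k log_ratio (xi_s t x k 0).
Definition xd_dot_ref t x : 'cV[R]_(3 + 3) :=
  \col_k (- g_s c k * eps_s t x k 0).

Definition e_v t x v : 'cV[R]_(3 + 3) := v - xd_dot_ref t x.
Definition P_v t : 'M[R]_(3 + 3) := diag_mx (\row_k rho_v k t).
Definition xi_v t x v : 'cV[R]_(3 + 3) := invmx (P_v t) *m e_v t x v.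
Definition R_v (xi : 'cV[R]_(3 + 3)) : 'M[R]_(3 + 3) :=
  diag_mx (\row_k (2 / (1 - xi k 0 ^+ 2))).
Definition eps_v (xi : 'cV[R]_(3 + 3)) : 'cV[R]_(3 + 3) :=
  \col_k log_ratio (xi k 0).

Definition control (i : 'I_N) t x v : 'cV[R]_(3 + 3) :=
  - (share c i * g_v c) *:
    (invmx (JOi s i x)^T *m invmx (P_v t) *m R_v (xi_v t x v)
       *m eps_v (xi_v t x v)).

Definition ubar t x v : 'cV[R]_(\sum_(i < N) (3 + 3)) :=
  \mxcol_i control i t x v.

Record params_ok (l : R) (x0 v0 : 'cV[R]_(3 + 3)) : Prop := ParamsOk {
  rho_s0_pos : forall k, (k < 3)%N -> rho_s0 c k = l;
  rho_s0_ang : forall k, (3 <= k)%N -> `|e_s t0 x0 k 0| < rho_s0 c k;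
  rho_s_range : forall k, 0 < rho_sinf c k < rho_s0 c k;
  l_s_gt0 : forall k, 0 < l_s c k;
  g_s_gt0 : forall k, 0 < g_s c k;
  rho_v0_gt : forall k, `|e_v t0 x0 v0 k 0| < rho_v0 c k;
  rho_v_range : forall k, 0 < rho_vinf c k < rho_v0 c k;
  l_v_gt0 : forall k, 0 < l_v c k;
  g_v_gt0 : 0 < g_v c;
  share_range : forall i, 0 <= share c i <= 1;
  share_sum : \sum_i share c i = 1
}.

(* The funnel only confines each coordinate of p_O - p_d to (-rho_k, rho_k).
   As rho_k starts at l0, this does not by itself bring the Euclidean distance
   d(p_O, p_d) below l0, which in_region requires on arrival: a coordinatewise
   bound allows up to sqrt 3 * l0.  This condition on the decay of the
   position funnel at the arrival time t closes the gap. *)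
Definition funnel_in_ball (l t : R) : Prop :=
  \sum_(k < 3 + 3 | (k < 3)%N) rho_s k t ^+ 2 <= l ^+ 2.

Definition closed_loop (tau : \bar R) (x v : R -> 'cV[R]_(3 + 3)) : Prop :=
  coupled_motion s t0 tau x v (fun t => ubar t (x t) (v t)).

Definition joint_closed_loop (tau : \bar R)
    (q : R -> 'cV[R]_(\sum_i nq i)) (v : R -> 'cV[R]_(3 + 3)) : Prop :=
  joint_motion s t0 tau q v (fun t => ubar t (xO s (q t)) (v t)).

(* The system operates away from representation singularities: the initial
   pose and the closed-loop motions starting from it keep a fixed distance
   from them. *)
Definition away_from_singularities (x0 v0 : 'cV[R]_(3 + 3)) : Prop :=
  exists mu : R, [/\ 0 < mu, nonsingular_pose s mu x0 &
    forall (tau : \bar R) (x v : R -> 'cV[R]_(3 + 3)),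
      closed_loop tau x v -> x t0 = x0 -> v t0 = v0 ->
      forall t, horizon t0 tau t -> nonsingular_pose s mu (x t)].

(* The angles themselves are left out: orientations live on the compact torus.
   The accelerations are considered on the open half-line, where they are
   two-sided derivatives. *)
Record bounded_signals (x v : R -> 'cV[R]_(3 + 3)) : Prop := BoundedSignals {
  pO_bounded : [bounded position (x t) | t in [set t | t0 <= t]];
  pE_bounded : forall i,
    [bounded position (fO s i (x t)) | t in [set t | t0 <= t]];
  v_bounded : [bounded v t | t in [set t | t0 <= t]];
  vE_bounded : forall i, [bounded JOi s i (x t) *m v t | t in [set t | t0 <= t]];
  vdot_bounded : [bounded 'D_1 v t | t in [set t | t0 < t]];
  e_s_bounded : [bounded e_s t (x t) | t in [set t | t0 <= t]];
  xi_s_bounded : [bounded xi_s t (x t) | t in [set t | t0 <= t]];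
  eps_s_bounded : [bounded eps_s t (x t) | t in [set t | t0 <= t]];
  ref_bounded : [bounded xd_dot_ref t (x t) | t in [set t | t0 <= t]];
  e_v_bounded : [bounded e_v t (x t) (v t) | t in [set t | t0 <= t]];
  xi_v_bounded : [bounded xi_v t (x t) (v t) | t in [set t | t0 <= t]];
  R_v_bounded : [bounded R_v (xi_v t (x t) (v t)) | t in [set t | t0 <= t]];
  eps_v_bounded : [bounded eps_v (xi_v t (x t) (v t)) | t in [set t | t0 <= t]];
  u_bounded : [bounded ubar t (x t) (v t) | t in [set t | t0 <= t]]
}.

End Protocol.

(* Main.v *)
(** Along a rigid grasp J_{E_i} = J_O, so away from singularities the J_{O_i} are
    block unitriangular and the closed loop reads M x'' + d = - g_v y, where
    y = P_v^-1 R_v eps_v, M is uniformly positive definite and d is bounded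
    (by compactness, as all fields are periodic in the angles).  As long as the
    errors stay in their funnels, a barrier argument on each xi_{s_k}^2, and then
    one on |eps_v|^2, whose derivative is 2 <y, x'' + b> with b bounded, confine
    them to |xi| <= theta for some theta < 1 that does not depend on the time
    horizon; continuous induction removes the a priori assumption.

    The dynamics are only continuous, so existence and prolongation rest on
    Peano's theorem.  It is applied to the closed-loop field with the errors
    clamped slightly above theta; by confinement the clamps are never active.

    Finally, the centres of adjacent cubes differ along one axis only, and the
    position funnels keep p_O within l_0 of p_d in each coordinate, hence the
    system within the union of the two cubes. *)

Require Import Defs.
From mathcomp Require Import all_boot all_order all_algebra.
From mathcomp Require Import all_classical all_reals all_analysis.
From mathcomp Require Import ring lra.

Set Implicit Arguments.
Unset Strict Implicit.
Unset Printing Implicit Defensive.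

Import Order.TTheory GRing.Theory Num.Theory.
Import numFieldNormedType.Exports.

Local Open Scope classical_set_scope.
Local Open Scope ring_scope.

(** * Limits, continuity and bounds of matrix functions *)

Section MatrixNorm.
Variables (R : realType) (m n : nat).
Implicit Types A : 'M[R]_(m, n).

(** Three obstacles shape the argument. The fields are only continuous, so solutions need not be
    unique: a given solution has to be prolonged, not restarted, and every estimate must hold for
    all solutions at once. [JOi] contains [invmx], which is meaningless at singular poses, while
    nonsingularity is granted only along closed-loop motions; hence the dynamics are rewritten with
    Jacobians that are smooth at every pose, and the determinant is carried along in the continuous
    induction. Finally, the two margins depend on each other: the rate of the velocity error
    contains 1/(1 - xi_s^2), so the velocity margin can be fixed only after the pose margin, whose
    value involves the velocity errors through |xi_v| < 1 alone. The feedback y is the gradient of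
    |eps_v|^2/2 in the velocity, and the inertia is controlled through its quadratic form; the sign
    of <y, x'' + b> is therefore obtained by pairing the equation of motion with x'' + b, where x''
    appears quadratically. *)

Lemma mx_norm_leP A (M : R) :
  0 <= M -> (forall i j, `|A i j| <= M) <-> `|A| <= M.
Proof.
move=> M0; rewrite {2}/Num.Def.normr/= mx_normrE; split=> [H|/bigmax_leP[_ H] i j].
  by apply: bigmax_le => // -[i j] _; exact: H.
exact: (H (i, j)).
Qed.

Lemma mx_coord_le A i j : `|A i j| <= `|A|.
Proof. by move: i j; apply/(mx_norm_leP _ (normr_ge0 _)). Qed.

Lemma cvg_mxP (T : Type) (F : set_system T) {FF : Filter F}
    (f : T -> 'M[R]_(m, n)) A :
  f @ F --> A <-> forall i j, f t i j @[t --> F] --> A i j.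
Proof.
split=> [fA i j|H].
  exact: (cvg_comp _ _ fA (@coord_continuous _ _ _ i j A)).
apply/cvgrPdist_le => e e0.
have : \forall t \near F, forall ij : 'I_m * 'I_n,
    `|(A - f t) ij.1 ij.2| <= e.
  apply: filter_forall => -[i j] /=.
  have /cvgrPdist_le/(_ _ e0) h := H i j.
  by apply: filterS h => u; rewrite !mxE.
move=> h; apply: filterS h => t Ht; apply/(mx_norm_leP _ (ltW e0)) => i j; exact: (Ht (i, j)).
Qed.

Lemma continuous_mxP (T : topologicalType) (f : T -> 'M[R]_(m, n)) :
  continuous f <-> forall i j, continuous (fun t => f t i j).
Proof.
split=> [cf i j t|cf t]; first by have /cvg_mxP := cf t; apply.
by apply/(@cvg_mxP _ (nbhs t)) => i j; exact: cf.
Qed.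

End MatrixNorm.

Section MatrixLimits.
Variables (R : realType) (T : Type) (F : set_system T).
Context {FF : Filter F}.

Lemma cvg_mulmx m n p (f : T -> 'M[R]_(m, n)) (g : T -> 'M[R]_(n, p))
    (A : 'M[R]_(m, n)) (B : 'M[R]_(n, p)) :
  f @ F --> A -> g @ F --> B -> f t *m g t @[t --> F] --> A *m B.
Proof.
move=> /cvg_mxP fA /cvg_mxP gB; apply/cvg_mxP => i j; rewrite mxE.
under eq_cvg do rewrite mxE.
apply: cvg_big => [|k _]; first exact: add_continuous.
exact: cvgM.
Qed.

Lemma cvg_trmx m n (f : T -> 'M[R]_(m, n)) (A : 'M[R]_(m, n)) :
  f @ F --> A -> (f t)^T @[t --> F] --> A^T.
Proof.
move=> /cvg_mxP fA; apply/cvg_mxP => i j; rewrite mxE.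
under eq_cvg do rewrite mxE.
exact: fA.
Qed.

Lemma cvg_col_mx m1 m2 n (f : T -> 'M[R]_(m1, n)) (g : T -> 'M[R]_(m2, n))
    (A : 'M[R]_(m1, n)) (B : 'M[R]_(m2, n)) :
  f @ F --> A -> g @ F --> B -> col_mx (f t) (g t) @[t --> F] --> col_mx A B.
Proof.
move=> /cvg_mxP fA /cvg_mxP gB; apply/cvg_mxP => i j.
under eq_cvg do rewrite mxE.
by rewrite mxE; case: (fintype.split i) => i'; [exact: fA|exact: gB].
Qed.

Lemma cvg_usubmx m1 m2 n (f : T -> 'M[R]_(m1 + m2, n)) (A : 'M[R]_(m1 + m2, n)) :
  f @ F --> A -> usubmx (f t) @[t --> F] --> usubmx A.
Proof.
move=> /cvg_mxP fA; apply/cvg_mxP => i j; rewrite mxE.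
under eq_cvg do rewrite mxE.
exact: fA.
Qed.

Lemma cvg_dsubmx m1 m2 n (f : T -> 'M[R]_(m1 + m2, n)) (A : 'M[R]_(m1 + m2, n)) :
  f @ F --> A -> dsubmx (f t) @[t --> F] --> dsubmx A.
Proof.
move=> /cvg_mxP fA; apply/cvg_mxP => i j; rewrite mxE.
under eq_cvg do rewrite mxE.
exact: fA.
Qed.

Lemma cvg_det n (f : T -> 'M[R]_n) (A : 'M[R]_n) :
  f @ F --> A -> \det (f t) @[t --> F] --> \det A.
Proof.
move=> /cvg_mxP fA; rewrite /determinant.
apply: cvg_big => [|s _]; first exact: add_continuous.
apply: cvgM; first exact: cvg_cst.
apply: cvg_big => [|k _]; first exact: mul_continuous.
exact: fA.
Qed.

(** Cramer's rule expresses the inverse by determinants. It is valid only near the limit, where the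
    determinant stays nonzero: on singular matrices [invmx] returns its argument. *)
Lemma cvg_invmx n (f : T -> 'M[R]_n) (A : 'M[R]_n) :
  A \in unitmx -> f @ F --> A -> invmx (f t) @[t --> F] --> invmx A.
Proof.
move=> Au fA; have dA := cvg_det fA.
have dA0 : \det A != 0 by rewrite -unitfE -unitmxE.
have adjA : \adj (f t) @[t --> F] --> \adj A.
  apply/cvg_mxP => i j; rewrite mxE; under eq_cvg do rewrite mxE.
  rewrite /cofactor; apply: cvgM; first exact: cvg_cst.
  apply: cvg_det; apply/cvg_mxP => i' j'; rewrite !mxE.
  under eq_cvg do rewrite !mxE.
  exact: (proj1 (cvg_mxP _ _) fA).
have : (\det (f t))^-1 *: \adj (f t) @[t --> F] --> invmx A.
  by rewrite /invmx Au; apply: cvgZ => //; apply: cvgV.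
apply: cvg_trans; apply: near_eq_cvg.
have : \forall t \near F, \det (f t) != 0 by exact: (cvgr_neq0 _ dA).
by apply: filterS => t; rewrite /invmx unitmxE unitfE => ->.
Qed.

End MatrixLimits.

Section ContinuousFunctions.
Variables (R : realType) (T : topologicalType).

Lemma ctsD (V : normedModType R) (f g : T -> V) :
  continuous f -> continuous g -> continuous (fun t => f t + g t).
Proof. by move=> cf cg t; apply: cvgD; [exact: (cf t)|exact: (cg t)]. Qed.

Lemma ctsN (V : normedModType R) (f : T -> V) :
  continuous f -> continuous (fun t => - f t).
Proof. by move=> cf t; apply: cvgN; exact: (cf t). Qed.

Lemma ctsM (f g : T -> R) :
  continuous f -> continuous g -> continuous (fun t => f t * g t).
Proof. by move=> cf cg t; apply: cvgM; [exact: (cf t)|exact: (cg t)]. Qed.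

Lemma ctsZ (V : normedModType R) (f : T -> R) (g : T -> V) :
  continuous f -> continuous g -> continuous (fun t => f t *: g t).
Proof. by move=> cf cg t; apply: cvgZ; [exact: (cf t)|exact: (cg t)]. Qed.

Lemma cts_sum (V : normedModType R) (I : Type) (r : seq I) (f : I -> T -> V) :
  (forall i, continuous (f i)) -> continuous (fun t => \sum_(i <- r) f i t).
Proof.
move=> cf t; apply: cvg_big => [|i _]; first exact: add_continuous.
exact: (cf i t).
Qed.

Lemma cts_mulmx m n p (f : T -> 'M[R]_(m, n)) (g : T -> 'M[R]_(n, p)) :
  continuous f -> continuous g -> continuous (fun t => f t *m g t).
Proof. by move=> cf cg t; apply: cvg_mulmx; [exact: (cf t)|exact: (cg t)]. Qed.

Lemma cts_trmx m n (f : T -> 'M[R]_(m, n)) :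
  continuous f -> continuous (fun t => (f t)^T).
Proof. by move=> cf t; apply: cvg_trmx; exact: (cf t). Qed.

Lemma cts_coord m n (f : T -> 'M[R]_(m, n)) i j :
  continuous f -> continuous (fun t => f t i j).
Proof. by move=> /continuous_mxP; apply. Qed.

Lemma cts_col_mx m1 m2 n (f : T -> 'M[R]_(m1, n)) (g : T -> 'M[R]_(m2, n)) :
  continuous f -> continuous g -> continuous (fun t => col_mx (f t) (g t)).
Proof. by move=> cf cg t; apply: cvg_col_mx; [exact: (cf t)|exact: (cg t)]. Qed.

Lemma cts_usubmx m1 m2 n (f : T -> 'M[R]_(m1 + m2, n)) :
  continuous f -> continuous (fun t => usubmx (f t)).
Proof. by move=> cf t; apply: cvg_usubmx; exact: (cf t). Qed.

Lemma cts_dsubmx m1 m2 n (f : T -> 'M[R]_(m1 + m2, n)) :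
  continuous f -> continuous (fun t => dsubmx (f t)).
Proof. by move=> cf t; apply: cvg_dsubmx; exact: (cf t). Qed.

Lemma cts_invmx n (f : T -> 'M[R]_n) : (forall t, f t \in unitmx) ->
  continuous f -> continuous (fun t => invmx (f t)).
Proof. by move=> fu cf t; apply: cvg_invmx; [exact: fu|exact: (cf t)]. Qed.

Lemma cts_det n (f : T -> 'M[R]_n) :
  continuous f -> continuous (fun t => \det (f t)).
Proof. by move=> cf t; apply: cvg_det; exact: (cf t). Qed.

Lemma cts_comp (U V : topologicalType) (f : T -> U) (g : U -> V) :
  continuous f -> continuous g -> continuous (fun t => g (f t)).
Proof. by move=> cf cg t; apply: (@continuous_comp _ _ _ f g); [exact: (cf t)|exact: (cg _)]. Qed.

Lemma cts_pair (U V : topologicalType) (f : T -> U) (g : T -> V) :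
  continuous f -> continuous g -> continuous (fun t => (f t, g t)).
Proof. by move=> cf cg t; apply: cvg_pair; [exact: (cf t)|exact: (cg t)]. Qed.

End ContinuousFunctions.

Lemma cts_id (T : topologicalType) : continuous (fun t : T => t).
Proof. by move=> t; exact: cvg_id. Qed.

Lemma cts_fst (U V : topologicalType) : continuous (@fst U V).
Proof. by move=> [x v]; exact: cvg_fst. Qed.

Lemma cts_snd (U V : topologicalType) : continuous (@snd U V).
Proof. by move=> [x v]; exact: cvg_snd. Qed.

Lemma cts_max (T : topologicalType) (R : realType) (f g : T -> R) :
  continuous f -> continuous g -> continuous (fun t => Num.max (f t) (g t)).
Proof.
move=> cf cg; exact: (@cts_comp _ _ _ (fun t => (f t, g t))
  (fun z => Num.max z.1 z.2) (cts_pair cf cg) (@max_continuous _ R)).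
Qed.

Lemma cts_min (T : topologicalType) (R : realType) (f g : T -> R) :
  continuous f -> continuous g -> continuous (fun t => Num.min (f t) (g t)).
Proof.
move=> cf cg; exact: (@cts_comp _ _ _ (fun t => (f t, g t))
  (fun z => Num.min z.1 z.2) (cts_pair cf cg) (@min_continuous _ R)).
Qed.

(** A bound by an explicit constant over an arbitrary index set, so that times, poses and triples
    (time, pose, velocity) are treated alike; [mbdd_bounded] and [bounded_mbdd] relate it to the
    filter-based [bounded]. *)
Definition mbdd (R : realType) (T : Type) (A : set T) m n
    (f : T -> 'M[R]_(m, n)) : Prop :=
  exists M, forall t, A t -> `|f t| <= M.

Section MatrixBounds.
Variables (R : realType) (T : Type) (A : set T).

Lemma mbddP m n (f : T -> 'M[R]_(m, n)) :
  mbdd A f <-> exists2 M, 0 <= M & forall t, A t -> forall i j, `|f t i j| <= M.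
Proof.
split=> [[M fM]|[M M0 fM]].
  exists `|M| => // t At i j; apply: le_trans (mx_coord_le _ _ _) _.
  by apply: le_trans (fM t At) _; exact: ler_norm.
by exists M => t At; apply/(mx_norm_leP _ M0); exact: fM.
Qed.

Lemma mbdd_cst m n (B : 'M[R]_(m, n)) : mbdd A (fun=> B).
Proof. by exists `|B|. Qed.

Lemma mbddD m n (f g : T -> 'M[R]_(m, n)) :
  mbdd A f -> mbdd A g -> mbdd A (fun t => f t + g t).
Proof.
move=> [M fM] [M' gM]; exists (M + M') => t At.
by apply: le_trans (ler_normD _ _) _; rewrite lerD ?fM ?gM.
Qed.

Lemma mbddN m n (f : T -> 'M[R]_(m, n)) : mbdd A f -> mbdd A (fun t => - f t).
Proof. by move=> [M fM]; exists M => t At; rewrite normrN; exact: fM. Qed.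

Lemma mbddB m n (f g : T -> 'M[R]_(m, n)) :
  mbdd A f -> mbdd A g -> mbdd A (fun t => f t - g t).
Proof. by move=> fM gM; apply: mbddD => //; exact: mbddN. Qed.

Lemma mbddM m n p (f : T -> 'M[R]_(m, n)) (g : T -> 'M[R]_(n, p)) :
  mbdd A f -> mbdd A g -> mbdd A (fun t => f t *m g t).
Proof.
move=> /mbddP[M M0 fM] /mbddP[M' M'0 gM]; apply/mbddP.
exists (\sum_(k < n) (M * M')); first by apply: sumr_ge0 => k _; exact: mulr_ge0.
move=> t At i j; rewrite mxE; apply: le_trans (ler_norm_sum _ _ _) _.
by apply: ler_sum => k _; rewrite normrM ler_pM ?fM ?gM.
Qed.

Lemma mbdd_tr m n (f : T -> 'M[R]_(m, n)) :
  mbdd A f -> mbdd A (fun t => (f t)^T).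
Proof.
by move=> /mbddP[M M0 fM]; apply/mbddP; exists M => // t At i j; rewrite mxE fM.
Qed.

Lemma mbdd_block m1 m2 n1 n2 (f : T -> 'M[R]_(m1, n1)) (g : T -> 'M[R]_(m1, n2))
    (h : T -> 'M[R]_(m2, n1)) (k : T -> 'M[R]_(m2, n2)) :
  mbdd A f -> mbdd A g -> mbdd A h -> mbdd A k ->
  mbdd A (fun t => block_mx (f t) (g t) (h t) (k t)).
Proof.
move=> /mbddP[M1 M10 fM] /mbddP[M2 M20 gM] /mbddP[M3 M30 hM] /mbddP[M4 M40 kM].
apply/mbddP; exists (M1 + M2 + (M3 + M4)); first by rewrite !addr_ge0.
move=> t At i j; rewrite /block_mx mxE; case: (fintype.split i) => i'; rewrite mxE;
  case: (fintype.split j) => j'.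
- by rewrite (le_trans (fM _ At _ _))// -addrA lerDl !addr_ge0.
- by rewrite (le_trans (gM _ At _ _))// addrAC lerDr !addr_ge0.
- by rewrite (le_trans (hM _ At _ _))// addrCA lerDl !addr_ge0.
- by rewrite (le_trans (kM _ At _ _))// addrA lerDr !addr_ge0.
Qed.

Lemma mbdd_sum (I : finType) m n (f : I -> T -> 'M[R]_(m, n)) :
  (forall i, mbdd A (f i)) -> mbdd A (fun t => \sum_i f i t).
Proof.
move=> fM; pose M i := sval (cid (fM i)); exists (\sum_i M i) => t At.
apply: le_trans (ler_norm_sum _ _ _) _; apply: ler_sum => i _.
by rewrite /M; case: cid => //= N; apply.
Qed.

Lemma mbdd_mxcol N (p : 'I_N -> nat) n (f : forall i, T -> 'M[R]_(p i, n)) :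
  (forall i, mbdd A (f i)) -> mbdd A (fun t => \mxcol_i f i t).
Proof.
move=> fM; pose M i := sval (cid (fM i)).
apply/mbddP; exists (\sum_i `|M i|); first by apply: sumr_ge0.
move=> t At i j; rewrite mxE; apply: le_trans (mx_coord_le _ _ _) _.
rewrite (bigD1 (tagnat.sig1 i))//= ler_wpDr//; first exact: sumr_ge0.
by apply: le_trans (ler_norm _); rewrite /M; case: cid => //= N'; apply.
Qed.

Lemma mbdd_bounded m n (f : T -> 'M[R]_(m, n)) :
  mbdd A f -> [bounded f t | t in A].
Proof.
move=> [M fM]; exists M; split; first exact: num_real.
by move=> x Mx t At; exact: le_trans (fM t At) (ltW Mx).
Qed.

Lemma bounded_mbdd m n (f : T -> 'M[R]_(m, n)) :
  [bounded f t | t in A] -> mbdd A f.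
Proof. by move=> [M [_ fM]]; exists (M + 1) => t At; apply: fM => //; rewrite ltrDl. Qed.

End MatrixBounds.

Lemma mbdd_sub (R : realType) (T T' : Type) (A : set T) (B : set T') (h : T' -> T)
    m n (f : T -> 'M[R]_(m, n)) :
  mbdd A f -> (forall t, B t -> A (h t)) -> mbdd B (fun t => f (h t)).
Proof. by move=> [M fM] BA; exists M => t /BA; exact: fM. Qed.

Lemma eq_mbdd (R : realType) (T : Type) (A : set T) m n (f g : T -> 'M[R]_(m, n)) :
  (forall t, A t -> f t = g t) -> mbdd A f -> mbdd A g.
Proof. by move=> fg [M fM]; exists M => t At; rewrite -fg//; exact: fM. Qed.

(** * Compactness and reduction of the angles modulo full turns *)

Section Periodic.
Variable R : realType.

(** For a nonnegative radius the ball is the continuous image under [vec_mx] of a ball of row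
    vectors, to which Heine-Borel applies. *)
Lemma compact_cball m n (r : R) : compact [set A : 'M[R]_(m, n) | `|A| <= r].
Proof.
have [r0|r0] := ltP r 0.
  have -> : [set A : 'M[R]_(m, n) | `|A| <= r] = set0.
    apply/seteqP; split => // A /= Ar.
    by have := le_lt_trans Ar r0; rewrite ltNge normr_ge0.
  exact: compact0.
have -> : [set A : 'M[R]_(m, n) | `|A| <= r] =
    (fun v : 'rV[R]_(m * n) => vec_mx v) @` [set v | `|v| <= r].
  apply/seteqP; split => [A /= Ar|_ [v /= vr <-]].
    exists (mxvec A); last exact: mxvecK.
    apply/(mx_norm_leP _ r0) => i k; rewrite ord1.
    by case/mxvec_indexP: k => a b; rewrite mxvecE; exact: le_trans (mx_coord_le _ _ _) Ar.
  apply/(mx_norm_leP _ (le_trans (normr_ge0 _) vr)) => i j; rewrite mxE.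
  exact: le_trans (mx_coord_le _ _ _) vr.
apply: continuous_compact.
  apply: continuous_subspaceT; apply/continuous_mxP => i j.
  have -> : (fun v : 'rV[R]_(m * n) => vec_mx v i j) = (fun v => v 0 (mxvec_index i j)).
    by apply/funext => v; rewrite mxE.
  exact: coord_continuous.
apply: bounded_closed_compact.
  by exists r; split; [exact: num_real|move=> x rx v /= /le_trans]; apply; exact: ltW.
have -> : [set v : 'rV[R]_(m * n) | `|v| <= r] =
  (fun v => `|v|) @^-1` [set x : R | x <= r] by [].
by apply: preimage_closed; [move=> x _; exact: norm_continuous|exact: closed_le].
Qed.

Lemma continuous_mbdd (T : topologicalType) (K : set T) m n (f : T -> 'M[R]_(m, n)) :
  compact K -> continuous f -> mbdd K f.
Proof.
move=> cK cf; have : compact (f @` K).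
  by apply: continuous_compact => //; exact: continuous_subspaceT.
move=> /compact_bounded [M [_ fM]]; exists (M + 1) => t Kt.
by apply: fM; [rewrite ltrDl|exists t].
Qed.

Lemma torus_fun_turns (T : Type) (F : 'cV[R]_3 -> T) : torus_fun F ->
  forall eta (k : 'I_3) (z : int), F (eta + turn R k *~ z) = F eta.
Proof.
move=> FT eta k z; have natT (n : nat) eta' : F (eta' + turn R k *+ n) = F eta'.
  elim: n eta' => [|n IH] eta'; first by rewrite mulr0n addr0.
  by rewrite mulrS addrA IH FT.
case: z => n; first by rewrite -pmulrn natT.
by rewrite NegzE mulrNz -[LHS](natT n.+1) -pmulrn subrK.
Qed.

(** One representative serves all periodic functions, whatever their target. It is what restores
    compactness, since the lifted angles themselves are unbounded. *)
Lemma torus_fun_reduce (eta : 'cV[R]_3) : exists2 eta0 : 'cV[R]_3,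
  `|eta0| <= 2 * pi &
  forall (T : Type) (F : 'cV[R]_3 -> T), torus_fun F -> F eta0 = F eta.
Proof.
(* Removing the integer part of the number of turns brings each angle into [0, 2 pi). *)
pose z k : int := - Num.floor (eta k 0 / (2 * pi)).
have pi2 : 0 < 2 * pi :> R by rewrite mulr_gt0// pi_gt0.
exists (eta + \sum_k turn R k *~ z k).
  apply/(mx_norm_leP _ (ltW pi2)) => k j.
  rewrite !ord1 mxE summxE (bigD1 k)//= big1 => [|l lk].
    rewrite addr0 -scaler_int !mxE !eqxx mulr1 /z mulrNz mulNr.
    set y := eta k 0; have y_eq : y = y / (2 * pi) * (2 * pi).
      by rewrite divfK ?gt_eqF.
    have /andP[fl1 fl2] := floor_itv (y / (2 * pi)).
    rewrite intrD in fl2.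
    rewrite {1}y_eq -mulrBl normrM (gtr0_norm pi2).
    have y0 : 0 <= y / (2 * pi) - (Num.floor (y / (2 * pi)))%:~R by rewrite subr_ge0.
    rewrite (ger0_norm y0) ler_piMl ?(ltW pi2)//.
    by rewrite lerBlDr addrC ltW.
  rewrite -scaler_int !mxE eq_sym (negbTE lk)/=; ring.
move=> T F FT; rewrite big_ord_recl big_ord_recl big_ord1.
by rewrite !addrA !torus_fun_turns.
Qed.

End Periodic.

Section PoseBounds.
Variable R : realType.
Implicit Types x v : 'cV[R]_(3 + 3).

Lemma pose_fun_reduce x : exists x0 : 'cV[R]_(3 + 3),
  [/\ position x0 = position x, `|x0| <= `|position x| + 2 * pi &
  forall (T : Type) (F : 'cV[R]_(3 + 3) -> T), pose_fun F -> F x0 = F x].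
Proof.
have [eta0 eta0le eta0E] := torus_fun_reduce (angles x).
exists (col_mx (position x) eta0); split.
- by rewrite /position col_mxKu.
- have pi0 : 0 <= 2 * pi :> R by rewrite mulr_ge0// pi_ge0.
  have B0 : 0 <= `|position x| + 2 * pi by rewrite addr_ge0.
  apply/(mx_norm_leP _ B0) => i k; rewrite mxE; case: (fintype.split i) => i'.
    by apply: le_trans (mx_coord_le _ _ _) _; rewrite lerDl.
  apply: le_trans (mx_coord_le _ _ _) _; apply: le_trans eta0le _.
  by rewrite lerDr.
- move=> T F FP; rewrite -[in RHS](vsubmxK x).
  apply: (eta0E T (fun eta => F (col_mx (position x) eta))) => eta k.
  have -> : col_mx (position x) (eta + turn R k) =
      col_mx (position x) eta + col_mx 0 (turn R k).
    by rewrite add_col_mx addr0.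
  exact: FP.
Qed.

(** After reduction of the angles, [F] takes only values that it already takes on a compact ball of
    poses of radius [B + 2 * pi]; only the position and the velocity need a bound. *)
Lemma pose_fun_mbdd m n (F : 'cV[R]_(3 + 3) -> 'cV[R]_(3 + 3) -> 'M[R]_(m, n)) (B : R) :
  continuous (fun z : 'cV[R]_(3 + 3) * 'cV[R]_(3 + 3) => F z.1 z.2) ->
  (forall v, pose_fun (F^~ v)) ->
  mbdd [set z | `|position z.1| <= B /\ `|z.2| <= B] (fun z => F z.1 z.2).
Proof.
move=> cF FP.
have := continuous_mbdd (compact_setX (@compact_cball R _ 1 (B + 2 * pi))
  (@compact_cball R _ 1 B)) cF.
move=> [M FM]; exists M => -[x v] [/= xB vB].
have [x0 [_ x0le x0E]] := pose_fun_reduce x.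
rewrite -(x0E _ (F^~ v))//; apply: (FM (x0, v)); split => //=.
by apply: le_trans x0le _; rewrite lerD2r.
Qed.

(** The constant is the minimum of the quadratic form over reduced poses and the unit sphere,
    positive because it is attained; periodicity and homogeneity extend the bound to all poses and
    vectors. *)
Lemma pos_def_uniform (M : 'cV[R]_(3 + 3) -> 'M[R]_(3 + 3)) (B : R) :
  continuous M -> pose_fun M -> (forall x, pos_def (M x)) ->
  exists2 mu, 0 < mu & forall x (a : 'cV[R]_(3 + 3)), `|position x| <= B ->
    mu * `|a| ^+ 2 <= (a^T *m M x *m a) 0 0.
Proof.
move=> cM MP Mpos.
pose q (z : 'cV[R]_(3 + 3) * 'cV[R]_(3 + 3)) := (z.2^T *m M z.1 *m z.2) 0 0.
have cq : continuous q.
  case=> x a; have cM1 : M u.1 @[u --> (x, a)] --> M x.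
    apply: (@cvg_comp _ _ _ fst M _ (nbhs x)); [exact: cvg_fst|exact: cM].
  have c2 : u.2 @[u --> (x, a)] --> a by exact: cvg_snd.
  have /cvg_mxP : (u.2^T *m M u.1 *m u.2) @[u --> (x, a)] --> a^T *m M x *m a.
    refine (@cvg_mulmx R _ (nbhs (x, a)) _ _ _ _ (fun u => u.2^T *m M u.1) snd _ _ _ c2).
    refine (@cvg_mulmx R _ (nbhs (x, a)) _ _ _ _ (fun u => u.2^T) (fun u => M u.1) _ _ _ cM1).
    exact: cvg_trmx.
  exact.
pose K := [set x : 'cV[R]_(3 + 3) | `|x| <= B + 2 * pi] `*`
          [set a : 'cV[R]_(3 + 3) | `|a| = 1].
have cK : compact K.
  apply: compact_setX; first exact: compact_cball.
  apply: (subclosed_compact _ (@compact_cball R _ 1 1)); last by move=> a /= ->.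
  have -> : [set a : 'cV[R]_(3 + 3) | `|a| = 1] = (fun a => `|a|) @^-1` [set 1] by [].
  by apply: preimage_closed; [move=> x _; exact: norm_continuous|exact: closed_eq].
(* [K] is empty only when no pose satisfies the bound on the position, and then any positive
   constant will do. *)
have [K0|K0] := pselect (K !=set0); last first.
  exists 1 => // x a xB; exfalso; apply: K0.
  exists (0, const_mx 1); split => /=.
    rewrite normr0 addr_ge0//; first exact: le_trans (normr_ge0 _) xB.
    by rewrite mulr_ge0// pi_ge0.
  apply/eqP; rewrite eq_le; apply/andP; split.
    by apply/(mx_norm_leP _ ler01) => i j; rewrite mxE normr1.
  have := mx_coord_le (const_mx 1 : 'cV[R]_(3 + 3)) ord0 ord0.
  by rewrite mxE normr1.
have [[x1 a1] /set_mem[/= _ a1n] qmin] := compact_EVT_min K0 cK (continuous_subspaceT cq).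
have a10 : a1 != 0 by apply: contra_eq_neq a1n => ->; rewrite normr0 eq_sym oner_neq0.
exists (q (x1, a1)); first exact: Mpos.
move=> x a xB; have [->|a0] := eqVneq a 0.
  by rewrite normr0 expr0n/= mulr0 mulmx0 mxE.
have na0 : `|a| != 0 by rewrite normr_eq0.
have [x0 [_ x0le x0E]] := pose_fun_reduce x.
have Kz : K (x0, `|a|^-1 *: a).
  split => /=; first by apply: le_trans x0le _; rewrite lerD2r.
  by rewrite normrZ ger0_norm ?invr_ge0// mulVf.
have := qmin _ (mem_set Kz).
rewrite {2}/q /= (x0E _ _ MP) linearZ/= linearZ/= -!scalemxAl !mxE.
rewrite mulrA -expr2 -ler_pdivrMl; last by rewrite exprn_gt0// invr_gt0 normr_gt0.
by rewrite exprVn invrK mulrC.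
Qed.

End PoseBounds.

(** * Barriers and the logarithmic error transform *)

Section Barrier.
Variable R : realType.

(** At the last time [s] before [t1] with [phi s <= c], the function exceeds [c] on all of (s, t1],
    so its derivative is nonpositive there, and the mean value theorem prevents it from having
    risen. *)
Lemma barrier (phi dphi : R -> R) (t0 T c : R) :
  phi @ t0^'+ --> phi t0 ->
  (forall t, t0 < t < T -> is_derive t 1 phi (dphi t)) ->
  phi t0 <= c ->
  (forall t, t0 < t < T -> c < phi t -> dphi t <= 0) ->
  forall t, t0 <= t < T -> phi t <= c.
Proof.
move=> c0 dphiP phi0 dneg t1 /andP[t01 t1T]; rewrite leNgt; apply/negP => ct1.
have {}t01 : t0 < t1.
  by rewrite lt_neqAle t01 andbT; apply/eqP => e; rewrite -e ltNge phi0 in ct1.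
pose S := [set s | t0 <= s <= t1 /\ phi s <= c].
have S0 : S t0 by split; [rewrite lexx ltW|].
have supS : has_sup S by split; [exists t0|exists t1 => s [/andP[]]].
set s := sup S.
have t0s : t0 <= s by exact: (sup_upper_bound supS).
have st1 : s <= t1 by apply: ge_sup; [exists t0|move=> r [/andP[]]].
have phis : phi s <= c.
  have [->//|t0s'] := eqVneq s t0.
  have {}t0s' : t0 < s by rewrite lt_neqAle eq_sym t0s' t0s.
  rewrite leNgt; apply/negP => cs.
  have /derivable1_diffP/differentiable_continuous cphi : derivable phi s 1.
    have sT : t0 < s < T by rewrite t0s' (le_lt_trans st1).
    by case: (dphiP s sT).
  have /nbhs_ballP[e /= e0 He] : \forall r \near s, c < phi r.
    exact: (cvgr_gt _ cphi).
  have [r Sr sr] := sup_adherent e0 supS.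
  have rs : r <= s by exact: (sup_upper_bound supS).
  have [_ rc] := Sr.
  have : c < phi r.
    by apply: He; rewrite /ball/= ger0_norm ?subr_ge0// ltrBlDr addrC -ltrBlDr.
  by rewrite ltNge rc.
have {}st1 : s < t1.
  by rewrite lt_neqAle st1 andbT; apply/eqP => e; rewrite e leNgt ct1 in phis.
have gtc r : s < r <= t1 -> c < phi r.
  move=> /andP[sr rt1]; rewrite ltNge; apply/negP => rc.
  have : r <= s by apply: (sup_upper_bound supS); split => //; rewrite rt1 (le_trans t0s)// ltW.
  by rewrite leNgt sr.
have cphi r : t0 < r < T -> phi @ r --> phi r.
  move=> rT; have /derivable1_diffP/differentiable_continuous// : derivable phi r 1.
  by case: (dphiP r rT).
have cw : {within `[s, t1], continuous phi}.
  apply/(continuous_within_itvP _ st1); split.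
  - move=> r; rewrite in_itv/= => /andP[sr rt1]; apply: cphi.
    by rewrite (le_lt_trans t0s)// (lt_trans rt1).
  - have [->//|t0s'] := eqVneq s t0.
    apply: cvg_at_right_filter; apply: cphi.
    by rewrite lt_neqAle eq_sym t0s' t0s (lt_trans st1).
  - by apply: cvg_at_left_filter; apply: cphi; rewrite t01.
have [|r] := @MVT R phi dphi s t1 st1 _ cw.
  move=> r; rewrite in_itv/= => /andP[sr rt1]; apply: dphiP.
  by rewrite (le_lt_trans t0s)// (lt_trans rt1).
rewrite in_itv/= => /andP[sr rt1] E.
have : phi t1 - phi s <= 0.
  rewrite E mulr_le0_ge0 ?subr_ge0 ?(ltW st1)//; apply: dneg.
    by rewrite (le_lt_trans t0s)// (lt_trans rt1).
  by apply: gtc; rewrite sr ltW.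
by rewrite subr_le0 leNgt (le_lt_trans phis).
Qed.

(** [P] is an a priori assumption and [K] the stronger conclusion that it yields. The gap between
    them drives the argument: [K] at one time gives [P] for a little longer, and [P] on a whole
    interval is improved to [K] there. *)
Lemma continuous_induction (P K : R -> Prop) (t0 tau : R) :
  (t0 < tau -> K t0) ->
  (forall t, t0 <= t < tau -> K t ->
    exists2 e, 0 < e & forall s, t <= s < t + e -> s < tau -> P s) ->
  (forall T, T <= tau -> (forall t, t0 <= t < T -> P t) ->
    forall t, t0 <= t < T -> K t) ->
  (forall t, t0 < t < tau -> (forall s, t0 <= s < t -> K s) -> K t) ->
  forall t, t0 <= t < tau -> K t.
Proof.
move=> K0 Kopen PK Kcl t1 /andP[t01 t1tau].
have t0tau : t0 < tau by exact: le_lt_trans t1tau.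
pose S := [set s | t0 <= s <= t1 /\ forall r, t0 <= r <= s -> K r].
have S0 : S t0.
  split; first by rewrite lexx.
  by move=> r /le_anti <-; exact: K0.
have supS : has_sup S by split; [exists t0|exists t1 => s [/andP[]]].
set s := sup S.
have t0s : t0 <= s by exact: (sup_upper_bound supS).
have st1 : s <= t1 by apply: ge_sup; [exists t0|move=> r [/andP[]]].
have Kl r : t0 <= r < s -> K r.
  move=> /andP[t0r]; rewrite -subr_gt0 => rs.
  have [u [/andP[u0 u1] uK]] := sup_adherent rs supS.
  by rewrite subKr => ru; apply: uK; rewrite t0r ltW.
have stau : s < tau by exact: le_lt_trans t1tau.
have Ks : K s.
  have [->|t0s'] := eqVneq s t0; first exact: K0.
  by apply: Kcl => //; rewrite lt_neqAle eq_sym t0s' t0s.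
have KP r : t0 <= r < tau -> K r -> P r.
  move=> rt Kr; have [e e0 eP] := Kopen r rt Kr.
  by apply: eP; [rewrite lexx ltrDl|case/andP: rt].
have [e e0 eP] := Kopen s (introT andP (conj t0s stau)) Ks.
(* [P] holds before [s] because [K] does, and just after [s] by openness; improving it to [K] beyond
   [s] contradicts the choice of [s] as a supremum, unless [t1] has been reached. *)
have Kr : forall t, t0 <= t < Num.min (s + e) tau -> K t.
  apply: PK; first by rewrite ge_min lexx orbT.
  move=> t /andP[t0t]; rewrite lt_min => /andP[tse ttau].
  have [ts|st] := ltP t s; last by apply: eP; rewrite ?st.
  by apply: KP; [rewrite t0t|apply: Kl; rewrite t0t].
have [t1se|se] := ltP t1 (s + e); first by apply: Kr; rewrite t01 lt_min t1se t1tau.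
have : s + e / 2 <= s.
  apply: (sup_upper_bound supS); split.
    by apply/andP; split; lra.
  move=> r /andP[t0r rs]; apply: Kr; rewrite t0r lt_min.
  by apply/andP; split; lra.
lra.
Qed.

End Barrier.

Section LogRatio.
Variable R : realType.
Implicit Types z E : R.

(** This is tanh(E/2), the inverse of [log_ratio]: it turns a bound on a transformed error into a
    distance to the funnel boundary. *)
Definition threshold E : R := (expR E - 1) / (expR E + 1).

Lemma threshold_ge0 E : 0 <= E -> 0 <= threshold E.
Proof.
move=> E0; apply: divr_ge0; last by rewrite addr_ge0 ?expR_ge0.
by rewrite subr_ge0 -expR0 ler_expR.
Qed.

Lemma threshold_lt1 E : threshold E < 1.
Proof.
have := expR_gt0 E => E0; rewrite ltr_pdivrMr ?addr_gt0// mul1r; lra.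
Qed.

Lemma log_ratioN z : `|z| < 1 -> log_ratio (- z) = - log_ratio z.
Proof.
rewrite ltr_norml => /andP[z1 z2]; rewrite /log_ratio opprK.
rewrite -lnV ?invf_div//; rewrite posrE divr_gt0//; lra.
Qed.

Lemma lt_log_ratio z1 z2 : -1 < z1 -> z1 < z2 -> z2 < 1 -> log_ratio z1 < log_ratio z2.
Proof.
move=> h1 h2 h3; rewrite /log_ratio ltr_ln ?posrE ?divr_gt0//; try lra.
rewrite ltr_pdivrMr; last lra.
rewrite mulrAC ltr_pdivlMr; last lra.
nra.
Qed.

Lemma log_ratio_threshold E : log_ratio (threshold E) = E.
Proof.
rewrite /log_ratio /threshold; have E0 := expR_gt0 E.
rewrite (_ : _ / _ = expR E) ?expRK//; field.
by apply/andP; split; lra.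
Qed.

Lemma log_ratio_le_threshold z E : 0 <= E -> `|z| < 1 -> `|log_ratio z| <= E ->
  `|z| <= threshold E.
Proof.
move=> E0 z1 zE; have t0 := threshold_ge0 E0; have t1 := threshold_lt1 E.
have aux z' : `|z'| < 1 -> log_ratio z' <= E -> z' <= threshold E.
  rewrite ltr_norml => /andP[h1 h2] h3; rewrite leNgt; apply/negP => h4.
  move: h3; rewrite leNgt => /negP; apply; rewrite -[E in E < _]log_ratio_threshold.
  by apply: lt_log_ratio => //; lra.
rewrite ler_norml; apply/andP; split.
  rewrite lerNl; apply: aux; first by rewrite normrN.
  rewrite log_ratioN//; move: zE; rewrite ler_norml => /andP[]; lra.
apply: aux => //; apply: le_trans zE; exact: ler_norm.
Qed.

Lemma log_ratio0 : log_ratio (0 : R) = 0.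
Proof. by rewrite /log_ratio addr0 subr0 divr1 ln1. Qed.

Lemma log_ratio_le z th : `|z| <= th -> th < 1 -> `|log_ratio z| <= log_ratio th.
Proof.
move=> zth th1; have th0 : 0 <= th by exact: le_trans zth.
have aux z' : `|z'| <= th -> log_ratio z' <= log_ratio th.
  rewrite ler_norml => /andP[h1 h2].
  have [->//|ne] := eqVneq z' th.
  by apply: ltW; apply: lt_log_ratio => //; [lra|rewrite lt_neqAle ne].
rewrite ler_norml aux// andbT lerNl -log_ratioN; last exact: le_lt_trans th1.
by apply: aux; rewrite normrN.
Qed.

Lemma log_ratio_mul_ge0 z : `|z| < 1 -> 0 <= z * log_ratio z.
Proof.
rewrite ltr_norml => /andP[h1 h2]; have [z0|z0|->] := ltgtP z 0.
- have := @lt_log_ratio z 0; rewrite log_ratio0 => /(_ h1 z0 ltr01) h; nra.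
- have := @lt_log_ratio 0 z; rewrite log_ratio0 => /(_ _ z0 h2) h.
  by apply: mulr_ge0; [exact: ltW|apply/ltW/h; lra].
- by rewrite mul0r.
Qed.

Lemma is_derive_log_ratio z : `|z| < 1 ->
  is_derive z 1 (@log_ratio R) (2 / (1 - z ^+ 2)).
Proof.
rewrite ltr_norml => /andP[h1 h2].
(* Splitting the logarithm of the quotient requires both factors to be positive, which holds only
   near [z]. *)
have e : \forall y \near z, ln (1 + y) - ln (1 - y) = log_ratio y.
  near=> y.
  have y1 : -1 < y by near: y; exact: lt_nbhsr.
  have y2 : y < 1 by near: y; exact: lt_nbhsl.
  rewrite /log_ratio ln_div ?posrE//; lra.
apply: (near_eq_is_derive e).
have d1 : is_derive z 1 (fun y : R => 1 + y) 1.
  apply: is_derive_eq (is_deriveD (is_derive_cst (1 : R) z 1) (is_derive_id z 1)) _.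
  by rewrite add0r.
have d2 : is_derive z 1 (fun y : R => 1 - y) (-1).
  apply: is_derive_eq (is_deriveB (is_derive_cst (1 : R) z 1) (is_derive_id z 1)) _.
  by rewrite sub0r.
have l1 : is_derive (1 + z) 1 (@ln R) (1 + z)^-1 by apply: is_derive1_ln; lra.
have l2 : is_derive (1 - z) 1 (@ln R) (1 - z)^-1 by apply: is_derive1_ln; lra.
have c1 : is_derive z 1 (@ln R \o (fun y : R => 1 + y)) ((1 + z)^-1 * 1).
  exact: is_derive1_comp.
have c2 : is_derive z 1 (@ln R \o (fun y : R => 1 - y)) ((1 - z)^-1 * -1).
  exact: is_derive1_comp.
have n1 : 1 + z != 0 by rewrite gt_eqF//; lra.
have n2 : 1 - z != 0 by rewrite gt_eqF//; lra.
have -> : 2 / (1 - z ^+ 2) = (1 + z)^-1 * 1 - (1 - z)^-1 * -1.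
  rewrite (_ : 1 - z ^+ 2 = (1 - z) * (1 + z)); last by ring.
  by field; rewrite n1 n2.
exact: (is_deriveB c1 c2).
Unshelve. all: by end_near. Qed.

End LogRatio.

(** * Peano's theorem *)

Lemma ultra_fmap (S T : Type) (f : S -> T) (F : set_system S) :
  UltraFilter F -> UltraFilter (f @ F).
Proof.
move=> FU; split => [|G FG sFG]; first exact: fmap_proper_filter.
apply/seteqP; split => A GA; last exact: sFG.
have [//|FA] := in_ultra_setVsetC (f @^-1` A) FU.
have GnA : G (~` A) by apply: sFG.
have /filter_ex[x []//] : G (A `&` ~` A) by exact: filterI.
Qed.

Section Peano.
Variables (R : realType) (d : nat) (f : R -> 'cV[R]_d -> 'cV[R]_d) (L : R).
Hypothesis L0 : 0 <= L.
Hypothesis fL : forall t y, `|f t y| <= L.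
Hypothesis cf : continuous (fun p : R * 'cV[R]_d => f p.1 p.2).
Variables (t0 : R).
Implicit Types (y z : R -> 'cV[R]_d) (h s t T : R).

(* An integral-free notion of approximate solution: if the field is e-close
   to a constant c on the tube that y can reach during [s, t] (with delay h),
   then the increment of y over [s, t] is e-close to that of slope c. *)
Definition tracks h T y : Prop :=
  forall s t (c : 'cV[R]_d) (e : R), t0 <= s -> s <= t -> t <= T -> 0 <= e ->
  (forall r (w : 'cV[R]_d), s - h <= r <= t -> `|w - y s| <= L * (t - s + h) ->
    `|f r w - c| <= e) ->
  `|y t - y s - (t - s) *: c| <= e * (t - s).

Lemma tracks_lipschitz h T y s t : tracks h T y ->
  t0 <= s -> s <= t -> t <= T -> `|y t - y s| <= L * (t - s).
Proof.
move=> yT t0s st tT.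
have := yT s t 0 L t0s st tT L0; rewrite scaler0 subr0; apply.
by move=> r y' _ _; rewrite subr0.
Qed.

(** One Euler step, with the slope frozen at the end point [(T, y T)]. This point belongs to the
    delayed tube of every interval that reaches beyond [T]: even when [s] is past [T], the sampling
    time satisfies [T >= s - h]. This is the purpose of the delay in [tracks]. *)
Lemma tracks_step h T y : 0 <= h -> t0 <= T -> tracks h T y ->
  tracks h (T + h) (fun t => if t <= T then y t else y T + (t - T) *: f T (y T)).
Proof.
move=> h0 t0T yT s t c e t0s st tTh e0 H.
have [tT|Tt] := leP t T.
  rewrite (le_trans st tT) in H *.
  exact: yT.
have [sT|Ts] := leP s T.
  have -> : y T + (t - T) *: f T (y T) - y s - (t - s) *: c =
      (y T - y s - (T - s) *: c) + (t - T) *: (f T (y T) - c).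
    by apply/matrixP => i j; rewrite !mxE; ring.
  rewrite sT in H; apply: le_trans (ler_normD _ _) _.
  rewrite (_ : e * (t - s) = e * (T - s) + e * (t - T)); last by ring.
  apply: lerD.
    apply: yT => // r y' /andP[r1 r2] y'y; apply: H; first by rewrite r1 (le_trans r2)// ltW.
    by apply: le_trans y'y _; rewrite ler_wpM2l// !lerD// ltW.
  rewrite normrZ ger0_norm ?subr_ge0 ?(ltW Tt)// [leLHS]mulrC ler_wpM2r ?subr_ge0 ?(ltW Tt)//.
  apply: H; first by rewrite (ltW Tt) lerBlDr (le_trans sT)// lerDl.
  apply: le_trans (tracks_lipschitz yT t0s sT (lexx _)) _.
  by rewrite ler_wpM2l// lerBlDr addrAC subrK ler_wpDr// ltW.
rewrite leNgt Ts/= in H.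
have -> : y T + (t - T) *: f T (y T) - (y T + (s - T) *: f T (y T)) - (t - s) *: c =
    (t - s) *: (f T (y T) - c).
  by apply/matrixP => i j; rewrite !mxE; ring.
rewrite normrZ ger0_norm ?subr_ge0// [leLHS]mulrC ler_wpM2r ?subr_ge0//.
apply: H; first by apply/andP; split; lra.
have -> : y T - (y T + (s - T) *: f T (y T)) = - ((s - T) *: f T (y T)).
  by apply/matrixP => i j; rewrite !mxE; ring.
rewrite normrN normrZ ger0_norm ?subr_ge0 ?(ltW Ts)// mulrC.
by apply: ler_pM => //; lra.
Qed.

Lemma tracks_iter h T y n : 0 <= h -> t0 <= T -> tracks h T y ->
  exists y', tracks h (T + n%:R * h) y' /\ forall t, t <= T -> y' t = y t.
Proof.
move=> h0 t0T yT; elim: n => [|n [y' [y'T y'y]]].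
  by exists y; rewrite mul0r addr0.
have nh0 : 0 <= n%:R * h by rewrite mulr_ge0.
have TT : T <= T + n%:R * h by rewrite lerDl.
eexists; split.
  rewrite -natr1 mulrDl mul1r addrA; apply: tracks_step y'T => //.
  exact: le_trans TT.
by move=> t tT /=; rewrite (le_trans tT TT) y'y.
Qed.

(** An exact solution tracks with any delay, so Euler steps can be appended to it. The mean value
    theorem replaces integration. *)
Lemma solution_tracks h T z : 0 <= h ->
  z @ t0^'+ --> z t0 ->
  (forall t, t0 < t <= T -> is_derive t 1 z (f t (z t))) ->
  tracks h T z.
Proof.
move=> h0 zc zd s t c e t0s; rewrite le_eqVlt => /predU1P[<- _ _ _|st tT e0 H].
  by rewrite !subrr scale0r subr0 normr0 mulr0.
(* The intermediate time depends on the coordinate, which is harmless because the matrix norm is the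
   largest entry. *)
have incr s' t' k : t0 <= s' -> s' < t' -> t' <= T -> exists r,
    s' < r < t' /\ z t' k 0 - z s' k 0 = f r (z r) k 0 * (t' - s').
  move=> t0s' st' t'T.
  have dz r : t0 < r <= T -> is_derive r 1 (fun u => z u k 0) (f r (z r) k 0).
    move=> rT; have [dr er] := zd r rT; split.
      by move/derivable_mxP: dr; apply.
    by rewrite -er derive_mx// mxE.
  have cz r : t0 < r <= T -> (fun u => z u k 0) @ r --> z r k 0.
    move=> rT; have /derivable1_diffP/differentiable_continuous// :
      derivable (fun u => z u k 0) r 1 by case: (dz r rT).
  have [||r] := @MVT R (fun u => z u k 0) (fun r => f r (z r) k 0) s' t' st'.
  - move=> r; rewrite in_itv/= => /andP[r1 r2]; apply: dz.
    by apply/andP; split; lra.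
  - apply/(continuous_within_itvP _ st'); split.
    + move=> r; rewrite in_itv/= => /andP[r1 r2]; apply: cz.
      by apply/andP; split; lra.
    + have [->|st0] := eqVneq s' t0; first by move/cvg_mxP: zc; apply.
      apply: cvg_at_right_filter; apply: cz.
      by rewrite lt_neqAle eq_sym st0 t0s'/= ltW// (lt_le_trans st').
    + by apply: cvg_at_left_filter; apply: cz; rewrite (le_lt_trans t0s').
  - by rewrite in_itv/= => rI E; exists r.
have lip s' t' : t0 <= s' -> s' < t' -> t' <= T -> `|z t' - z s'| <= L * (t' - s').
  move=> t0s' st' t'T.
  have Lt : 0 <= L * (t' - s') by rewrite mulr_ge0// subr_ge0 ltW.
  apply/(mx_norm_leP _ Lt) => k j; rewrite !ord1 !mxE.
  have [r [_ ->]] := incr s' t' k t0s' st' t'T.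
  rewrite normrM [`|t' - s'|]ger0_norm ?subr_ge0 ?(ltW st')//.
  rewrite ler_wpM2r ?subr_ge0 ?(ltW st')//.
  exact: le_trans (mx_coord_le _ _ _) (fL _ _).
have et : 0 <= e * (t - s) by rewrite mulr_ge0// subr_ge0 ltW.
apply/(mx_norm_leP _ et) => k j; rewrite !ord1 !mxE.
have [r [/andP[sr rt] ->]] := incr s t k t0s st tT.
rewrite mulrC -mulrBr normrM ger0_norm ?subr_ge0 ?(ltW st)// [leLHS]mulrC.
rewrite ler_wpM2r ?subr_ge0 ?(ltW st)//.
have : `|f r (z r) - c| <= e.
  apply: H; first by apply/andP; split; lra.
  apply: le_trans (lip s r t0s sr _) _; first by lra.
  by rewrite ler_wpM2l//; lra.
by apply: le_trans; apply: le_trans (mx_coord_le _ k 0); rewrite !mxE.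
Qed.

(* A pointwise limit of approximate solutions along an ultrafilter is an exact
   solution; no uniform convergence is required. *)
Lemma tracks_limit (hn Tn : nat -> R) (yn : nat -> R -> 'cV[R]_d) (y0 : 'cV[R]_d) :
  (forall n, 0 <= hn n) ->
  hn @ \oo --> 0 -> Tn @ \oo --> +oo ->
  (forall n, yn n t0 = y0) -> (forall n, tracks (hn n) (Tn n) (yn n)) ->
  exists Y : R -> 'cV[R]_d,
    [/\ forall t (w : 'cV[R]_d), t0 <= t -> (\forall n \near \oo, yn n t = w) -> Y t = w,
        Y @ t0^'+ --> Y t0 &
        forall t, t0 < t -> is_derive t 1 Y (f t (Y t))].
Proof.
move=> hn0 hnc Tnc yn0 ynT.
(* Along an ultrafilter finer than [\oo], a sequence that is eventually in a compact set converges;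
   no subsequence has to be extracted, and the same [U] serves every time [t]. *)
have [U [UU sU]] := @ultraFilterLemma nat \oo eventually_filter.
have UT t : \forall n \near U, t <= Tn n.
  by apply: sU; move/cvgryPge: Tnc; apply.
(* All [yn n] start from [y0] and are Lipschitz with constant [L], so their values at [t] lie in a
   fixed ball as soon as [t <= Tn n]. *)
have Yex t : t0 <= t -> exists Yt : 'cV[R]_d, yn n t @[n --> U] --> Yt.
  move=> t0t.
  have := @compact_cball R d 1 (`|y0| + L * (t - t0)); rewrite compact_ultra.
  move=> /(_ _ (ultra_fmap (fun n => yn n t) UU)) [|Yt [_ HY]]; last by exists Yt.
  have := UT t; apply: filterS => n tT /=.
  have := tracks_lipschitz (ynT n) (lexx _) t0t tT; rewrite yn0 => ynl.
  have -> : yn n t = y0 + (yn n t - y0) by rewrite addrC subrK.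
  by apply: le_trans (ler_normD _ _) _; rewrite lerD2l.
pose Y t := if pselect (t0 <= t) is left h then sval (cid (Yex t h)) else 0.
have YP t : t0 <= t -> yn n t @[n --> U] --> Y t.
  by move=> t0t; rewrite /Y; case: pselect => // h; case: cid.
(* This first-order expansion of the limit at [t] gives both its right continuity at [t0] and its
   derivative at later times. *)
have incr t e : t0 <= t -> 0 < e -> exists2 del, 0 < del &
    forall s, t0 <= s -> `|s - t| < del ->
      `|Y s - Y t - (s - t) *: f t (Y t)| <= e * `|s - t|.
  move=> t0t e0.
  have cft : (fun p : R * 'cV[R]_d => f p.1 p.2) @ (t, Y t) --> f t (Y t) by exact: (@cf (t, Y t)).
  have /cvgrPdist_le/(_ _ e0)/nbhs_ballP[del /= del0 Hdel] := cft.
  (* Since [L * del' + del' = del / 4], the tube around [yn n] over an interval shorter than [del'],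
     with delay at most [del'], stays in the [del]-neighbourhood of [(t, Y t)]: the three distances
     involved are less than [del / 4], at most [del / 4] and at most [del / 2]. *)
  pose del' := del / (4 * (L + 1)).
  have L0' := L0; have L1 : 0 < 4 * (L + 1) by lra.
  have del'0 : 0 < del' by rewrite divr_gt0.
  have del'L : L * del' + del' = del / 4.
    by rewrite /del'; field; rewrite gt_eqF//; lra.
  have LD : 0 <= L * del' by rewrite mulr_ge0// ltW.
  (* With [t] allowed at either end, increments to the right and to the left of [t] are treated
     together. *)
  have core a b : t0 <= a -> a <= b -> b - a < del' -> (a = t \/ b = t) ->
      `|Y b - Y a - (b - a) *: f t (Y t)| <= e * (b - a).
    move=> t0a ab ba abt.
    have cl : `|yn n b - yn n a - (b - a) *: f t (Y t)| @[n --> U] -->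
        `|Y b - Y a - (b - a) *: f t (Y t)|.
      apply: cvg_norm; apply: cvgB; last exact: cvg_cst.
      by apply: cvgB; apply: YP => //; exact: le_trans ab.
    apply: (cvgr_to_le cl).
    have hd : \forall n \near U, hn n <= del'.
      by apply: sU; apply: (cvgr_le _ hnc).
    have yd : \forall n \near U, `|Y t - yn n t| < del / 4.
      by have /cvgrPdist_lt := YP t t0t; apply; rewrite divr_gt0.
    near=> n.
    have bT : b <= Tn n by near: n.
    have hnd : hn n <= del' by near: n.
    have ynt : `|Y t - yn n t| < del / 4 by near: n.
    apply: (ynT n a b) => //; first exact: ltW.
    move=> r y' /andP[r1 r2] y'y.
    rewrite distrC; apply: (Hdel (r, y')); split => /=.
      by rewrite /ball/= ltr_norml; apply/andP; split; case: abt => ?; subst; nra.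
    have y'a : `|y' - yn n a| <= del / 2.
      apply: le_trans y'y _; have : L * (b - a + hn n) <= L * (2 * del').
        by rewrite ler_wpM2l//; lra.
      nra.
    have yat : `|yn n a - yn n t| <= L * del'.
      case: abt => E; subst; first by rewrite subrr normr0.
      rewrite distrC; apply: le_trans (tracks_lipschitz (ynT n) t0a ab bT) _.
      by rewrite ler_wpM2l// ltW.
    rewrite mx_norm_ball /ball_/=.
    have -> : Y t - y' = (Y t - yn n t) - (yn n a - yn n t) - (y' - yn n a).
      by apply/matrixP => i j; rewrite !mxE; ring.
    apply: le_lt_trans (ler_normB _ _) _.
    have := ler_normB (Y t - yn n t) (yn n a - yn n t).
    lra.
  exists del' => // s t0s; have [ts|st] := leP t s.
    rewrite ger0_norm ?subr_ge0// => sd; apply: core => //; by left.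
  rewrite distrC ger0_norm ?subr_ge0 ?(ltW st)// => sd.
  have := core s t t0s (ltW st) sd (or_intror erefl).
  rewrite -normrN; congr (`|_| <= _).
  by apply/matrixP => i j; rewrite !mxE; ring.
exists Y; split.
- move=> t z t0t yz; have /cvg_lim <-// := YP t t0t.
  apply/cvg_lim => //; apply: cvg_near_cst.
  by apply: sU.
- apply/cvgrPdist_le => e e0.
  have [del del0 H] := incr t0 1 (lexx _) ltr01.
  pose K := `|f t0 (Y t0)| + 1.
  have K0 : 0 < K by rewrite ltr_wpDl.
  near=> s.
  have t0s : t0 < s by near: s; exact: nbhs_right_gt.
  have sd : s < t0 + del by near: s; apply: nbhs_right_lt; rewrite ltrDl.
  have se : s < t0 + e / K by near: s; apply: nbhs_right_lt; rewrite ltrDl divr_gt0.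
  have s0 : 0 <= s - t0 by rewrite subr_ge0 ltW.
  have := H s (ltW t0s); rewrite !(ger0_norm s0) ltrBlDl => /(_ sd) H1.
  rewrite distrC.
  have -> : Y s - Y t0 = (Y s - Y t0 - (s - t0) *: f t0 (Y t0)) + (s - t0) *: f t0 (Y t0).
    by rewrite subrK.
  apply: le_trans (ler_normD _ _) _; rewrite normrZ (ger0_norm s0).
  have : (s - t0) * K <= e by rewrite -ler_pdivlMr// lerBlDl ltW.
  rewrite /K; nra.
- move=> t t0t.
  suff lm : h^-1 *: (Y (h *: 1 + t) - Y t) @[h --> 0^'] --> f t (Y t).
    split; last by apply/cvg_lim.
    by apply/cvg_ex; exists (f t (Y t)).
  apply/cvgrPdist_le => e e0.
  have [del del0 H] := incr t e (ltW t0t) e0.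
  near=> h.
  have hn0' : h != 0 by near: h; exact: nbhs_dnbhs_neq.
  have hd : `|h| < del by near: h; exact: dnbhs0_lt.
  have ht : `|h| < t - t0 by near: h; apply: dnbhs0_lt; rewrite subr_gt0.
  have hE : h *: (1 : R) + t = h + t by rewrite [_ *: _]mulr1.
  have := H (h + t); rewrite addrK => /(_ _ hd) H1.
  rewrite hE.
  have -> : f t (Y t) - h^-1 *: (Y (h + t) - Y t) =
     - (h^-1 *: (Y (h + t) - Y t - h *: f t (Y t))).
    rewrite [in RHS]scalerBr scalerA mulVf// scale1r opprB//.
  rewrite normrN normrZ normfV ler_pdivrMl ?normr_gt0// mulrC.
  apply: H1; move: ht; rewrite ltr_norml => /andP[]; lra.
Unshelve. all: by end_near. Qed.

(* Peano's theorem, in the form of prolonging a solution given on [t0, tau);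
   for tau <= t0 it is an existence theorem from the initial value z t0. *)
Theorem peano z (tau : R) :
  z @ t0^'+ --> z t0 ->
  (forall t, t0 < t < tau -> is_derive t 1 z (f t (z t))) ->
  exists Y : R -> 'cV[R]_d,
    [/\ forall t, t0 <= t < tau -> Y t = z t, Y t0 = z t0,
        Y @ t0^'+ --> Y t0 &
        forall t, t0 < t -> is_derive t 1 Y (f t (Y t))].
Proof.
move=> zc zd.
pose hn (n : nat) : R := n.+1%:R^-1.
(* The given solution is followed up to [sig n], which, when it exceeds [t0], stops short of [tau]
   because nothing is known of [z] at [tau] itself. *)
pose sig n := Num.max t0 (tau - hn n).
have hn0 n : 0 < hn n by rewrite invr_gt0.
have t0sig n : t0 <= sig n by rewrite le_max lexx.
have zT n : tracks (hn n) (sig n) z.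
  apply: solution_tracks => // [|t /andP[t1]]; first exact: ltW.
  rewrite le_max leNgt t1/= => t2; apply: zd; rewrite t1/= (le_lt_trans t2)//.
  by rewrite ltrBlDr ltrDl.
(* A number (n+1)^2 of Euler steps of length 1/(n+1) prolongs by n+1, so the horizons tend to
   infinity while the steps tend to zero. *)
have ex n := tracks_iter (n.+1 ^ 2) (ltW (hn0 n)) (t0sig n) (zT n).
pose yn n := sval (cid (ex n)).
have ynP1 n : tracks (hn n) (sig n + (n.+1 ^ 2)%:R * hn n) (yn n).
  by rewrite /yn; case: cid => ? [].
have ynP2 n t : t <= sig n -> yn n t = z t.
  by rewrite /yn; case: (cid (ex n)) => /= w [_ wz]; exact: wz.
have yn0 n : yn n t0 = z t0 by apply: ynP2.
have hnc : hn @ \oo --> 0 by exact: cvg_harmonic.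
have Tc : sig n + (n.+1 ^ 2)%:R * hn n @[n --> \oo] --> +oo.
  apply/cvgryPge => A; near=> n.
  apply: (@le_trans _ _ (t0 + n.+1%:R)).
    rewrite -lerBlDl; apply: le_trans (_ : n%:R <= _); last by rewrite ler_nat.
    near: n; exact: nbhs_infty_ger.
  by rewrite lerD// natrX expr2 -mulrA divff ?mulr1// pnatr_eq0.
have [Y [Y1 Y2 Y3]] := tracks_limit (fun n => ltW (hn0 n)) hnc Tc yn0 ynP1.
have Yt0 : Y t0 = z t0 by apply: Y1 => //; exact: nearW.
exists Y; split => // t /andP[t0t ttau].
apply: Y1 => //.
(* A time before [tau] eventually lies below [sig n], where every approximation coincides with [z];
   so does the limit. *)
have : \forall n \near \oo, hn n < tau - t by apply: (cvgr_lt _ hnc); rewrite subr_gt0.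
apply: filterS => n hnt; apply: ynP2.
by rewrite le_max lerBrDr addrC -lerBrDr (ltW hnt) orbT.
Unshelve. all: by end_near. Qed.

End Peano.

(** * Regularized dynamics *)

Section ContinuouslyDifferentiable.
Variable R : realType.
Implicit Types (p q : 'cV[R]_(3 + 3) -> R).

(** The derivative is required to be continuous jointly in the point and the direction, because the
    rate of the grasp map enters the dynamics as a field in pose and velocity. *)
Definition C1fun p : Prop :=
  [/\ continuous p, forall x v, derivable p x v &
      continuous (fun z : 'cV[R]_(3 + 3) * 'cV[R]_(3 + 3) => 'D_(z.2) p z.1)].

Lemma C1cst (c : R) : C1fun (fun=> c).
Proof.
split=> [|x v|]; [exact: cst_continuous|exact: derivable_cst|].
under eq_fun do rewrite derive_cst.
exact: cst_continuous.
Qed.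

Lemma C1D p q : C1fun p -> C1fun q -> C1fun (fun x => p x + q x).
Proof.
move=> [cp dp Dp] [cq dq Dq]; split=> [|x v|]; first exact: ctsD.
  exact: derivableD.
under eq_fun do rewrite (deriveD (dp _ _) (dq _ _)).
exact: ctsD.
Qed.

Lemma C1N p : C1fun p -> C1fun (fun x => - p x).
Proof.
move=> [cp dp Dp]; split=> [|x v|]; first exact: ctsN.
  exact: derivableN.
under eq_fun do rewrite (deriveN (dp _ _)).
exact: ctsN.
Qed.

Lemma C1M p q : C1fun p -> C1fun q -> C1fun (fun x => p x * q x).
Proof.
move=> [cp dp Dp] [cq dq Dq]; split=> [|x v|]; first exact: ctsM.
  exact: derivableM.
under eq_fun do rewrite (deriveM (dp _ _) (dq _ _)).
apply: ctsD; apply: ctsM; [|exact: Dq| |exact: Dp].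
  exact: (@cts_comp _ _ _ fst p (@cts_fst _ _) cp).
exact: (@cts_comp _ _ _ fst q (@cts_fst _ _) cq).
Qed.

Lemma C1sum (I : Type) (r : seq I) (p : I -> 'cV[R]_(3 + 3) -> R) :
  (forall i, C1fun (p i)) -> C1fun (fun x => \sum_(i <- r) p i x).
Proof.
move=> Cp; elim: r => [|i r IH].
  by under eq_fun do rewrite big_nil; exact: C1cst.
by under eq_fun do rewrite big_cons; exact: C1D.
Qed.

(** Smoothness gives the continuity of each directional derivative for a fixed direction. Linearity
    in the direction reduces the joint statement to the three basis directions. *)
Lemma C1_angles m n (F : 'cV[R]_3 -> 'M[R]_(m, n)) i j :
  smooth F -> C1fun (fun x => F (angles x) i j).
Proof.
move=> sF; have [cF [dF DF]] := (sF 0%N, sF 1%N); rewrite /= in cF dF DF.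
have dFv a v : derivable F a v by apply: diff_derivable; exact: dF.
have anglesL (h : R) x v : angles (h *: v + x) = h *: angles v + angles x.
  by rewrite /angles linearP.
have derE x v : (fun h => h^-1 *: (((fun x => F (angles x) i j) \o shift x) (h *: v)
    - F (angles x) i j)) = (fun h : R => h^-1 *: (((fun a => F a i j) \o shift (angles x))
     (h *: angles v) - F (angles x) i j)).
  by apply/funext => h /=; rewrite anglesL.
have canglesx : continuous (@angles R) by apply: cts_dsubmx; exact: cts_id.
split=> [|x v|].
- by apply: cts_coord; exact: cts_comp.
- rewrite /derivable derE.
  have : derivable (fun a => F a i j) (angles x) (angles v).
    by have /derivable_mxP := dFv (angles x) (angles v); apply.
  by [].
- have -> : (fun z : 'cV[R]_(3 + 3) * 'cV[R]_(3 + 3) =>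
      'D_(z.2) (fun x => F (angles x) i j) z.1) =
      (fun z => \sum_(k < 3) angles z.2 k 0 * ('D_(delta_mx k 0) F (angles z.1)) i j).
    apply/funext => -[x v] /=; rewrite {1}/derive derE.
    have -> : lim ((fun h : R => h^-1 *: (((fun a => F a i j) \o shift (angles x))
     (h *: angles v) - F (angles x) i j)) @ 0^') = ('D_(angles v) F (angles x)) i j.
      by rewrite derive_mx ?mxE.
    rewrite deriveE// {1}(matrix_sum_delta (angles v)) linear_sum/= summxE.
    apply: eq_bigr => k _; rewrite big_ord1 linearZ/= mxE.
    by rewrite deriveE.
  apply: cts_sum => k; apply: ctsM.
    apply: (@cts_coord _ _ _ _ (fun z => angles z.2)).
    exact: (@cts_comp _ _ _ snd (@angles R) (@cts_snd _ _) canglesx).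
  apply: (@cts_coord _ _ _ _ (fun z => 'D_(delta_mx k 0) F (angles z.1))).
  have cag : continuous (fun z : 'cV[R]_(3 + 3) * 'cV[R]_(3 + 3) => angles z.1).
    exact: (@cts_comp _ _ _ fst (@angles R) (@cts_fst _ _) canglesx).
  exact: (@cts_comp _ _ _ _ ('D_(delta_mx k 0) F) cag (DF _)).
Qed.

Definition C1mx m n (F : 'cV[R]_(3 + 3) -> 'M[R]_(m, n)) : Prop :=
  forall i j, C1fun (fun x => F x i j).

Lemma C1mx_mul m n k (F : 'cV[R]_(3 + 3) -> 'M[R]_(m, n))
    (G : 'cV[R]_(3 + 3) -> 'M[R]_(n, k)) :
  C1mx F -> C1mx G -> C1mx (fun x => F x *m G x).
Proof.
move=> CF CG i j; under eq_fun do rewrite mxE.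
by apply: C1sum => l; apply: C1M.
Qed.

Lemma C1mx_skew (a : 'cV[R]_(3 + 3) -> 'cV[R]_3) :
  C1mx a -> C1mx (fun x => Defs.skew (a x)).
Proof.
move=> Ca i j; under eq_fun do rewrite mxE.
case: i => [[|[|[|//]]] ?]; case: j => [[|[|[|//]]] ?] /=;
  solve [exact: C1cst|exact: Ca|apply: C1N; exact: Ca].
Qed.

Lemma C1mx_block m1 m2 n1 n2 (A : 'cV[R]_(3 + 3) -> 'M[R]_(m1, n1))
    (B : 'cV[R]_(3 + 3) -> 'M[R]_(m1, n2)) (C : 'cV[R]_(3 + 3) -> 'M[R]_(m2, n1))
    (D : 'cV[R]_(3 + 3) -> 'M[R]_(m2, n2)) :
  C1mx A -> C1mx B -> C1mx C -> C1mx D ->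
  C1mx (fun x => block_mx (A x) (B x) (C x) (D x)).
Proof.
move=> CA CB CC CD i j.
have [[i' ->]|[i' ->]] : (exists i', i = lshift m2 i') \/ (exists i', i = rshift m1 i').
  by case: (fintype.splitP i) => i' Hi; [left|right]; exists i'; exact/val_inj.
all: have [[j' ->]|[j' ->]] : (exists j', j = lshift n2 j') \/ (exists j', j = rshift n1 j').
  1,4: by case: (fintype.splitP j) => j' Hj; [left|right]; exists j'; exact/val_inj.
- by under eq_fun do rewrite block_mxEul.
- by under eq_fun do rewrite block_mxEur.
- by under eq_fun do rewrite block_mxEdl.
- by under eq_fun do rewrite block_mxEdr.
Qed.

Lemma C1mx_derivable m n (F : 'cV[R]_(3 + 3) -> 'M[R]_(m, n)) x v :
  C1mx F -> derivable F x v.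
Proof. by move=> CF; apply/derivable_mxP => i j; have [] := CF i j. Qed.

Lemma C1mx_continuous m n (F : 'cV[R]_(3 + 3) -> 'M[R]_(m, n)) :
  C1mx F -> continuous F.
Proof. by move=> CF; apply/continuous_mxP => i j; have [] := CF i j. Qed.

Lemma C1mx_derive_continuous m n (F : 'cV[R]_(3 + 3) -> 'M[R]_(m, n)) :
  C1mx F -> continuous (fun z : 'cV[R]_(3 + 3) * 'cV[R]_(3 + 3) => 'D_(z.2) F z.1).
Proof.
move=> CF; apply/continuous_mxP => i j.
have -> : (fun z : 'cV[R]_(3 + 3) * 'cV[R]_(3 + 3) => 'D_(z.2) F z.1 i j) =
    (fun z => 'D_(z.2) (fun x => F x i j) z.1).
  by apply/funext => z; rewrite derive_mx ?mxE//; exact: C1mx_derivable.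
by have [] := CF i j.
Qed.

End ContinuouslyDifferentiable.

(** * Fields in pose and velocity that are periodic in the angles *)

Section PoseFields.
Variable R : realType.

(** The hypotheses of [pose_fun_mbdd], bundled into a class closed under the algebraic operations
    from which the coupled dynamics are built. *)
Definition pose_field m n (F : 'cV[R]_(3 + 3) -> 'cV[R]_(3 + 3) -> 'M[R]_(m, n)) :
    Prop :=
  continuous (fun z : 'cV[R]_(3 + 3) * 'cV[R]_(3 + 3) => F z.1 z.2) /\
  forall v, pose_fun (F^~ v).

Lemma pose_field_mbdd m n (F : 'cV[R]_(3 + 3) -> 'M[R]_(m, n)) (B : R) :
  pose_field (fun x _ => F x) -> mbdd [set x | `|position x| <= B] F.
Proof.
move=> [cF pF].
apply: (mbdd_sub (h := fun x => (x, 0)) (pose_fun_mbdd (Num.max 0 B) cF pF)).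
move=> x /= xB; split=> /=; first by rewrite le_max xB orbT.
by rewrite normr0 le_max lexx.
Qed.

Lemma pose_fieldD m n (F G : 'cV[R]_(3 + 3) -> 'cV[R]_(3 + 3) -> 'M[R]_(m, n)) :
  pose_field F -> pose_field G -> pose_field (fun x v => F x v + G x v).
Proof.
move=> [cF pF] [cG pG]; split; first exact: ctsD.
by move=> v x k; rewrite pF pG.
Qed.

Lemma pose_fieldM m n p (F : 'cV[R]_(3 + 3) -> 'cV[R]_(3 + 3) -> 'M[R]_(m, n))
    (G : 'cV[R]_(3 + 3) -> 'cV[R]_(3 + 3) -> 'M[R]_(n, p)) :
  pose_field F -> pose_field G -> pose_field (fun x v => F x v *m G x v).
Proof.
move=> [cF pF] [cG pG]; split; first exact: cts_mulmx.
by move=> v x k; rewrite pF pG.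
Qed.

Lemma pose_field_tr m n (F : 'cV[R]_(3 + 3) -> 'cV[R]_(3 + 3) -> 'M[R]_(m, n)) :
  pose_field F -> pose_field (fun x v => (F x v)^T).
Proof.
move=> [cF pF]; split; first exact: cts_trmx.
by move=> v x k; rewrite pF.
Qed.

Lemma pose_field_sum (I : Type) (r : seq I) m n
    (F : I -> 'cV[R]_(3 + 3) -> 'cV[R]_(3 + 3) -> 'M[R]_(m, n)) :
  (forall i, pose_field (F i)) -> pose_field (fun x v => \sum_(i <- r) F i x v).
Proof.
move=> H; split; first by apply: cts_sum => i; have [] := H i.
by move=> v x k; apply: eq_bigr => i _; have [_ ->] := H i.
Qed.

Lemma pose_field_vel : pose_field (fun _ v => v).
Proof. by split=> //; exact: cts_snd. Qed.

Lemma pose_field_pose m n (F : 'cV[R]_(3 + 3) -> 'M[R]_(m, n)) :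
  continuous F -> pose_fun F -> pose_field (fun x _ => F x).
Proof.
move=> cF pF; split=> //.
exact: (@cts_comp _ _ _ fst F (@cts_fst _ _) cF).
Qed.

Lemma pose_field_derive m n (F : 'cV[R]_(3 + 3) -> 'M[R]_(m, n)) :
  C1mx F -> pose_fun F -> pose_field (fun x v => 'D_v F x).
Proof.
move=> CF pF; split; first exact: C1mx_derive_continuous.
move=> v x k; rewrite /derive.
have -> : (fun h : R => h^-1 *: ((F \o shift (x + col_mx 0 (turn R k))) (h *: v)
    - F (x + col_mx 0 (turn R k)))) =
    (fun h => h^-1 *: ((F \o shift x) (h *: v) - F x)).
  by apply/funext => h /=; rewrite addrA !pF.
by [].
Qed.

Lemma angles_shift (x : 'cV[R]_(3 + 3)) k :
  angles (x + col_mx 0 (turn R k)) = angles x + turn R k.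
Proof. by rewrite /angles linearD/= col_mxKd. Qed.

Lemma position_shift (x : 'cV[R]_(3 + 3)) k :
  position (x + col_mx 0 (turn R k)) = position x.
Proof. by rewrite /position linearD/= col_mxKu addr0. Qed.

End PoseFields.

(** * The coupled dynamics with Jacobians regular at every pose *)

Section RegularizedSystem.
Variables (R : realType) (N : nat) (nq : 'I_N -> nat) (s : manip_system R nq).
Hypothesis ok : manip_system_ok s.
Implicit Types (x v a : 'cV[R]_(3 + 3)) (t : R) (i : 'I_N).

(** The lever arm depends on the angles only, which makes the Jacobians periodic and bounded. *)
Lemma arm_eq i x : position x - position (fO s i x) = - (RO s (angles x) *m pEO s i).
Proof. by rewrite /fO /position col_mxKu opprD addrA subrr add0r. Qed.

Lemma angles_fO i x : angles (fO s i x) = angles x + alphaE s i.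
Proof. by rewrite /fO /angles col_mxKd. Qed.

Lemma JE_eq_JO i (eta : 'cV[R]_3) : JE s i (eta + alphaE s i) = JO s eta.
Proof.
apply/matrixP => k l; have /colP/(_ k) := grasp_omega ok i eta (delta_mx l 0).
by rewrite -!colE !mxE.
Qed.

(* As J_{E_i} = J_O along a rigid grasp, J_{O_i} is block unitriangular wherever
   it is defined; this is its extension to all poses. *)
Definition JR i x : 'M[R]_(3 + 3) :=
  block_mx 1%:M (Defs.skew (position x - position (fO s i x)) *m JO s (angles x))
           0 1%:M.

Lemma JOi_JR i x : \det (JO s (angles x)) != 0 -> JOi s i x = JR i x.
Proof.
move=> d; rewrite /JOi angles_fO JE_eq_JO mulVmx//.
by rewrite unitmxE unitfE.
Qed.

Lemma JR_inv i x : exists2 K : 'M[R]_(3 + 3), JR i x *m K = 1%:M &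
  K = block_mx 1%:M
    (- (Defs.skew (position x - position (fO s i x)) *m JO s (angles x))) 0 1%:M.
Proof.
eexists; last by [].
rewrite /JR mulmx_block !mul1mx !mul0mx !mulmx0 !mulmx1 !addr0 add0r addNr.
by rewrite -scalar_mx_block.
Qed.

Lemma JR_unit i x : JR i x \in unitmx.
Proof. by have [K /mulmx1_unit[]] := JR_inv i x. Qed.

Lemma C1mx_JR i : C1mx (JR i).
Proof.
have CJO : C1mx (fun x => JO s (angles x)).
  by move=> k l; apply: C1_angles; exact: JO_smooth ok.
have CRO : C1mx (fun x => RO s (angles x)).
  by move=> k l; apply: C1_angles; exact: RO_smooth ok.
have cst m n (A : 'M[R]_(m, n)) : C1mx (fun=> A) by move=> k l; exact: C1cst.
apply: C1mx_block; [exact: cst| |exact: cst|exact: cst].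
apply: C1mx_mul; last exact: CJO.
apply: C1mx_skew.
under eq_fun do rewrite arm_eq.
have : C1mx (fun x => RO s (angles x) *m pEO s i) by exact: C1mx_mul.
move=> H k l; under eq_fun do rewrite mxE.
exact: C1N.
Qed.

Lemma pose_fun_JR i : pose_fun (JR i).
Proof.
move=> x k; rewrite /JR !arm_eq angles_shift.
by rewrite (RO_torus ok) (JO_torus ok).
Qed.

Lemma pose_field_JR i : pose_field (fun x _ => JR i x).
Proof. by apply: pose_field_pose; [exact/C1mx_continuous/C1mx_JR|exact: pose_fun_JR]. Qed.

Lemma fO_shift i x k : fO s i (x + col_mx 0 (turn R k)) = fO s i x + col_mx 0 (turn R k).
Proof.
rewrite /fO position_shift angles_shift (RO_torus ok) add_col_mx addr0.
by congr col_mx; rewrite addrAC.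
Qed.

Lemma continuous_RO : continuous (fun x => RO s (angles x)).
Proof.
apply: (@cts_comp _ _ _ (@angles R)); last exact: (RO_smooth ok 0).
by apply: cts_dsubmx; exact: cts_id.
Qed.

Lemma continuous_JO : continuous (fun x => JO s (angles x)).
Proof.
apply: (@cts_comp _ _ _ (@angles R)); last exact: (JO_smooth ok 0).
by apply: cts_dsubmx; exact: cts_id.
Qed.

Lemma continuous_fO i : continuous (fO s i).
Proof.
have cst m n (T : topologicalType) (A : 'M[R]_(m, n)) : continuous (fun _ : T => A).
  exact: cst_continuous.
apply: cts_col_mx; apply: ctsD => //.
- by apply: cts_usubmx; exact: cts_id.
- by apply: cts_mulmx => //; exact: continuous_RO.
- by apply: cts_dsubmx; exact: cts_id.
- exact: cst.
Qed.

Lemma pose_field_agent m n (F : 'cV[R]_(3 + 3) -> 'cV[R]_(3 + 3) -> 'M[R]_(m, n)) i :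
  pose_field F -> pose_field (fun x v => F (fO s i x) (JR i x *m v)).
Proof.
move=> [cF pF]; split; last by move=> v x k; rewrite fO_shift pF pose_fun_JR.
apply: (@cts_comp _ _ _ (fun z : 'cV[R]_(3 + 3) * 'cV[R]_(3 + 3) =>
  (fO s i z.1, JR i z.1 *m z.2)) (fun z => F z.1 z.2)) => //.
apply: cts_pair; first exact: (@cts_comp _ _ _ fst (fO s i) (@cts_fst _ _) (@continuous_fO i)).
apply: cts_mulmx; last exact: cts_snd.
by have [] := pose_field_JR i.
Qed.

(** The coefficients of the coupled dynamics with [JR] in place of [JOi] and the block products
    expanded into sums over the agents; they are continuous at every pose, singular or not. *)
Definition MR x : 'M[R]_(3 + 3) :=
  MO s x + \sum_(i < N) (JR i x)^T *m Mag s i (fO s i x) *m JR i x.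

Definition CR x v : 'M[R]_(3 + 3) :=
  CO s x v
  + \sum_(i < N) (JR i x)^T *m Mag s i (fO s i x) *m 'D_v (JR i) x
  + \sum_(i < N) (JR i x)^T *m Cag s i (fO s i x) (JR i x *m v) *m JR i x.

Definition hR x v : 'cV[R]_(3 + 3) :=
  gO s x + \sum_(i < N) (JR i x)^T *m gag s i (fO s i x)
  + \sum_(i < N) (JR i x)^T *m fag s i (fO s i x) (JR i x *m v).

(* The disturbances are frozen at negative times, where they are arbitrary. *)
Definition wR x t : 'cV[R]_(3 + 3) :=
  wO s (Num.max 0 t) + \sum_(i < N) (JR i x)^T *m wag s i (Num.max 0 t).

Definition drift t x v : 'cV[R]_(3 + 3) := CR x v *m v + hR x v + wR x t.

Lemma pose_field_Mag i : pose_field (fun x _ => Mag s i (fO s i x)).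
Proof.
apply: (@pose_field_agent _ _ (fun x _ => Mag s i x)).
by apply: pose_field_pose; [exact: Mag_cont ok i|exact: Mag_pose ok i].
Qed.

Lemma pose_field_MR : pose_field (fun x _ => MR x).
Proof.
apply: pose_fieldD.
  by apply: pose_field_pose; [exact: MO_cont ok|exact: MO_pose ok].
apply: pose_field_sum => i; apply: pose_fieldM; last exact: pose_field_JR.
by apply: pose_fieldM; [exact: pose_field_tr (pose_field_JR i)|exact: pose_field_Mag].
Qed.

Lemma pose_field_CR : pose_field CR.
Proof.
apply: pose_fieldD; first apply: pose_fieldD.
- by split; [exact: CO_cont ok|move=> v; exact: (CO_pose ok)].
- apply: pose_field_sum => i; apply: pose_fieldM.
    by apply: pose_fieldM; [exact: pose_field_tr (pose_field_JR i)|exact: pose_field_Mag].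
  by apply: pose_field_derive; [exact: C1mx_JR|exact: pose_fun_JR].
- apply: pose_field_sum => i; apply: pose_fieldM; last exact: pose_field_JR.
  apply: pose_fieldM; first exact: pose_field_tr (pose_field_JR i).
  apply: pose_field_agent.
  by split; [exact: Cag_cont ok i|move=> v; exact: (Cag_pose ok)].
Qed.

Lemma pose_field_hR : pose_field hR.
Proof.
apply: pose_fieldD; first apply: pose_fieldD.
- by apply: pose_field_pose; [exact: gO_cont ok|exact: gO_pose ok].
- apply: pose_field_sum => i; apply: pose_fieldM; first exact: pose_field_tr (pose_field_JR i).
  apply: (@pose_field_agent _ _ (fun x _ => gag s i x)).
  by apply: pose_field_pose; [exact: gag_cont ok i|exact: gag_pose ok i].
- apply: pose_field_sum => i; apply: pose_fieldM; first exact: pose_field_tr (pose_field_JR i).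
  apply: pose_field_agent.
  by split; [exact: fag_cont ok i|move=> v; exact: (fag_pose ok)].
Qed.

(** Agent [i] adds the value at [JR i x *m a] of a positive definite form, so a lower bound for the
    inertia of the object alone suffices. *)
Lemma MR_quad x a : (a^T *m MO s x *m a) 0 0 <= (a^T *m MR x *m a) 0 0.
Proof.
rewrite /MR mulmxDr mulmxDl [leRHS]mxE lerDl mulmx_sumr mulmx_suml summxE.
apply: sumr_ge0 => i _; rewrite !mulmxA -trmx_mul -!mulmxA mulmxA.
have [->|b0] := eqVneq (JR i x *m a) 0; first by rewrite mulmx0 mxE.
exact/ltW/(Mag_pos ok).
Qed.

Lemma MR_unit x : MR x \in unitmx.
Proof.
rewrite unitmxE unitfE; apply/eqP => d0.
have /det0P[b b0 bM] : \det (MR x)^T == 0 by rewrite det_tr d0.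
have bT0 : b^T != 0 by apply: contra b0 => /eqP bT; rewrite -[b]trmxK bT trmx0.
have H : 0 < ((b^T)^T *m MO s x *m b^T) 0 0 by exact: (MO_pos ok).
have := lt_le_trans H (MR_quad x b^T); rewrite trmxK.
have -> : b *m MR x *m b^T = 0.
  have E : (b *m MR x *m b^T)^T = 0 by rewrite !trmx_mul trmxK mulmxA bM mul0mx.
  by rewrite -[LHS]trmxK E trmx0.
by rewrite mxE ltxx.
Qed.

Lemma continuous_clamped (w : R -> 'cV[R]_(3 + 3)) :
  {within [set t | 0 <= t], continuous w} -> continuous (fun t => w (Num.max 0 t)).
Proof.
move=> cw t.
have cm : (fun t : R => Num.max 0 t) @ t --> Num.max 0 t.
  by apply: (@cts_max _ R (fun=> 0) id); [exact: cst_continuous|exact: cts_id].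
have /cvgrPdist_le H : w @ within [set t | 0 <= t] (nbhs (Num.max 0 t)) --> w (Num.max 0 t).
  by move/subspace_continuousP: cw; apply; rewrite /= le_max lexx.
apply/cvgrPdist_le => e e0.
have h : nbhs t [set r : R | 0 <= Num.max 0 r ->
  `|w (Num.max 0 t) - w (Num.max 0 r)| <= e] := cm _ (H e e0).
by apply: filterS h => r /=; apply; rewrite le_max lexx.
Qed.

Lemma continuous_drift :
  continuous (fun z : R * ('cV[R]_(3 + 3) * 'cV[R]_(3 + 3)) => drift z.1 z.2.1 z.2.2).
Proof.
have c2 (F : 'cV[R]_(3 + 3) -> 'cV[R]_(3 + 3) -> 'cV[R]_(3 + 3)) : pose_field F ->
    continuous (fun z : R * ('cV[R]_(3 + 3) * 'cV[R]_(3 + 3)) => F z.2.1 z.2.2).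
  by move=> [cF _]; apply: (@cts_comp _ _ _ snd (fun z => F z.1 z.2) (@cts_snd _ _) cF).
have cJ i : continuous (fun z : R * ('cV[R]_(3 + 3) * 'cV[R]_(3 + 3)) => JR i z.2.1).
  apply: (@cts_comp _ _ _ (fun z : R * ('cV[R]_(3 + 3) * 'cV[R]_(3 + 3)) => z.2.1) (JR i)).
    exact: (@cts_comp _ _ _ snd fst (@cts_snd _ _) (@cts_fst _ _)).
  exact/C1mx_continuous/C1mx_JR.
have cw (w : R -> 'cV[R]_(3 + 3)) : {within [set t | 0 <= t], continuous w} ->
    continuous (fun z : R * ('cV[R]_(3 + 3) * 'cV[R]_(3 + 3)) => w (Num.max 0 z.1)).
  move=> /continuous_clamped cw.
  exact: (@cts_comp _ _ _ fst (fun t => w (Num.max 0 t)) (@cts_fst _ _) cw).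
apply: ctsD; first apply: ctsD.
- apply: (c2 (fun x v => CR x v *m v)); apply: pose_fieldM; first exact: pose_field_CR.
  exact: pose_field_vel.
- exact: c2 pose_field_hR.
- apply: ctsD; first exact/cw/(wO_cont ok).
  apply: cts_sum => i; apply: cts_mulmx; first exact: cts_trmx.
  exact/cw/(wag_cont ok).
Qed.

Lemma mbdd_JR i (B : R) : mbdd [set x | `|position x| <= B] (JR i).
Proof. exact/pose_field_mbdd/pose_field_JR. Qed.

Lemma mbdd_MR (B : R) : mbdd [set x | `|position x| <= B] MR.
Proof. exact/pose_field_mbdd/pose_field_MR. Qed.

Lemma mbdd_drift (B : R) :
  mbdd [set z : R * ('cV[R]_(3 + 3) * 'cV[R]_(3 + 3)) |
    `|position z.2.1| <= B /\ `|z.2.2| <= B] (fun z => drift z.1 z.2.1 z.2.2).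
Proof.
have bd (F : 'cV[R]_(3 + 3) -> 'cV[R]_(3 + 3) -> 'cV[R]_(3 + 3)) : pose_field F ->
  mbdd [set z : R * ('cV[R]_(3 + 3) * 'cV[R]_(3 + 3)) |
    `|position z.2.1| <= B /\ `|z.2.2| <= B] (fun z => F z.2.1 z.2.2).
  move=> [cF pF]; exact: (mbdd_sub (h := snd) (pose_fun_mbdd B cF pF)).
have wb (w : R -> 'cV[R]_(3 + 3)) : [bounded w t | t in [set t | 0 <= t]] ->
  mbdd [set z : R * ('cV[R]_(3 + 3) * 'cV[R]_(3 + 3)) |
    `|position z.2.1| <= B /\ `|z.2.2| <= B] (fun z => w (Num.max 0 z.1)).
  move=> /bounded_mbdd wb; apply: (mbdd_sub (h := fun z => Num.max 0 z.1) wb).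
  by move=> z _ /=; rewrite le_max lexx.
apply: mbddD; first apply: mbddD.
- apply: (bd (fun x v => CR x v *m v)); apply: pose_fieldM; first exact: pose_field_CR.
  exact: pose_field_vel.
- exact: bd pose_field_hR.
- apply: mbddD; first exact/wb/(wO_bounded ok).
  apply: mbdd_sum => i; apply: mbddM; last exact/wb/(wag_bounded ok).
  apply: mbdd_tr; apply: (mbdd_sub (h := fun z => z.2.1) (mbdd_JR i B)).
  by move=> z [].
Qed.

Lemma near_nonsingular x : \det (JO s (angles x)) != 0 ->
  \forall y \near x, \det (JO s (angles y)) != 0.
Proof.
have cd : continuous (fun x => \det (JO s (angles x))).
  by apply: cts_det; exact: continuous_JO.
move=> dx; exact: (cvgr_neq0 _ (cd x)).
Qed.

Lemma coupled_dynamicsE t x v a : 0 <= t -> \det (JO s (angles x)) != 0 ->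
  Mtilde s x *m a + Ctilde s x v *m v + htilde s x v + wtilde s x t =
  MR x *m a + drift t x v.
Proof.
move=> tge0 dx.
have GE : grasp_map s x = \mxcol_i JR i x.
  by rewrite /grasp_map; apply: eq_mxcol => i; rewrite JOi_JR.
have dGE : grasp_map_dot s x v = \mxcol_i 'D_v (JR i) x.
  rewrite /grasp_map_dot.
  (* The derivative sees only a neighbourhood of [x], in which the determinant is still nonzero and
     [JOi] agrees with [JR]. *)
  have -> : 'D_v (grasp_map s) x = 'D_v (fun y => \mxcol_i JR i y) x.
    apply: near_eq_derive; have := near_nonsingular dx.
    by apply: filterS => y dy; rewrite /grasp_map; apply: eq_mxcol => i; rewrite JOi_JR.
  rewrite derive_mx; last first.
    apply/derivable_mxP => k l; under eq_fun do rewrite mxE.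
    by have [_ dJ _] := C1mx_JR (tagnat.sig1 k) (tagnat.sig2 k) l; exact: dJ.
  apply/matrixP => k l; rewrite !mxE.
  rewrite derive_mx; last exact/C1mx_derivable/C1mx_JR.
  by rewrite mxE; under eq_fun do rewrite mxE.
rewrite /Mtilde /Ctilde /htilde /wtilde /drift /MR /CR /hR /wR /Mbar /Cbar /gbar /fbar /wbar.
rewrite GE dGE (max_idPr tge0) !tr_mxcol.
rewrite !mul_mxrow_mxdiag !mul_mxrow_mxcol.
have -> : \sum_i (JR i x)^T *m Cag s i (fO s i x) (JOi s i x *m v) *m JR i x =
    \sum_i (JR i x)^T *m Cag s i (fO s i x) (JR i x *m v) *m JR i x.
  by apply: eq_bigr => i _; rewrite JOi_JR.
have -> : \sum_i (JR i x)^T *m fag s i (fO s i x) (JOi s i x *m v) =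
    \sum_i (JR i x)^T *m fag s i (fO s i x) (JR i x *m v).
  by apply: eq_bigr => i _; rewrite JOi_JR.
by rewrite !addrA.
Qed.

Lemma nonsingular_poseE (mu : R) x :
  nonsingular_pose s mu x <-> mu <= `|\det (JO s (angles x))|.
Proof.
split=> [[]//|H]; split=> // i; by rewrite angles_fO JE_eq_JO.
Qed.

(** Inverting a block unitriangular matrix merely negates its off-diagonal block, so a bound on [JR]
    bounds its inverse without any estimate of determinants. *)
Lemma mbdd_invJR i (B : R) : mbdd [set x | `|position x| <= B] (fun x => invmx (JR i x)).
Proof.
have /(mbdd_sub (h := id)) JB := mbdd_JR i B.
have uB : mbdd [set x | `|position x| <= B]
    (fun x => Defs.skew (position x - position (fO s i x)) *m JO s (angles x)).
  have [M JM] := JB _ (fun _ => id).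
  exists M => x xB; apply/mx_norm_leP => [|k l].
    exact: le_trans (normr_ge0 _) (JM x xB).
  have := le_trans (mx_coord_le _ (lshift 3 k) (rshift 3 l)) (JM x xB).
  by rewrite /JR block_mxEur.
apply: (@eq_mbdd _ _ _ _ _ (fun x => block_mx 1%:M
  (- (Defs.skew (position x - position (fO s i x)) *m JO s (angles x))) 0 1%:M)).
  move=> x _; have [K JK KE] := JR_inv i x.
  by rewrite -KE -[RHS]mulmx1 -JK mulKmx// JR_unit.
by apply: mbdd_block; [exact: mbdd_cst|exact: mbddN|exact: mbdd_cst|exact: mbdd_cst].
Qed.


End RegularizedSystem.

(** * Confinement to the funnels *)

Section RealTools.
Variable R : realType.

Lemma mulmx_norm_le m n p (A : 'M[R]_(m, n)) (B : 'M[R]_(n, p)) :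
  `|A *m B| <= n%:R * `|A| * `|B|.
Proof.
have h : 0 <= n%:R * `|A| * `|B| by rewrite !mulr_ge0.
apply/(mx_norm_leP _ h) => i j; rewrite mxE.
apply: le_trans (ler_norm_sum _ _ _) _.
have -> : n%:R * `|A| * `|B| = \sum_(k < n) (`|A| * `|B|).
  by rewrite sumr_const card_ord -mulrA mulr_natl.
by apply: ler_sum => k _; rewrite normrM ler_pM ?mx_coord_le.
Qed.

Lemma dot_le n (u w : 'cV[R]_n) : `|(u^T *m w) 0 0| <= n%:R * `|u| * `|w|.
Proof.
apply: le_trans (mx_coord_le _ _ _) _; apply: le_trans (mulmx_norm_le _ _) _.
rewrite ler_wpM2r// ler_wpM2l//; apply/(mx_norm_leP _ (normr_ge0 _)) => i j.
by rewrite mxE; exact: mx_coord_le.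
Qed.

Lemma dotC n (u w : 'cV[R]_n) : (u^T *m w) 0 0 = (w^T *m u) 0 0.
Proof. by rewrite !mxE; apply: eq_bigr => k _; rewrite !mxE mulrC. Qed.

Lemma finite_lt1_bound (I : finType) (a : I -> R) : (forall i, a i < 1) ->
  exists2 th, 0 < th < 1 & forall i, a i <= th.
Proof.
(* The default value 1/2 keeps the bound positive even if every [a i] is nonpositive. *)
move=> a1; exists (\big[Num.max/2^-1]_i a i).
  apply/andP; split.
    apply: (@lt_le_trans _ _ 2^-1); first by rewrite invr_gt0.
    exact: bigmax_ge_id.
  by apply: bigmax_lt => // ; rewrite invf_lt1// ltr1n.
by move=> i; exact: le_bigmax.
Qed.

Lemma finite_bound (I : finType) (a : I -> R) : exists2 M, 0 <= M & forall i, a i <= M.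
Proof.
exists (\big[Num.max/0]_i a i); first exact: bigmax_ge_id.
by move=> i; exact: le_bigmax.
Qed.

Lemma square_le_norm (a b : R) : 0 <= b -> (a ^+ 2 <= b ^+ 2) = (`|a| <= b).
Proof. by move=> b0; rewrite -[a ^+ 2]real_normK ?num_real// ler_sqr ?nnegrE. Qed.

Lemma is_derive_coord m n (x : R -> 'M[R]_(m, n)) (dx : 'M[R]_(m, n)) (t : R) i j :
  is_derive t 1 x dx -> is_derive t 1 (fun u => x u i j) (dx i j).
Proof.
move=> [dxt <-]; split; first by move/derivable_mxP: dxt; apply.
by rewrite derive_mx// mxE.
Qed.

Lemma is_derive_mx m n (x : R -> 'M[R]_(m, n)) (dx : 'M[R]_(m, n)) (t : R) :
  (forall i j, is_derive t 1 (fun u => x u i j) (dx i j)) -> is_derive t 1 x dx.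
Proof.
move=> dij; have d : derivable x t 1.
  by apply/derivable_mxP => i j; have [] := dij i j.
split=> //; rewrite derive_mx//; apply/matrixP => i j; rewrite mxE.
by have [] := dij i j.
Qed.

Lemma is_derive_bigsum n (h : 'I_n -> R -> R) (t : R) (dh : 'I_n -> R) :
  (forall i, is_derive t 1 (h i) (dh i)) ->
  is_derive t 1 (fun u => \sum_i h i u) (\sum_i dh i).
Proof.
move=> H; have := @is_derive_sum _ _ _ _ h t 1 dh H.
by congr (is_derive _ _ _ _); apply/funext => u; rewrite fct_sumE.
Qed.

Lemma perf_bounds (r0 rinf l t0 t : R) : 0 < rinf < r0 -> 0 < l -> t0 <= t ->
  rinf <= perf r0 rinf l t0 t <= r0.
Proof.
move=> /andP[h1 h2] l0 t0t; rewrite /perf.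
have e0 := expR_gt0 (- l * (t - t0)).
have e1 : expR (- l * (t - t0)) <= 1.
  by rewrite -expR0 ler_expR mulNr oppr_le0 mulr_ge0 ?subr_ge0// ltW.
apply/andP; split; nra.
Qed.

Lemma perf_gt0 (r0 rinf l t0 t : R) : 0 < rinf < r0 -> 0 < perf r0 rinf l t0 t.
Proof.
move=> /andP[h1 h2]; rewrite /perf.
by rewrite addr_gt0// mulr_gt0 ?expR_gt0 ?subr_gt0.
Qed.

Lemma perf_start (r0 rinf l t0 : R) : perf r0 rinf l t0 t0 = r0.
Proof. by rewrite /perf subrr mulr0 expR0 mulr1 subrK. Qed.

Definition dperf (r0 rinf l t0 t : R) : R :=
  (r0 - rinf) * (expR (- l * (t - t0)) * - l).

Lemma is_derive_perf (r0 rinf l t0 t : R) :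
  is_derive t 1 (perf r0 rinf l t0) (dperf r0 rinf l t0 t).
Proof.
have d1 : is_derive t 1 (fun u : R => - l * (u - t0)) (- l).
  have := is_deriveZ (- l) (is_deriveB (is_derive_id t (1 : R)) (is_derive_cst t0 t 1)).
  by rewrite subr0 [_ *: 1]mulr1.
have d2 : is_derive t 1 (expR \o (fun u : R => - l * (u - t0)))
    (expR (- l * (t - t0)) * - l) by exact: is_derive1_comp.
have := is_deriveD (is_deriveZ (r0 - rinf) d2) (is_derive_cst rinf t 1).
by rewrite addr0.
Qed.

Lemma dperf_bound (r0 rinf l t0 t : R) : 0 < rinf < r0 -> 0 < l -> t0 <= t ->
  `|dperf r0 rinf l t0 t| <= (r0 - rinf) * l.
Proof.
move=> /andP[h1 h2] l0 t0t; rewrite /dperf.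
have e0 := expR_gt0 (- l * (t - t0)).
have e1 : expR (- l * (t - t0)) <= 1.
  by rewrite -expR0 ler_expR mulNr oppr_le0 mulr_ge0 ?subr_ge0// ltW.
rewrite mulrN mulrN normrN ger0_norm; last first.
  by rewrite !mulr_ge0 ?subr_ge0 ?ltW.
by rewrite ler_wpM2l ?subr_ge0 ?(ltW h2)// ler_piMl// ltW.
Qed.

Lemma is_derive_continuous (f : R -> R) (t df : R) : is_derive t 1 f df -> f @ t --> f t.
Proof. by case=> df' _; apply: differentiable_continuous; exact/derivable1_diffP. Qed.

Lemma derivable_cvg (V : normedModType R) (x : R -> V) (t : R) :
  derivable x t 1 -> x @ t --> x t.
Proof. by move=> dx; apply: differentiable_continuous; exact/derivable1_diffP. Qed.

End RealTools.

(** * The normalized errors in coordinates *)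

Section ScalarErrors.
Variables (R : realType) (N : nat) (nq : 'I_N -> nat) (s : manip_system R nq).
Variables (c : control_params R N) (t0 : R) (xd : R -> 'cV[R]_(3 + 3)).
Implicit Types (x v : 'cV[R]_(3 + 3)) (t : R) (k : 'I_(3 + 3)).

(** [zs] and [zv] are the entries of [xi_s] and [xi_v], freed from matrix inverses so that they can
    be differentiated as scalar functions. *)
Definition zs t x k : R := (rho_s c t0 k t)^-1 * (x k 0 - xd t k 0).
Definition zv t x v k : R :=
  (rho_v c t0 k t)^-1 * (v k 0 + g_s c k * log_ratio (zs t x k)).

(** The vector y of the overview. Its entries are the partial derivatives of |eps_v|^2/2 with
    respect to the velocity. *)
Definition feedback t x v : 'cV[R]_(3 + 3) :=
  \col_k ((rho_v c t0 k t)^-1 * (2 / (1 - zv t x v k ^+ 2)) * log_ratio (zv t x v k)).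

Lemma xi_sE t x k : xi_s c t0 xd t x k 0 = zs t x k.
Proof. by rewrite !mxE. Qed.

Hypothesis rv_range : forall k, 0 < rho_vinf c k < rho_v0 c k.

Lemma invmx_P_v t : invmx (P_v c t0 t) = diag_mx (\row_k (rho_v c t0 k t)^-1).
Proof.
have E : P_v c t0 t *m diag_mx (\row_k (rho_v c t0 k t)^-1) = 1%:M.
  rewrite /P_v mulmx_diag -[RHS]diag_const_mx; congr diag_mx.
  by apply/rowP => k; rewrite !mxE divff// gt_eqF// perf_gt0.
have /mulmx1_unit[Pu _] := E.
by rewrite -[LHS]mulmx1 -E mulKmx.
Qed.

Lemma xi_vE t x v k : xi_v c t0 xd t x v k 0 = zv t x v k.
Proof.
rewrite /xi_v invmx_P_v mul_diag_mx !mxE /zv; congr (_ * _).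
by rewrite mulNr opprK.
Qed.

Lemma feedbackE t x v : invmx (P_v c t0 t) *m R_v (xi_v c t0 xd t x v)
  *m eps_v (xi_v c t0 xd t x v) = feedback t x v.
Proof.
rewrite invmx_P_v /R_v -mulmxA; apply/colP => k.
move: (xi_v _ _ _ _ _ _) (xi_vE t x v k) => xi xiE.
by rewrite !mul_diag_mx !mxE xiE mulrA.
Qed.

(** The transposed Jacobians cancel agent by agent, and the load sharing coefficients then add up to
    one. *)
Lemma grasp_input t x v : \det (JO s (angles x)) != 0 -> manip_system_ok s ->
  \sum_i share c i = 1 ->
  (grasp_map s x)^T *m ubar s c t0 xd t x v = - g_v c *: feedback t x v.
Proof.
move=> dx ok sh; rewrite /grasp_map /ubar tr_mxcol mul_mxrow_mxcol.
rewrite (eq_bigr (fun i => (- (share c i * g_v c)) *: feedback t x v)); last first.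
  move=> i _; rewrite /control -scalemxAr !mulmxA mulmxV; last first.
    by rewrite unitmx_tr JOi_JR// JR_unit.
  by rewrite mul1mx feedbackE.
rewrite -scaler_suml; congr (_ *: _).
by rewrite sumrN -mulr_suml sh mul1r.
Qed.

Lemma zs_bound_inv t x k th : 0 < rho_s c t0 k t -> `|zs t x k| <= th ->
  `|x k 0 - xd t k 0| <= th * rho_s c t0 k t.
Proof.
move=> r0; rewrite /zs normrM normfV (gtr0_norm r0) mulrC.
by rewrite ler_pdivrMr.
Qed.

End ScalarErrors.

Section FunnelConfinement.
Variables (R : realType) (N : nat) (nq : 'I_N -> nat) (s : manip_system R nq).
Variables (c : control_params R N) (t0 : R) (xd : R -> 'cV[R]_(3 + 3)).
Variables (x0 v0 : 'cV[R]_(3 + 3)) (D Bd : R).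
Implicit Types (t T : R) (k : 'I_(3 + 3)).
Hypothesis ok : manip_system_ok s.
Hypothesis rs_range : forall k, 0 < rho_sinf c k < rho_s0 c k.
Hypothesis ls_gt0 : forall k, 0 < l_s c k.
Hypothesis gs_gt0 : forall k, 0 < g_s c k.
Hypothesis rv_range : forall k, 0 < rho_vinf c k < rho_v0 c k.
Hypothesis lv_gt0 : forall k, 0 < l_v c k.
Hypothesis gv_gt0 : 0 < g_v c.
Hypothesis xd_derivable : forall t, derivable xd t 1.
Hypothesis xd_rate : forall t, t0 <= t -> `|'D_1 xd t| <= D.
Hypothesis xd_position : forall t, t0 <= t -> `|position (xd t)| <= Bd.
Hypothesis zs_start : forall k, `|zs c t0 xd t0 x0 k| < 1.
Hypothesis zv_start : forall k, `|zv c t0 xd t0 x0 v0 k| < 1.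

Local Notation zs := (zs c t0 xd).
Local Notation zv := (zv c t0 xd).

(** The closed loop expressed with fields defined at all poses, so that no nonsingularity is
    involved. For [T <= t0] the differential part is vacuous. *)
Definition regular_solution T (x v : R -> 'cV[R]_(3 + 3)) : Prop :=
  [/\ x @ t0^'+ --> x t0, v @ t0^'+ --> v t0 &
   forall t, t0 < t < T ->
     [/\ is_derive t 1 x (v t), derivable v t 1 &
      MR s (x t) *m 'D_1 v t + drift s t (x t) (v t) =
      - g_v c *: feedback c t0 xd t (x t) (v t)]].

Lemma rho_s_bounds t k : t0 <= t -> rho_sinf c k <= rho_s c t0 k t <= rho_s0 c k.
Proof. exact: perf_bounds. Qed.

Lemma rho_v_bounds t k : t0 <= t -> rho_vinf c k <= rho_v c t0 k t <= rho_v0 c k.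
Proof. exact: perf_bounds. Qed.

Lemma rho_s_gt0 t k : 0 < rho_s c t0 k t.
Proof. exact: perf_gt0. Qed.

Lemma rho_v_gt0 t k : 0 < rho_v c t0 k t.
Proof. exact: perf_gt0. Qed.

Lemma zs_cvg (F : set_system R) {FF : Filter F} t (x : R -> 'cV[R]_(3 + 3))
    (x1 : 'cV[R]_(3 + 3)) k :
  F --> t -> x @ F --> x1 -> zs u (x u) k @[u --> F] --> zs t x1 k.
Proof.
move=> Ft /cvg_mxP xx1; rewrite /zs; apply: cvgM.
  apply: cvgV; first by rewrite gt_eqF// rho_s_gt0.
  have := is_derive_continuous (is_derive_perf (rho_s0 c k) (rho_sinf c k) (l_s c k) t0 t).
  exact: cvg_comp.
apply: cvgB; first exact: xx1.
have xdc : xd @ t --> xd t.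
  by apply: differentiable_continuous; apply/derivable1_diffP.
have : (fun u => xd u k 0) @ t --> xd t k 0 by have /cvg_mxP := xdc; apply.
exact: cvg_comp.
Qed.

Lemma zv_cvg (F : set_system R) {FF : Filter F} t (x v : R -> 'cV[R]_(3 + 3))
    (x1 v1 : 'cV[R]_(3 + 3)) k :
  F --> t -> x @ F --> x1 -> v @ F --> v1 -> `|zs t x1 k| < 1 ->
  zv u (x u) (v u) k @[u --> F] --> zv t x1 v1 k.
Proof.
move=> Ft xx1 vv1 z1; rewrite /zv; apply: cvgM.
  apply: cvgV; first by rewrite gt_eqF// rho_v_gt0.
  have := is_derive_continuous (is_derive_perf (rho_v0 c k) (rho_vinf c k) (l_v c k) t0 t).
  exact: cvg_comp.
apply: cvgD; first by move/cvg_mxP: vv1; apply.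
apply: cvgM; first exact: cvg_cst.
have := is_derive_continuous (is_derive_log_ratio z1).
by apply: cvg_comp; exact: zs_cvg.
Qed.

Definition dzs t (x v : 'cV[R]_(3 + 3)) k : R := (rho_s c t0 k t)^-1 * (v k 0 - ('D_1 xd t) k 0
  - zs t x k * dperf (rho_s0 c k) (rho_sinf c k) (l_s c k) t0 t).

Lemma is_derive_zs t (x : R -> 'cV[R]_(3 + 3)) (v : 'cV[R]_(3 + 3)) k : is_derive t 1 x v ->
  is_derive t 1 (fun u => zs u (x u) k) (dzs t (x t) v k).
Proof.
move=> dx.
have d1 : is_derive t 1 (fun u => (rho_s c t0 k u)^-1)
    (- (rho_s c t0 k t) ^- 2 * dperf (rho_s0 c k) (rho_sinf c k) (l_s c k) t0 t).
  apply: is_deriveV; first by rewrite gt_eqF// rho_s_gt0.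
  exact: is_derive_perf.
have d2 : is_derive t 1 (fun u => x u k 0 - xd u k 0) (v k 0 - ('D_1 xd t) k 0).
  have dd : is_derive t 1 xd ('D_1 xd t) by apply: derivableP.
  exact: is_deriveB (is_derive_coord k 0 dx) (is_derive_coord k 0 dd).
apply: is_derive_eq (is_deriveM d1 d2) _.
rewrite /dzs /zs /= -![_ *: _]/(_ * _).
have r0 : rho_s c t0 k t != 0 by rewrite gt_eqF// rho_s_gt0.
by field.
Qed.

(** Beyond the threshold the reference velocity [- g_s * log_ratio z], which points towards the
    centre of the funnel, outweighs the three perturbations: the velocity error, at most [rho_v0],
    the desired speed, at most [D], and the shrinking of the funnel, at most
    [(rho_s0 - rho_sinf) * l_s]. *)
Lemma dzs_sign t (x v : 'cV[R]_(3 + 3)) k : t0 <= t -> `|zs t x k| < 1 -> `|zv t x v k| < 1 ->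
  threshold ((rho_v0 c k + D + (rho_s0 c k - rho_sinf c k) * l_s c k) / g_s c k)
    < `|zs t x k| -> zs t x k * dzs t x v k <= 0.
Proof.
move=> t0t z1 zv1; set B := rho_v0 c k + D + _ => Bz.
have D0 : 0 <= D by exact: le_trans (xd_rate t0t).
have /andP[rs1 rs2] := rs_range k; have /andP[rv1 rv2] := rv_range k.
have lr0 : 0 <= (rho_s0 c k - rho_sinf c k) * l_s c k.
  by rewrite mulr_ge0 ?subr_ge0 ?(ltW rs2) ?(ltW (ls_gt0 k)).
have B0 : 0 <= B by rewrite /B !addr_ge0// ltW// (lt_trans rv1).
set z := zs t x k in z1 Bz *; set e := log_ratio z.
have e_ge : B <= g_s c k * `|e|.
  rewrite mulrC -ler_pdivrMr// leNgt; apply/negP => eB.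
  have := log_ratio_le_threshold (divr_ge0 B0 (ltW (gs_gt0 k))) z1 (ltW eB).
  by rewrite leNgt Bz.
have ze : z * e = `|z| * `|e| by rewrite -normrM ger0_norm// log_ratio_mul_ge0.
have vE : v k 0 = rho_v c t0 k t * zv t x v k - g_s c k * e.
  by rewrite /zv mulrA divff ?mul1r ?addrK// gt_eqF// rho_v_gt0.
have /andP[rvt1 rvt2] := rho_v_bounds k t0t.
have evB : `|rho_v c t0 k t * zv t x v k| <= rho_v0 c k.
  rewrite normrM (gtr0_norm (rho_v_gt0 t k)).
  by apply: le_trans rvt2; rewrite ler_piMr ?ltW ?rho_v_gt0.
have dB : `|('D_1 xd t) k 0| <= D.
  exact: le_trans (mx_coord_le _ _ _) (xd_rate t0t).
have pB : `|z * dperf (rho_s0 c k) (rho_sinf c k) (l_s c k) t0 t| <=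
    (rho_s0 c k - rho_sinf c k) * l_s c k.
  rewrite normrM; apply: le_trans (dperf_bound (rs_range k) (ls_gt0 k) t0t).
  by rewrite ler_piMl// ltW.
rewrite /dzs -/z mulrCA pmulr_rle0 ?invr_gt0 ?rho_s_gt0// vE.
set w := rho_v c t0 k t * _ in evB *; set p := z * dperf _ _ _ _ _ in pB *.
set d := ('D_1 xd t) k 0 in dB *.
have -> : z * (w - g_s c k * e - d - p) = z * (w - d - p) - g_s c k * (z * e) by ring.
rewrite ze subr_le0.
have : `|w - d - p| <= B.
  by apply: le_trans (ler_normB _ _) _; rewrite lerD// (le_trans (ler_normB _ _))// lerD.
move=> H; apply: le_trans (ler_norm _) _; rewrite normrM.
rewrite mulrCA ler_wpM2l//; exact: le_trans e_ge.
Qed.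

(** The margin is the larger of the initial error and the threshold of [dzs_sign], both below 1. The
    velocity errors enter only through [|zv| < 1], so it can be fixed before the velocity margin. *)
Lemma position_funnel : exists2 th, 0 < th < 1 &
  (forall k, `|zs t0 x0 k| <= th) /\
  forall T x v, regular_solution T x v -> x t0 = x0 ->
    (forall t, t0 <= t < T -> forall k, `|zs t (x t) k| < 1 /\ `|zv t (x t) (v t) k| < 1) ->
    forall t, t0 <= t < T -> forall k, `|zs t (x t) k| <= th.
Proof.
pose b k := Num.max `|zs t0 x0 k| (threshold
  ((rho_v0 c k + D + (rho_s0 c k - rho_sinf c k) * l_s c k) / g_s c k)).
have [k|th /andP[th0 th1] thb] := @finite_lt1_bound R _ b.
  by rewrite gt_max zs_start threshold_lt1.
exists th; first by rewrite th0.
have start k : `|zs t0 x0 k| <= th by apply: le_trans (thb k); rewrite le_max lexx.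
split=> // T x v [xc vc sol] xt0 zlt t tT k.
rewrite -square_le_norm ?(ltW th0)// expr2.
pose phi u := zs u (x u) k * zs u (x u) k.
pose dphi u := 2 * (zs u (x u) k * dzs u (x u) (v u) k).
have t0T : t0 < T by case/andP: tT; exact: le_lt_trans.
apply: (@barrier R phi dphi t0 T (th ^+ 2)) tT.
- rewrite /phi; have zc : zs u (x u) k @[u --> t0^'+] --> zs t0 (x t0) k.
    by apply: zs_cvg => //; exact: cvg_within.
  exact: cvgM.
- move=> u uT; have [dx _ _] := sol u uT.
  have dz := is_derive_zs k dx.
  apply: is_derive_eq (is_deriveM dz dz) _.
  by rewrite /dphi /= -![_ *: _]/(_ * _); ring.
- by rewrite /phi -expr2 xt0 square_le_norm// ltW.
- move=> u /andP[u1 u2]; rewrite /phi -expr2 ltNge square_le_norm ?(ltW th0)// -ltNge => zth.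
  have uT : t0 <= u < T by rewrite u2 ltW.
  have [z1 z2] := zlt u uT k.
  rewrite /dphi pmulr_rle0//; apply: dzs_sign => //; first exact: ltW.
  by apply: le_lt_trans zth; apply: le_trans (thb k); rewrite le_max lexx orbT.
Qed.

(** * Estimates inside the pose funnel and the velocity funnel *)

Section Velocity.
Variables (th : R).
Hypothesis th01 : 0 < th < 1.

(** The velocity is recovered from the errors as [rho_v * zv - g_s * log_ratio zs], and [log_ratio]
    is bounded as long as [zs] keeps the margin [th < 1]. *)
Lemma velocity_bound : exists2 B, 0 <= B & forall t (x v : 'cV[R]_(3 + 3)), t0 <= t ->
  (forall k, `|zs t x k| <= th) -> (forall k, `|zv t x v k| <= 1) ->
  `|position x| <= B /\ `|v| <= B.
Proof.
have [th0 th1] := andP th01.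
pose a k := rho_s0 c k; pose b k := rho_v0 c k + g_s c k * log_ratio th.
have [A A0 aA] := finite_bound a; have [B B0 bB] := finite_bound b.
exists (Num.max (A + `|Bd|) B); first by rewrite le_max B0 orbT.
move=> t x v t0t zst zvt; split.
  rewrite le_max; apply/orP; left; have AB : 0 <= A + `|Bd| by rewrite addr_ge0.
  have -> : position x = position (x - xd t) + position (xd t).
    by rewrite /position -linearD/= subrK.
  apply: le_trans (ler_normD _ _) _; apply: lerD; last first.
    by apply: le_trans (xd_position t0t) _; exact: ler_norm.
  apply/(mx_norm_leP _ A0) => i j; rewrite ord1 !mxE.
  have /andP[_ r2] := rho_s_bounds (lshift 3 i) t0t.
  apply: le_trans (zs_bound_inv (rho_s_gt0 _ _) (zst (lshift 3 i))) _.
  apply: le_trans (aA (lshift 3 i)); apply: le_trans r2.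
  by rewrite ler_piMl// ltW// rho_s_gt0.
rewrite le_max; apply/orP; right; apply/(mx_norm_leP _ B0) => k j; rewrite ord1.
apply: le_trans (bB k); rewrite /b.
have vE : v k 0 = rho_v c t0 k t * zv t x v k - g_s c k * log_ratio (zs t x k).
  by rewrite /zv mulrA divff ?mul1r ?addrK// gt_eqF// rho_v_gt0.
rewrite vE; apply: le_trans (ler_normB _ _) _; apply: lerD.
  rewrite normrM (gtr0_norm (rho_v_gt0 t k)).
  have /andP[_ r2] := rho_v_bounds k t0t.
  by apply: le_trans r2; rewrite ler_piMr// ltW// rho_v_gt0.
by rewrite normrM (gtr0_norm (gs_gt0 k)) ler_wpM2l ?(ltW (gs_gt0 k))// log_ratio_le.
Qed.

Lemma funnel_dynamics_bounds : exists mu Mm Dm,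
  [/\ 0 < mu, 0 <= Mm, 0 <= Dm & forall t (x v : 'cV[R]_(3 + 3)), t0 <= t ->
   (forall k, `|zs t x k| <= th) -> (forall k, `|zv t x v k| <= 1) ->
   [/\ forall a : 'cV[R]_(3 + 3), mu * `|a| ^+ 2 <= (a^T *m MR s x *m a) 0 0,
       `|MR s x| <= Mm & `|drift s t x v| <= Dm]].
Proof.
have [B B0 Bb] := velocity_bound.
have [mu mu0 muM] := pos_def_uniform B (MO_cont ok) (MO_pose ok) (MO_pos ok).
have [Mm MmP] := mbdd_MR ok B; have [Dm DmP] := mbdd_drift ok B.
exists mu, `|Mm|, `|Dm|; split => // t x v t0t h1 h2.
have [xB vB] := Bb t x v t0t h1 h2; split.
- by move=> a; apply: le_trans (muM x a xB) (MR_quad ok x a).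
- by apply: le_trans (MmP x xB) _; exact: ler_norm.
- by apply: le_trans (ler_norm _); apply: (DmP (t, (x, v))).
Qed.

(** The b of the overview: everything besides the acceleration in the rate of [zv], namely the
    derivative of minus the reference velocity and the effect of the shrinking velocity funnel. *)
Definition velocity_coupling t (x v : 'cV[R]_(3 + 3)) k : R :=
  g_s c k * (2 / (1 - zs t x k ^+ 2) * dzs t x v k)
  - zv t x v k * dperf (rho_v0 c k) (rho_vinf c k) (l_v c k) t0 t.

Lemma is_derive_zv t (x v : R -> 'cV[R]_(3 + 3)) (a : 'cV[R]_(3 + 3)) k :
  is_derive t 1 x (v t) -> is_derive t 1 v a -> `|zs t (x t) k| < 1 ->
  is_derive t 1 (fun u => zv u (x u) (v u) k)
    ((rho_v c t0 k t)^-1 * (a k 0 + velocity_coupling t (x t) (v t) k)).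
Proof.
move=> dx dv z1.
have d1 : is_derive t 1 (fun u => (rho_v c t0 k u)^-1)
    (- (rho_v c t0 k t) ^- 2 * dperf (rho_v0 c k) (rho_vinf c k) (l_v c k) t0 t).
  apply: is_deriveV; first by rewrite gt_eqF// rho_v_gt0.
  exact: is_derive_perf.
have d2 : is_derive t 1 (@log_ratio R \o (fun u => zs u (x u) k))
    (2 / (1 - zs t (x t) k ^+ 2) * dzs t (x t) (v t) k).
  by apply: is_derive1_comp; [exact: is_derive_log_ratio|exact: is_derive_zs].
have d3 := is_deriveD (is_derive_coord k 0 dv) (is_deriveZ (g_s c k) d2).
apply: is_derive_eq (is_deriveM d1 d3) _.
rewrite /velocity_coupling /zv.
rewrite -![_ *: _]/(_ * _) /=.
have r0 : rho_v c t0 k t != 0 by rewrite gt_eqF// rho_v_gt0.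
rewrite (_ : ((fun u : R => v u k 0) + _) t =
  v t k 0 + g_s c k * log_ratio (zs t (x t) k)) //.
set q := 2 / _.
by field.
Qed.

Lemma velocity_coupling_bound : exists2 B, 0 <= B &
  forall t (x v : 'cV[R]_(3 + 3)), t0 <= t ->
  (forall k, `|zs t x k| <= th) -> (forall k, `|zv t x v k| <= 1) ->
  `|\col_k velocity_coupling t x v k| <= B.
Proof.
have [th0 th1] := andP th01.
have [B B0 Bb] := velocity_bound.
pose b k := g_s c k * (2 / (1 - th ^+ 2) * ((rho_sinf c k)^-1 *
   (B + D + (rho_s0 c k - rho_sinf c k) * l_s c k)))
   + (rho_v0 c k - rho_vinf c k) * l_v c k.
have [C C0 bC] := finite_bound b.
exists C => // t x v t0t h1 h2; apply/(mx_norm_leP _ C0) => k j; rewrite ord1 mxE.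
apply: le_trans (bC k); have [_ vB] := Bb t x v t0t h1 h2.
apply: le_trans (ler_normB _ _) _; apply: lerD; last first.
  rewrite normrM; apply: le_trans (dperf_bound (rv_range k) (lv_gt0 k) t0t).
  by rewrite ler_piMl.
rewrite normrM (gtr0_norm (gs_gt0 k)) ler_wpM2l ?(ltW (gs_gt0 k))//.
have zk := h1 k; have zsq : zs t x k ^+ 2 <= th ^+ 2.
  by rewrite square_le_norm// ltW.
have th2 : 0 < 1 - th ^+ 2 by nra.
rewrite normrM; apply: ler_pM => //.
  rewrite ger0_norm; last by rewrite divr_ge0//; lra.
  by rewrite ler_wpM2l// lef_pV2 ?posrE//; lra.
have /andP[rs1 rs2] := rs_range k.
have /andP[r1 _] := rho_s_bounds k t0t.
rewrite /dzs normrM normfV (gtr0_norm (rho_s_gt0 t k)); apply: ler_pM => //.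
  by rewrite invr_ge0 ltW// rho_s_gt0.
  by rewrite lef_pV2 ?posrE ?rho_s_gt0.
apply: le_trans (ler_normB _ _) _; apply: lerD.
  apply: le_trans (ler_normB _ _) _; apply: lerD.
    exact: le_trans (mx_coord_le _ _ _) vB.
  exact: le_trans (mx_coord_le _ _ _) (xd_rate t0t).
rewrite normrM; apply: le_trans (dperf_bound (rs_range k) (ls_gt0 k) t0t).
by rewrite ler_piMl//; apply: le_trans zk _; exact: ltW.
Qed.

(* g <y, a + b> = - <M a + d, a + b> is at most - mu |a|^2 + C |a| + C, hence it
   is nonpositive when a is large, and a is large when y is. *)
Lemma energy_decreases (mu Mm Dm Bb g : R) : 0 < mu -> 0 <= Mm -> 0 <= Dm -> 0 <= Bb ->
  0 < g -> exists2 Y, 0 <= Y &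
  forall (M : 'M[R]_(3 + 3)) (y a d b : 'cV[R]_(3 + 3)),
    mu * `|a| ^+ 2 <= (a^T *m M *m a) 0 0 -> `|M| <= Mm -> `|d| <= Dm -> `|b| <= Bb ->
    M *m a + d = - g *: y -> Y < `|y| -> (y^T *m (a + b)) 0 0 <= 0.
Proof.
move=> mu0 Mm0 Dm0 Bb0 g0.
pose n : R := (3 + 3)%:R; have n0 : 0 <= n by exact: ler0n.
pose C := n * (n * Mm) * Bb + n * Dm.
pose C2 := n * Dm * Bb.
have nM0 : 0 <= n * Mm by exact: mulr_ge0.
have C0 : 0 <= C by rewrite addr_ge0// !mulr_ge0.
have C20 : 0 <= C2 by rewrite !mulr_ge0.
(* For [|a| >= A0], which is at least 1, the quadratic term [mu * |a|^2] dominates [C * |a| + C2].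
   The factors [n] in [C] and [C2] are the price of the entrywise maximum norm. *)
pose A0 := (C + C2) / mu + 1.
have A1 : 0 <= (C + C2) / mu by apply: divr_ge0; [exact: addr_ge0|exact: ltW].
have A00 : 0 <= A0 by exact: addr_ge0.
(* If [|a|] were below [A0], then [M *m a + d], which is [- g *: y], would keep [|y|] below this
   value. *)
exists ((n * Mm * A0 + Dm) / g).
  by rewrite divr_ge0 ?(ltW g0)// addr_ge0// mulr_ge0.
move=> M y a d b qM MM dD bB E yY.
have Ma : `|M *m a| <= n * Mm * `|a|.
  apply: le_trans (mulmx_norm_le _ _) _; rewrite ler_wpM2r//.
  by rewrite ler_wpM2l.
have aA : A0 <= `|a|.
  rewrite leNgt; apply/negP => aA0.
  move: yY; rewrite ltNge => /negP; apply.
  have : `|M *m a + d| <= n * Mm * A0 + Dm.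
    apply: le_trans (ler_normD _ _) _; apply: lerD => //.
    by apply: le_trans Ma _; rewrite ler_wpM2l// ltW.
  by rewrite E normrZ normrN (gtr0_norm g0) ler_pdivlMr// mulrC.
have gy : g * (y^T *m (a + b)) 0 0 = - (((M *m a + d)^T *m (a + b)) 0 0).
  rewrite E (_ : (- g *: y)^T = - g *: y^T); last by rewrite linearZ.
  by rewrite -scalemxAl [in RHS]mxE mulNr opprK.
rewrite -(pmulr_rle0 _ g0) gy oppr_le0.
have -> : ((M *m a + d)^T *m (a + b)) 0 0 = (a^T *m M *m a) 0 0
    + ((M *m a)^T *m b) 0 0 + (d^T *m a) 0 0 + (d^T *m b) 0 0.
  rewrite -mulmxA [(a^T *m (M *m a)) 0 0]dotC.
  have add00 (A B : 'M[R]_1) : (A + B) 0 0 = A 0 0 + B 0 0 by rewrite mxE.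
  by rewrite [(_ + d)^T]linearD/= mulmxDl !mulmxDr !add00 !addrA.
have := dot_le (M *m a) b; have := dot_le d a; have := dot_le d b.
rewrite -/n !ler_norml => /andP[H1 _] /andP[H2 _] /andP[H3 _].
have K1 : n * `|d| * `|b| <= C2 by rewrite /C2 ler_pM ?mulr_ge0// ler_wpM2l.
have K2 : n * `|d| * `|a| <= n * Dm * `|a| by rewrite ler_wpM2r// ler_wpM2l.
have K3 : n * `|M *m a| * `|b| <= n * (n * Mm * `|a|) * Bb.
  by rewrite ler_pM ?mulr_ge0// ler_wpM2l.
have K4 : n * (n * Mm * `|a|) * Bb + n * Dm * `|a| = C * `|a| by rewrite /C; ring.
have K5 : (C + C2 + mu) <= mu * `|a|.
  have -> : C + C2 + mu = mu * A0 by rewrite /A0; field; rewrite gt_eqF.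
  by rewrite ler_wpM2l// ltW.
have a1 : 1 <= `|a|.
  by apply: le_trans aA; rewrite /A0 lerDr.
have K6 : mu * `|a| ^+ 2 = mu * `|a| * `|a| by rewrite expr2 mulrA.
have K7 : (C + C2 + mu) * `|a| <= mu * `|a| * `|a| by rewrite ler_wpM2r.
have K8 : C2 <= C2 * `|a| by rewrite ler_peMr.
have K9 : 0 <= mu * `|a| by rewrite mulr_ge0// ltW.
have K10 : (C + C2 + mu) * `|a| = C * `|a| + C2 * `|a| + mu * `|a| by ring.
lra.
Qed.


(** The factor [2 / (1 - z ^+ 2)] is at least 1, so an entry of the feedback is no smaller than the
    transformed error divided by [rho_v]. Read contrapositively, a large transformed error forces a
    large feedback. *)
Lemma feedback_log_ratio (Y : R) : 0 <= Y -> exists2 E, 0 <= E &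
  forall t (x v : 'cV[R]_(3 + 3)), t0 <= t -> (forall k, `|zv t x v k| < 1) ->
  `|feedback c t0 xd t x v| <= Y -> forall k, `|log_ratio (zv t x v k)| <= E.
Proof.
move=> Y0; have [E E0 EP] := finite_bound (fun k => rho_v0 c k * Y).
exists E => // t x v t0t z1 fY k; apply: le_trans (EP k).
have := le_trans (mx_coord_le _ k 0) fY; rewrite mxE.
have r0 := rho_v_gt0 t k; have /andP[_ r2] := rho_v_bounds k t0t.
have z2 : zv t x v k ^+ 2 < 1.
  by rewrite ltNge -[1](expr1n R 2) -[zv _ _ _ _ ^+ 2]real_normK ?num_real// ler_sqr ?nnegrE// -ltNge.
set z := zv t x v k in z2 *; have z0 : 0 <= z ^+ 2 by exact: sqr_ge0.
set e := log_ratio z.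
rewrite -mulrA normrM normfV (gtr0_norm r0) mulrC ler_pdivrMr// normrM.
have q1 : 1 <= `|2 / (1 - z ^+ 2)|.
  rewrite ger0_norm; last by rewrite divr_ge0//; lra.
  by rewrite ler_pdivlMr; lra.
move=> H; apply: (@le_trans _ _ (Y * rho_v c t0 k t)).
  by apply: le_trans H; rewrite ler_peMl.
by rewrite mulrC ler_wpM2r.
Qed.

(** The barrier function is |eps_v|^2. Above the level [C] some transformed error exceeds [E], hence
    the feedback exceeds [Y], and [energy_decreases] applies. *)
Lemma velocity_funnel : exists2 thv, 0 < thv < 1 &
  (forall k, `|zv t0 x0 v0 k| <= thv) /\
  forall T x v, regular_solution T x v -> x t0 = x0 -> v t0 = v0 ->
    (forall t, t0 <= t < T -> forall k, `|zs t (x t) k| <= th /\ `|zv t (x t) (v t) k| < 1) ->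
    forall t, t0 <= t < T -> forall k, `|zv t (x t) (v t) k| <= thv.
Proof.
have [th0 th1] := andP th01.
have [mu [Mm [Dm [mu0 Mm0 Dm0 dyn]]]] := funnel_dynamics_bounds.
have [Bb Bb0 BbP] := velocity_coupling_bound.
have [Y Y0 YP] := energy_decreases mu0 Mm0 Dm0 Bb0 gv_gt0.
have [E E0 EP] := feedback_log_ratio Y0.
pose V0 : R := \sum_k log_ratio (zv t0 x0 v0 k) * log_ratio (zv t0 x0 v0 k).
pose Vc : R := \sum_(k < 3 + 3) E * E.
pose C := Num.max V0 Vc.
have C0 : 0 <= C.
  by rewrite le_max /V0 sumr_ge0// => k _; rewrite -expr2 sqr_ge0.
(* A bound [C] on the sum of squares bounds each transformed error by [C + 1], since C <= (C + 1)^2;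
   this avoids a square root. *)
pose b k := Num.max `|zv t0 x0 v0 k| (threshold (C + 1)).
have [k|thv /andP[thv0 thv1] thvb] := @finite_lt1_bound R _ b.
  by rewrite gt_max zv_start threshold_lt1.
exists thv; first by rewrite thv0.
split=> [k|T x v [xc vc sol] xt0 vt0 H t tT k].
  by apply: le_trans (thvb k); rewrite le_max lexx.
apply: le_trans (thvb k); rewrite le_max; apply/orP; right.
have [_ zk] := H t tT k.
apply: log_ratio_le_threshold => //; first by rewrite addr_ge0.
pose eps u k := log_ratio (zv u (x u) (v u) k).
pose V u := \sum_k eps u k * eps u k.
pose dV u := 2 * ((feedback c t0 xd u (x u) (v u))^T *m
  ('D_1 v u + \col_k velocity_coupling u (x u) (v u) k)) 0 0.
have t0T : t0 < T by case/andP: tT; exact: le_lt_trans.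
have VC : V t <= C.
  apply: (@barrier R V dV t0 T C) tT.
  - rewrite /V; apply: cvg_big => [|l _]; first exact: add_continuous.
    have tT0 : t0 <= t0 < T by rewrite lexx.
    have [z1 z2] := H t0 tT0 l.
    have zc : zv u (x u) (v u) l @[u --> t0^'+] --> zv t0 (x t0) (v t0) l.
      apply: zv_cvg => //; first exact: cvg_within.
      by apply: le_lt_trans th1.
    have ec : eps u l @[u --> t0^'+] --> eps t0 l.
      have := is_derive_continuous (is_derive_log_ratio z2).
      exact: cvg_comp.
    exact: cvgM.
  - move=> u /andP[u1 u2]; have uT : t0 < u < T by rewrite u1.
    have [dx dv _] := sol u uT.
    have uT' : t0 <= u < T by rewrite u2 ltW.
    have de l : is_derive u 1 (fun w => eps w l) (2 / (1 - zv u (x u) (v u) l ^+ 2) *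
        ((rho_v c t0 l u)^-1 * (('D_1 v u) l 0 + velocity_coupling u (x u) (v u) l))).
      have [z1 z2] := H u uT' l.
      have dvu : is_derive u 1 v ('D_1 v u) by exact: derivableP.
      have dz := is_derive_zv dx dvu (le_lt_trans z1 th1).
      exact: (@is_derive1_comp R (@log_ratio R) (fun w => zv w (x w) (v w) l) u _ _
        (is_derive_log_ratio z2) dz).
    apply: is_derive_eq (is_derive_bigsum (fun l => is_deriveM (de l) (de l))) _.
    rewrite /dV mxE mulr_sumr; apply: eq_bigr => l _.
    rewrite !mxE -!/(zv _ _ _ _) -/(eps u l) -![_ *: _]/(_ * _).
    set q := 2 / _; ring.
  - by rewrite /V /eps xt0 vt0 le_max lexx.
  - move=> u /andP[u1 u2] CV; have uT : t0 < u < T by rewrite u1.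
    have [_ _ eqn] := sol u uT.
    have uT' : t0 <= u < T by rewrite u2 ltW.
    have h1 l : `|zs u (x u) l| <= th by have [] := H u uT' l.
    have h2 l : `|zv u (x u) (v u) l| < 1 by have [] := H u uT' l.
    have h2' l : `|zv u (x u) (v u) l| <= 1 by exact: ltW.
    have [q1 q2 q3] := dyn u (x u) (v u) (ltW u1) h1 h2'.
    rewrite /dV pmulr_rle0//.
    apply: (YP _ _ _ _ _ (q1 _) q2 q3 (BbP u (x u) (v u) (ltW u1) h1 h2') eqn).
    rewrite ltNge; apply/negP => fY.
    have ee := EP u (x u) (v u) (ltW u1) h2 fY.
    suff : V u <= Vc by rewrite leNgt (le_lt_trans _ CV)// le_max lexx orbT.
    apply: ler_sum => l _; rewrite -!expr2 square_le_norm//; exact: ee.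
rewrite -square_le_norm; last by rewrite addr_ge0.
apply: (@le_trans _ _ C); last by nra.
apply: le_trans VC; rewrite /V (bigD1 k)//= -expr2 lerDl.
by apply: sumr_ge0 => l _; rewrite -expr2 sqr_ge0.
Qed.

Lemma feedback_bounded : exists2 F, 0 <= F & forall t (x v : 'cV[R]_(3 + 3)), t0 <= t ->
  (forall k, `|zv t x v k| <= th) -> `|feedback c t0 xd t x v| <= F.
Proof.
have [th0 th1] := andP th01.
have [F F0 FP] := finite_bound (fun k =>
  (rho_vinf c k)^-1 * (2 / (1 - th ^+ 2)) * log_ratio th).
exists F => // t x v t0t zt; apply/(mx_norm_leP _ F0) => k j; rewrite ord1 mxE.
apply: le_trans (FP k).
have zsq : zv t x v k ^+ 2 <= th ^+ 2 by rewrite square_le_norm// ltW.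
have th2 : 0 < 1 - th ^+ 2 by nra.
have /andP[r1 _] := rho_v_bounds k t0t; have /andP[rv1 rv2] := rv_range k.
rewrite normrM; apply: ler_pM => //; last exact: log_ratio_le.
rewrite normrM normfV (gtr0_norm (rho_v_gt0 t k)); apply: ler_pM => //.
- by rewrite invr_ge0 ltW// rho_v_gt0.
- by rewrite lef_pV2 ?posrE ?rho_v_gt0.
- rewrite ger0_norm; last by rewrite divr_ge0//; lra.
  by rewrite ler_wpM2l// lef_pV2 ?posrE//; lra.
Qed.

(** Pairing the equation of motion with [a] gives mu |a|^2 <= <a, M a>, which is at most a constant
    times |a|. *)
Lemma acceleration_bounded : exists2 A, 0 <= A &
  forall t (x v a : 'cV[R]_(3 + 3)), t0 <= t ->
  (forall k, `|zs t x k| <= th /\ `|zv t x v k| <= th) ->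
  MR s x *m a + drift s t x v = - g_v c *: feedback c t0 xd t x v -> `|a| <= A.
Proof.
have [th0 th1] := andP th01.
have [mu [Mm [Dm [mu0 Mm0 Dm0 dyn]]]] := funnel_dynamics_bounds.
have [F F0 FP] := feedback_bounded.
pose n : R := (3 + 3)%:R; have n0 : 0 <= n by exact: ler0n.
pose S := g_v c * F + Dm.
have S0 : 0 <= S by rewrite addr_ge0// mulr_ge0// ltW.
exists (n * S / mu); first by rewrite divr_ge0 ?mulr_ge0// ltW.
move=> t x v a t0t h E; have h1 k := (h k).1; have h2 k := (h k).2.
have h2' k : `|zv t x v k| <= 1 by apply: le_trans (h2 k) _; exact: ltW.
have [q1 q2 q3] := dyn t x v t0t h1 h2'.
have Ma : `|MR s x *m a| <= S.
  have -> : MR s x *m a = - g_v c *: feedback c t0 xd t x v - drift s t x v.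
    by rewrite -E addrK.
  apply: le_trans (ler_normB _ _) _; apply: lerD => //.
  by rewrite normrZ normrN (gtr0_norm gv_gt0) ler_wpM2l ?FP// ltW.
have [->|a0] := eqVneq a 0; first by rewrite normr0 divr_ge0 ?mulr_ge0// ltW.
have an : 0 < `|a| by rewrite normr_gt0.
rewrite ler_pdivlMr// mulrC -(ler_pM2r an) -mulrA -expr2.
apply: le_trans (q1 a) _; apply: le_trans (ler_norm _) _.
rewrite -mulmxA; apply: le_trans (dot_le _ _) _; rewrite -/n.
by rewrite mulrAC ler_wpM2r// ler_wpM2l.
Qed.

End Velocity.

Lemma regular_solution_le T T' x v : T' <= T ->
  regular_solution T x v -> regular_solution T' x v.
Proof.
move=> TT [xc vc sol]; split => // t /andP[t1 t2].
by apply: sol; rewrite t1 (lt_le_trans t2).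
Qed.

Lemma regular_solution_cvg T x v t : regular_solution T x v -> t0 < t < T ->
  x @ t --> x t /\ v @ t --> v t.
Proof.
move=> [_ _ sol] tT; have [dx dv _] := sol t tT.
split; last exact: derivable_cvg dv.
by case: dx => dx _; exact: derivable_cvg dx.
Qed.

Lemma funnels_open (x v : R -> 'cV[R]_(3 + 3)) (thr : R) t :
  x @ t^'+ --> x t -> v @ t^'+ --> v t -> thr <= 1 ->
  (forall k, `|zs t (x t) k| < thr /\ `|zv t (x t) (v t) k| < thr) ->
  exists2 e, 0 < e & forall u, t <= u < t + e ->
    forall k, `|zs u (x u) k| < thr /\ `|zv u (x u) (v u) k| < thr.
Proof.
move=> xc vc thr1 H.
have n1 : \forall u \near t^'+, forall k, `|zs u (x u) k| < thr.
  apply: filter_forall => k; have [h1 h2] := H k.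
  have zc : `|zs u (x u) k| @[u --> t^'+] --> `|zs t (x t) k|.
    by apply: cvg_norm; apply: zs_cvg => //; exact: cvg_within.
  exact: (cvgr_lt _ zc).
have n2 : \forall u \near t^'+, forall k, `|zv u (x u) (v u) k| < thr.
  apply: filter_forall => k; have [h1 h2] := H k.
  have zc : `|zv u (x u) (v u) k| @[u --> t^'+] --> `|zv t (x t) (v t) k|.
    apply: cvg_norm; apply: zv_cvg => //; first exact: cvg_within.
    exact: lt_le_trans thr1.
  exact: (cvgr_lt _ zc).
have /nbhs_ballP[e /= e0 He] : nbhs t [set u | t < u -> forall k,
    `|zs u (x u) k| < thr /\ `|zv u (x u) (v u) k| < thr].
  have : \forall u \near t^'+, forall k,
      `|zs u (x u) k| < thr /\ `|zv u (x u) (v u) k| < thr.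
    by apply: filterS2 n1 n2 => u h1 h2 k; split; [exact: h1|exact: h2].
  by [].
exists e => // u /andP[tu ute] k.
move: tu; rewrite le_eqVlt => /predU1P[<-//|tu].
by apply: He => //; rewrite /ball/= distrC ger0_norm ?subr_ge0 ?(ltW tu)// ltrBlDl.
Qed.

Lemma funnels_closed (x v : R -> 'cV[R]_(3 + 3)) (thr : R) t : t0 < t ->
  x @ t --> x t -> v @ t --> v t -> thr < 1 ->
  (forall u, t0 <= u < t -> forall k,
    `|zs u (x u) k| <= thr /\ `|zv u (x u) (v u) k| <= thr) ->
  forall k, `|zs t (x t) k| <= thr /\ `|zv t (x t) (v t) k| <= thr.
Proof.
move=> t0t xc vc thr1 H k.
have xl := cvg_at_left_filter xc; have vl := cvg_at_left_filter vc.
have nK : \forall u \near t^'-, `|zs u (x u) k| <= thr /\ `|zv u (x u) (v u) k| <= thr.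
  near=> u; apply: H; apply/andP; split.
    by apply: ltW; near: u; exact: nbhs_left_gt.
  by near: u; exact: nbhs_left_lt.
(* The pose error comes first: the continuity of [zv] at [t] rests on [|zs| < 1] there. *)
have zsk : `|zs t (x t) k| <= thr.
  have zc : `|zs u (x u) k| @[u --> t^'-] --> `|zs t (x t) k|.
    by apply: cvg_norm; apply: zs_cvg => //; exact: cvg_within.
  by apply: (cvgr_to_le zc); apply: filterS nK => u [].
split=> //.
have zc : `|zv u (x u) (v u) k| @[u --> t^'-] --> `|zv t (x t) (v t) k|.
  apply: cvg_norm; apply: zv_cvg => //; first exact: cvg_within.
  exact: le_lt_trans thr1.
by apply: (cvgr_to_le zc); apply: filterS nK => u [].
Unshelve. all: by end_near. Qed.

Theorem funnel_confinement : exists th, [/\ 0 < th < 1,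
  forall k, `|zs t0 x0 k| <= th /\ `|zv t0 x0 v0 k| <= th &
  forall T x v, regular_solution T x v -> x t0 = x0 -> v t0 = v0 ->
  forall t, t0 <= t < T -> forall k, `|zs t (x t) k| <= th /\ `|zv t (x t) (v t) k| <= th].
Proof.
have [ths ths01 [Hs0 Hs]] := position_funnel.
have [thv thv01 [Hv0 Hv]] := velocity_funnel ths01.
have [[ths0 ths1] [thv0 thv1]] := (andP ths01, andP thv01).
pose th := Num.max ths thv.
have th01 : 0 < th < 1 by rewrite lt_max ths0/= gt_max ths1.
have [sth vth] : ths <= th /\ thv <= th by rewrite !le_max !lexx orbT.
exists th; split=> // [k|T x v xv xt0 vt0].
  by split; [exact: le_trans sth|exact: le_trans vth].
(* The a priori assumption is that the errors are inside their funnels; the improved property is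
   that they keep the margin [th]. *)
apply: (@continuous_induction R
  (fun t => forall k, `|zs t (x t) k| < 1 /\ `|zv t (x t) (v t) k| < 1)).
- by move=> _ k; rewrite xt0 vt0; split; [exact: le_trans sth|exact: le_trans vth].
- move=> t /andP[t0t tT] K.
  have [xr vr] : x @ t^'+ --> x t /\ v @ t^'+ --> v t.
    have [->|tt0] := eqVneq t t0; first by case: xv.
    have [|xc vc] := @regular_solution_cvg T x v t xv.
      by rewrite tT andbT lt_neqAle eq_sym tt0.
    by split; apply: cvg_at_right_filter.
  have [k|e e0 He] := funnels_open xr vr (lexx 1).
    by have [h1 h2] := K k; split; apply: le_lt_trans (andP th01).2.
  by exists e => // u ue _; exact: He.
- move=> T' T'T P t tT' k.
  have xv' := regular_solution_le T'T xv.
  have Ps := Hs T' x v xv' xt0 P.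
  split; first exact: le_trans (Ps t tT' k) sth.
  apply: le_trans vth; apply: (Hv T' x v xv' xt0 vt0) => // u uT' l.
  by split; [exact: Ps|have [] := P u uT' l].
- move=> t /andP[t0t tT] K.
  have [|xc vc] := @regular_solution_cvg T x v t xv; first by rewrite t0t.
  by apply: funnels_closed => //; case/andP: th01.
Qed.

End FunnelConfinement.

(** * Existence and prolongation of closed-loop motions *)

Section Clamp.
Variable R : realType.
Implicit Types M z : R.

Definition clamp M z : R := Num.max (- M) (Num.min M z).

Lemma clamp_bound M z : 0 <= M -> `|clamp M z| <= M.
Proof.
move=> M0; rewrite /clamp ler_norml le_max lexx/= ge_max ge_min lexx/= andbT.
lra.
Qed.

Lemma clamp_id M z : `|z| <= M -> clamp M z = z.
Proof. by rewrite /clamp ler_norml => /andP[h1 h2]; rewrite (min_idPr h2) (max_idPr h1). Qed.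

Lemma continuous_clamp M (T : topologicalType) (f : T -> R) :
  continuous f -> continuous (fun t => clamp M (f t)).
Proof.
by move=> cf; apply: cts_max; [exact: cst_continuous|apply: cts_min => //; exact: cst_continuous].
Qed.

Lemma continuous_log_ratio_clamp M (T : topologicalType) (f : T -> R) : 0 <= M -> M < 1 ->
  continuous f -> continuous (fun t => log_ratio (clamp M (f t))).
Proof.
move=> M0 M1 cf t.
have c1 := @continuous_clamp M T f cf t.
have c2 : `|clamp M (f t)| < 1 by apply: le_lt_trans M1; exact: clamp_bound.
have := is_derive_continuous (is_derive_log_ratio c2).
exact: (@continuous_comp _ _ _ (fun t => clamp M (f t)) (@log_ratio R) t c1).
Qed.

Lemma is_derive_col_mx m1 m2 n (x : R -> 'M[R]_(m1, n)) (y : R -> 'M[R]_(m2, n)) (t : R)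
    dx dy : is_derive t 1 x dx -> is_derive t 1 y dy ->
  is_derive t 1 (fun u => col_mx (x u) (y u)) (col_mx dx dy).
Proof.
move=> hx hy; apply: is_derive_mx => i j.
have [[i' ->]|[i' ->]] : (exists i', i = lshift m2 i') \/ (exists i', i = rshift m1 i').
  by case: (fintype.splitP i) => i' Hi; [left|right]; exists i'; exact/val_inj.
- under eq_fun do rewrite col_mxEu.
  by rewrite col_mxEu; exact: is_derive_coord.
- under eq_fun do rewrite col_mxEd.
  by rewrite col_mxEd; exact: is_derive_coord.
Qed.

Lemma is_derive_usubmx m1 m2 n (x : R -> 'M[R]_(m1 + m2, n)) (t : R) dx :
  is_derive t 1 x dx -> is_derive t 1 (fun u => usubmx (x u)) (usubmx dx).
Proof.
move=> hx; apply: is_derive_mx => i j.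
by under eq_fun do rewrite mxE; rewrite mxE; exact: is_derive_coord.
Qed.

Lemma is_derive_dsubmx m1 m2 n (x : R -> 'M[R]_(m1 + m2, n)) (t : R) dx :
  is_derive t 1 x dx -> is_derive t 1 (fun u => dsubmx (x u)) (dsubmx dx).
Proof.
move=> hx; apply: is_derive_mx => i j.
by under eq_fun do rewrite mxE; rewrite mxE; exact: is_derive_coord.
Qed.

Lemma horizon_right_continuous m n (t0 : R) (tau : \bar R) (x : R -> 'M[R]_(m, n)) :
  (t0%:E < tau)%E -> {within horizon t0 tau, continuous x} -> x @ t0^'+ --> x t0.
Proof.
move=> t0tau /subspace_continuousP xc.
have /xc {}xc : horizon t0 tau t0 by split.
have [T t0T Ttau] : exists2 T : R, t0 < T & (T%:E <= tau)%E.
  case: tau t0tau {xc} => [T| |]//; first by rewrite lte_fin => h; exists T.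
  by move=> _; exists (t0 + 1); rewrite ?leey// ltrDl.
apply/cvgrPdist_le => e e0; move/cvgrPdist_le : xc => /(_ e e0) xc.
have h : nbhs t0 [set u | horizon t0 tau u -> `|x t0 - x u| <= e] := xc.
have h2 : nbhs t0 [set u | u < T] by exact: lt_nbhsl.
have : nbhs t0 [set u | t0 < u -> `|x t0 - x u| <= e].
  apply: filterS2 h h2 => u hu uT t0u; apply: hu; split; first exact: ltW.
  by apply: lt_le_trans Ttau; rewrite lte_fin.
by [].
Qed.

Lemma right_continuous_horizon m n (t0 : R) (tau : \bar R) (x : R -> 'M[R]_(m, n)) :
  x @ t0^'+ --> x t0 ->
  (forall t, t0 < t -> (t%:E < tau)%E -> derivable x t 1) ->
  {within horizon t0 tau, continuous x}.
Proof.
move=> xr xd; apply/subspace_continuousP => t [t0t ttau].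
have [->|tt0] := eqVneq t t0; last first.
  have /derivable1_diffP/differentiable_continuous xc : derivable x t 1.
    by apply: xd => //; rewrite lt_neqAle eq_sym tt0.
  by apply: cvg_trans xc; apply: cvg_app; exact: cvg_within.
apply/cvgrPdist_le => e e0; move/cvgrPdist_le : xr => /(_ e e0) xr.
have h : nbhs t0 [set u | t0 < u -> `|x t0 - x u| <= e] := xr.
have : nbhs t0 [set u | horizon t0 tau u -> `|x t0 - x u| <= e].
  apply: filterS h => u hu [t0u _]; move: t0u; rewrite le_eqVlt => /predU1P[<-|]; last exact: hu.
  by rewrite subrr normr0 ltW.
by [].
Qed.

End Clamp.

Section Prolongation.
Variables (R : realType) (N : nat) (nq : 'I_N -> nat) (s : manip_system R nq).
Variables (c : control_params R N) (t0 : R) (xd : R -> 'cV[R]_(3 + 3)).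
Variables (x0 v0 : 'cV[R]_(3 + 3)) (D Bd mu : R).
Implicit Types (t T : R) (k : 'I_(3 + 3)).
Hypothesis ok : manip_system_ok s.
Hypothesis t0_ge0 : 0 <= t0.
Hypothesis rs_range : forall k, 0 < rho_sinf c k < rho_s0 c k.
Hypothesis ls_gt0 : forall k, 0 < l_s c k.
Hypothesis gs_gt0 : forall k, 0 < g_s c k.
Hypothesis rv_range : forall k, 0 < rho_vinf c k < rho_v0 c k.
Hypothesis lv_gt0 : forall k, 0 < l_v c k.
Hypothesis gv_gt0 : 0 < g_v c.
Hypothesis share1 : \sum_i share c i = 1.
Hypothesis xd_derivable : forall t, derivable xd t 1.
Hypothesis xd_rate : forall t, t0 <= t -> `|'D_1 xd t| <= D.
Hypothesis xd_position : forall t, t0 <= t -> `|position (xd t)| <= Bd.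
Hypothesis zs_start : forall k, `|zs c t0 xd t0 x0 k| < 1.
Hypothesis zv_start : forall k, `|zv c t0 xd t0 x0 v0 k| < 1.
Hypothesis mu_gt0 : 0 < mu.
Hypothesis start_nonsingular : mu <= `|\det (JO s (angles x0))|.
Hypothesis stays_nonsingular : forall T (x v : R -> 'cV[R]_(3 + 3)),
  closed_loop s c t0 xd T%:E x v -> x t0 = x0 -> v t0 = v0 ->
  forall t, horizon t0 T%:E t -> mu <= `|\det (JO s (angles (x t)))|.

Local Notation zs := (zs c t0 xd).
Local Notation zv := (zv c t0 xd).
Local Notation regular_solution := (regular_solution s c t0 xd).

Lemma closed_loop_regular (tau : \bar R) T (x v : R -> 'cV[R]_(3 + 3)) :
  closed_loop s c t0 xd tau x v -> t0 < T -> (T%:E <= tau)%E ->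
  (forall t, horizon t0 tau t -> \det (JO s (angles (x t))) != 0) ->
  regular_solution T x v.
Proof.
move=> [xc vc sol] t0T Ttau ns.
have t0tau : (t0%:E < tau)%E by apply: lt_le_trans Ttau; rewrite lte_fin.
split; [exact: horizon_right_continuous xc|exact: horizon_right_continuous vc|].
move=> t /andP[t0t tT].
have ttau : (t%:E < tau)%E by apply: lt_le_trans Ttau; rewrite lte_fin.
have [dx dv eqn] := sol t t0t ttau.
have nst : \det (JO s (angles (x t))) != 0 by apply: ns; split => //; exact: ltW.
split=> //; rewrite -coupled_dynamicsE//; last by apply: le_trans t0_ge0 _; exact: ltW.
by rewrite eqn (grasp_input t0 xd rv_range).
Qed.

(** The horizon [tau] may be infinite while those of [regular_solution] are real, so each time
    before [tau] is covered by a real horizon lying beyond it. *)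
Lemma regular_closed_loop (tau : \bar R) (x v : R -> 'cV[R]_(3 + 3)) :
  (forall T, t0 < T -> (T%:E < tau)%E -> exists2 T', T < T' & regular_solution T' x v) ->
  x @ t0^'+ --> x t0 -> v @ t0^'+ --> v t0 ->
  (forall t, t0 < t -> (t%:E < tau)%E -> \det (JO s (angles (x t))) != 0) ->
  closed_loop s c t0 xd tau x v.
Proof.
move=> sol xc vc ns.
have sol' t : t0 < t -> (t%:E < tau)%E -> [/\ is_derive t 1 x (v t), derivable v t 1 &
      MR s (x t) *m 'D_1 v t + drift s t (x t) (v t) =
      - g_v c *: feedback c t0 xd t (x t) (v t)].
  move=> t0t ttau; have [T' tT' [_ _ H]] := sol t t0t ttau.
  by apply: H; rewrite t0t.
split.
- apply: right_continuous_horizon => // t t0t ttau.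
  have [dx _ _] := sol' t t0t ttau.
  by case: dx.
- apply: right_continuous_horizon => // t t0t ttau.
  by have [] := sol' t t0t ttau.
- move=> t t0t ttau; have [dx dv eqn] := sol' t t0t ttau.
  split=> //; rewrite coupled_dynamicsE//; first last.
  + exact: ns.
  + by apply: le_trans t0_ge0 _; exact: ltW.
  by rewrite (grasp_input t0 xd rv_range)//; exact: ns.
Qed.

Section Field.
Variables (th : R).
Hypothesis th01 : 0 < th < 1.

Definition clamped_log (z : R) : R := log_ratio (clamp th z).

(** The clamps are nested: the pose error is clamped already inside the velocity error, since
    [log_ratio] is singular at the funnel boundary. *)
Definition clamped_zv t (x v : 'cV[R]_(3 + 3)) k : R :=
  (rho_v c t0 k t)^-1 * (v k 0 + g_s c k * clamped_log (zs t x k)).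

Definition clamped_feedback t x v : 'cV[R]_(3 + 3) :=
  \col_k ((rho_v c t0 k t)^-1 * (2 / (1 - clamp th (clamped_zv t x v k) ^+ 2))
    * clamped_log (clamped_zv t x v k)).

Definition acceleration t x v : 'cV[R]_(3 + 3) :=
  invmx (MR s x) *m (- g_v c *: clamped_feedback t x v - drift s t x v).

Lemma clamped_feedbackE t x v :
  (forall k, `|zs t x k| <= th /\ `|zv t x v k| <= th) ->
  clamped_feedback t x v = feedback c t0 xd t x v.
Proof.
move=> H; apply/colP => k; rewrite !mxE; have [h1 h2] := H k.
have -> : clamped_zv t x v k = zv t x v k.
  by rewrite /clamped_zv /clamped_log clamp_id.
by rewrite /clamped_log clamp_id.
Qed.

Lemma accelerationE t x v a :
  (forall k, `|zs t x k| <= th /\ `|zv t x v k| <= th) ->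
  MR s x *m a + drift s t x v = - g_v c *: feedback c t0 xd t x v <->
  a = acceleration t x v.
Proof.
move=> H; rewrite /acceleration clamped_feedbackE//; split=> [<-|->].
  by rewrite addrK mulKmx// MR_unit.
by rewrite mulKVmx ?MR_unit// subrK.
Qed.

Lemma continuous_acceleration : continuous
  (fun p : R * 'cV[R]_((3 + 3) + (3 + 3)) => acceleration p.1 (usubmx p.2) (dsubmx p.2)).
Proof.
have [th0 th1] := andP th01; have th0' := ltW th0.
pose T : topologicalType := (R * 'cV[R]_((3 + 3) + (3 + 3)))%type.
have c1 : continuous (fun p : T => p.1) by exact: cts_fst.
have cx : continuous (fun p : T => usubmx p.2 : 'cV[R]_(3 + 3)).
  by apply: cts_usubmx; exact: cts_snd.
have cv : continuous (fun p : T => dsubmx p.2 : 'cV[R]_(3 + 3)).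
  by apply: cts_dsubmx; exact: cts_snd.
have cR (f : R -> R) : continuous f -> continuous (fun p : T => f p.1).
  by move=> cf; exact: (@cts_comp T R R (fun p => p.1) f c1 cf).
have crho (r0 rinf l : 'I_(3 + 3) -> R) k : 0 < rinf k < r0 k ->
    continuous (fun p : T => (perf (r0 k) (rinf k) (l k) t0 p.1)^-1).
  move=> h; apply: (cR (fun u => (perf (r0 k) (rinf k) (l k) t0 u)^-1)) => u.
  apply: cvgV; first by rewrite gt_eqF// perf_gt0.
  exact: is_derive_continuous (is_derive_perf _ _ _ _ _).
have cxd k : continuous (fun p : T => xd p.1 k 0).
  apply: (cR (fun u => xd u k 0)); apply: cts_coord => u.
  by apply: differentiable_continuous; apply/derivable1_diffP.
have czs k : continuous (fun p : T => zs p.1 (usubmx p.2) k).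
  apply: ctsM; first exact: crho.
  have cxk : continuous (fun p : T => (usubmx p.2 : 'cV[R]_(3 + 3)) k 0).
    exact: cts_coord.
  exact: (@ctsD R T R _ _ cxk (@ctsN R T R _ (cxd k))).
have czv k : continuous (fun p : T => clamped_zv p.1 (usubmx p.2) (dsubmx p.2) k).
  apply: ctsM; first exact: crho.
  apply: ctsD; first exact: cts_coord.
  apply: ctsM; first exact: cst_continuous.
  exact: continuous_log_ratio_clamp.
have cfb : continuous (fun p : T => clamped_feedback p.1 (usubmx p.2) (dsubmx p.2)).
  apply/continuous_mxP => k j; under eq_fun do rewrite mxE.
  apply: ctsM; last exact: continuous_log_ratio_clamp.
  apply: ctsM; first exact: crho.
  apply: ctsM; first exact: cst_continuous.
  move=> p; have := @clamp_bound R th (clamped_zv p.1 (usubmx p.2) (dsubmx p.2) k) th0'.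
  move=> cb; have cq := @continuous_clamp R th _ _ (czv k) p.
  apply: cvgV.
    have : clamp th (clamped_zv p.1 (usubmx p.2) (dsubmx p.2) k) ^+ 2 <= th ^+ 2.
      by rewrite square_le_norm.
    by move=> h; rewrite gt_eqF//; nra.
  by apply: cvgB; [exact: cvg_cst|exact: cvgM].
have cdr : continuous (fun p : T => drift s p.1 (usubmx p.2) (dsubmx p.2)).
  apply: (@cts_comp T _ _ (fun p => (p.1, (usubmx p.2, dsubmx p.2)))
    (fun z : R * ('cV[R]_(3 + 3) * 'cV[R]_(3 + 3)) => drift s z.1 z.2.1 z.2.2)).
    exact: (cts_pair c1 (cts_pair cx cv)).
  exact: continuous_drift.
have cM : continuous (fun p : T => MR s (usubmx p.2)).
  have [cF _] := pose_field_MR ok.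
  apply: (@cts_comp T _ _ (fun p => (usubmx p.2, 0 : 'cV[R]_(3 + 3)))
    (fun z => MR s z.1) _ cF).
  by apply: cts_pair; [exact: cx|exact: cst_continuous].
apply: cts_mulmx; first by apply: cts_invmx => // p; exact: MR_unit.
apply: ctsD; last exact: ctsN.
by apply: ctsZ; [exact: cst_continuous|exact: cfb].
Qed.

End Field.

(** For [tau <= t0] only right continuity is asked of the given functions, and the statement becomes
    an existence theorem. *)
Theorem prolongation (tau : R) (x v : R -> 'cV[R]_(3 + 3)) :
  regular_solution tau x v -> x t0 = x0 -> v t0 = v0 ->
  exists x' v' : R -> 'cV[R]_(3 + 3),
    [/\ closed_loop s c t0 xd +oo%E x' v', x' t0 = x0, v' t0 = v0 &
      forall t, t0 <= t < tau -> x' t = x t /\ v' t = v t].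
Proof.
move=> xv xt0 vt0.
have [th1 [th101 thstart confined]] := funnel_confinement ok rs_range ls_gt0 gs_gt0
  rv_range lv_gt0 gv_gt0 xd_derivable xd_rate xd_position zs_start zv_start.
(* The clamping level lies strictly between the confinement level [th1] and 1, so a confined
   solution has room to move before a clamp acts. *)
pose th := (th1 + 1) / 2.
have [th1lt th01] : th1 < th /\ 0 < th < 1.
  by move: th101 => /andP[h1 h2]; rewrite /th; split; [|apply/andP; split]; lra.
have [thp thl] := andP th01; have thl' := ltW thl.
have [A A0 AP] := acceleration_bounded ok rs_range ls_gt0 gs_gt0
  rv_range lv_gt0 gv_gt0 xd_position th01.
have [B B0 BP] := velocity_bound rs_range ls_gt0 gs_gt0 rv_range lv_gt0 xd_position th01.
(* [A] bounds the acceleration and [B] the velocity inside the funnels of level [th]. Truncating the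
   field at [L] makes it globally bounded, as Peano's theorem demands, without changing it there. *)
pose L := Num.max A B.
have L0 : 0 <= L by rewrite le_max A0.
pose F t (z : 'cV[R]_((3 + 3) + (3 + 3))) : 'cV[R]_((3 + 3) + (3 + 3)) :=
  col_mx (dsubmx z) (acceleration th t (usubmx z) (dsubmx z)).
pose f t z := map_mx (clamp L) (F t z).
have cf : continuous (fun p : R * 'cV[R]_((3 + 3) + (3 + 3)) => f p.1 p.2).
  apply/continuous_mxP => i j; under eq_fun do rewrite mxE.
  apply: continuous_clamp; apply: cts_coord; apply: cts_col_mx.
    by apply: cts_dsubmx; exact: cts_snd.
  exact: continuous_acceleration.
have fL t z : `|f t z| <= L.
  by apply/(mx_norm_leP _ L0) => i j; rewrite mxE clamp_bound.
have fF t (x1 v1 : 'cV[R]_(3 + 3)) : t0 <= t ->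
    (forall k, `|zs t x1 k| <= th /\ `|zv t x1 v1 k| <= th) ->
    f t (col_mx x1 v1) = col_mx v1 (acceleration th t x1 v1).
  move=> t0t H; rewrite /f /F col_mxKu col_mxKd.
  apply/matrixP => i j; rewrite mxE clamp_id//.
  have v1L : `|v1| <= L.
    rewrite le_max; apply/orP; right.
    have h1 k : `|zs t x1 k| <= th by have [] := H k.
    have h2 k : `|zv t x1 v1 k| <= 1 by have [_ h] := H k; exact: le_trans h thl'.
    by have [] := BP t x1 v1 t0t h1 h2.
  have aL : `|acceleration th t x1 v1| <= L.
    rewrite le_max; apply/orP; left; apply: (AP t x1 v1) => //.
    exact/(accelerationE _ H).
  apply: le_trans (mx_coord_le _ _ _) _; apply/(mx_norm_leP _ L0) => k l.
  rewrite mxE; case: (fintype.split k) => k'; apply: le_trans (mx_coord_le _ _ _) _ => //.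
have zc : col_mx (x u) (v u) @[u --> t0^'+] --> col_mx (x t0) (v t0).
  by case: xv => xc vc _; exact: cvg_col_mx.
have zd t : t0 < t < tau -> is_derive t 1 (fun u => col_mx (x u) (v u))
    (f t (col_mx (x t) (v t))).
  move=> /andP[t0t ttau]; have tI : t0 <= t < tau by rewrite ltW.
  have H k : `|zs t (x t) k| <= th /\ `|zv t (x t) (v t) k| <= th.
    have [h1 h2] := confined _ _ _ xv xt0 vt0 t tI k.
    by split; apply: le_trans (ltW th1lt).
  rewrite fF ?(ltW t0t)//; have [_ _ /(_ t)] := xv; rewrite t0t ttau => /(_ isT)[dx dv eqn].
  apply: is_derive_col_mx => //.
  have <- : 'D_1 v t = acceleration th t (x t) (v t) by apply/(accelerationE _ H).
  exact: derivableP.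
have [Y [Yz Y0 Yc Yd]] := peano L0 fL cf zc zd.
pose y1 t : 'cV[R]_(3 + 3) := usubmx (Y t); pose y2 t : 'cV[R]_(3 + 3) := dsubmx (Y t).
have y1t0 : y1 t0 = x0 by rewrite /y1 Y0 col_mxKu.
have y2t0 : y2 t0 = v0 by rewrite /y2 Y0 col_mxKd.
have y1c : y1 @ t0^'+ --> y1 t0 by exact: cvg_usubmx.
have y2c : y2 @ t0^'+ --> y2 t0 by exact: cvg_dsubmx.
have YE t : Y t = col_mx (y1 t) (y2 t) by rewrite vsubmxK.
have dY t : t0 < t -> is_derive t 1 Y (f t (col_mx (y1 t) (y2 t))).
  by move=> t0t; rewrite -YE; exact: Yd.
have cY t : t0 < t -> y1 @ t --> y1 t /\ y2 @ t --> y2 t.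
  move=> t0t; have Yct : Y @ t --> Y t.
    apply: differentiable_continuous; apply/derivable1_diffP.
    by have [] := Yd t t0t.
  by split; [exact: cvg_usubmx|exact: cvg_dsubmx].
have cdet : continuous (fun x : 'cV[R]_(3 + 3) => `|\det (JO s (angles x))|).
  have cd : continuous (fun x : 'cV[R]_(3 + 3) => \det (JO s (angles x))).
    by apply: cts_det; exact: continuous_JO.
  exact: (@cts_comp _ _ _ _ (fun r : R => `|r|) cd (@norm_continuous _ R)).
(* The determinant has to be part of the induction: the bound [mu] is granted only along closed-loop
   motions, and [Y] is known to be one only as long as the determinant does not vanish. *)
pose P t := (forall k, `|zs t (y1 t) k| < th /\ `|zv t (y1 t) (y2 t) k| < th) /\
  0 < `|\det (JO s (angles (y1 t)))|.
pose K t := (forall k, `|zs t (y1 t) k| <= th1 /\ `|zv t (y1 t) (y2 t) k| <= th1) /\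
  mu <= `|\det (JO s (angles (y1 t)))|.
have PR T : (forall t, t0 <= t < T -> P t) -> regular_solution T y1 y2.
  move=> PT; split=> // t /andP[t0t tT].
  have [|PT1 _] := PT t; first by rewrite tT ltW.
  have H k : `|zs t (y1 t) k| <= th /\ `|zv t (y1 t) (y2 t) k| <= th.
    by have [h1 h2] := PT1 k; split; exact: ltW.
  have := dY t t0t; rewrite fF ?(ltW t0t)// => dYt.
  have := is_derive_usubmx dYt; rewrite col_mxKu => d1.
  have := is_derive_dsubmx dYt; rewrite col_mxKd => d2.
  split; [exact: d1|by case: d2|].
  by apply/(accelerationE _ H); case: d2 => _ <-.
have PC T : (forall t, t0 <= t < T -> P t) -> closed_loop s c t0 xd T%:E y1 y2.
  move=> PT; apply: regular_closed_loop => //.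
    move=> T1 t0T1; rewrite lte_fin => T1T; exists T => //; exact: PR.
  move=> t t0t; rewrite lte_fin => tT; have [|_] := PT t; first by rewrite tT ltW.
  by rewrite normr_gt0.
have KP t : K t -> P t.
  move=> [K1 K2]; split; last exact: lt_le_trans K2.
  by move=> k; have [h1 h2] := K1 k; split; exact: le_lt_trans th1lt.
have allK T t : t0 <= t < T -> K t.
  apply: (@continuous_induction R P K).
  - move=> _; split; last by rewrite y1t0.
    by move=> k; rewrite y1t0 y2t0.
  - move=> u /andP[t0u uT] /KP[P1 P2].
    have [y1u y2u] : y1 @ u^'+ --> y1 u /\ y2 @ u^'+ --> y2 u.
      have [->//|uu0] := eqVneq u t0.
      have [|h1 h2] := cY u; first by rewrite lt_neqAle eq_sym uu0.
      by split; apply: cvg_at_right_filter.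
    have [e1 e10 He1] := funnels_open rs_range rv_range xd_derivable y1u y2u thl' P1.
    have dc : `|\det (JO s (angles (y1 w)))| @[w --> u^'+] -->
        `|\det (JO s (angles (y1 u)))|.
      exact: (cvg_comp _ _ y1u (cdet (y1 u))).
    have nd : \forall w \near u^'+, 0 < `|\det (JO s (angles (y1 w)))|.
      exact: (cvgr_gt _ dc).
    have /nbhs_ballP[e2 /= e20 He2] : nbhs u [set w | u < w ->
      0 < `|\det (JO s (angles (y1 w)))|] := nd.
    exists (Num.min e1 e2); first by rewrite lt_min e10.
    move=> w /andP[uw]; rewrite -ltrBlDl lt_min => /andP[we1 we2] _; split.
      by apply: He1; rewrite uw -ltrBlDl.
    move: uw; rewrite le_eqVlt => /predU1P[<-//|uw].
    by apply: He2 => //; rewrite /ball/= distrC ger0_norm// subr_ge0 ltW.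
  - move=> T' _ PT u uT; split.
      by apply: (confined T') => //; exact: PR.
    apply: (stays_nonsingular (PC T' PT) y1t0 y2t0).
    by case/andP: uT => u1 u2; split; rewrite ?lte_fin.
  - move=> u /andP[t0u uT] Ku; have [h1 h2] := cY u t0u; split.
      apply: (funnels_closed rs_range rv_range xd_derivable t0u h1 h2).
        exact: lt_trans thl.
      by move=> w uw; have [] := Ku w uw.
    have dc : `|\det (JO s (angles (y1 w)))| @[w --> u^'-] -->
        `|\det (JO s (angles (y1 u)))|.
      exact: (cvg_comp _ _ (cvg_at_left_filter h1) (cdet (y1 u))).
    apply: (cvgr_to_ge dc); near=> w; have [] // := Ku w _.
    apply/andP; split; first by apply: ltW; near: w; exact: nbhs_left_gt.
    by near: w; exact: nbhs_left_lt.
have allP T t : t0 <= t < T -> P t by move=> tT; exact/KP/(allK T).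
exists y1, y2; split; [|exact: y1t0|exact: y2t0|].
- apply: regular_closed_loop; [|exact: y1c|exact: y2c|].
    by move=> T t0T _; exists (T + 1); [rewrite ltrDl|apply: PR; exact: allP].
  move=> t t0t _; have [|_] := allP (t + 1) t; first by rewrite ltrDl ltr01 ltW.
  by rewrite normr_gt0.
- by move=> t tT; rewrite /y1 /y2 Yz// col_mxKu col_mxKd.
Unshelve. all: by end_near. Qed.

End Prolongation.

(** * Adjacent regions *)

Section EuclideanDistance.
Variable R : realType.
Implicit Types a b : 'cV[R]_3.

Lemma sum_sq_ge0 a : 0 <= \sum_i a i 0 ^+ 2.
Proof. by apply: sumr_ge0 => i _; exact: sqr_ge0. Qed.

Lemma coord_le_edist a b k : `|a k 0 - b k 0| <= Defs.edist a b.
Proof.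
rewrite /Defs.edist /enorm -sqrtr_sqr; apply: ler_wsqrtr.
rewrite (bigD1 k)//= !mxE lerDl; apply: sumr_ge0 => i _; exact: sqr_ge0.
Qed.

Lemma edist_lt a b (r : R) : 0 < r ->
  (Defs.edist a b < r) = (\sum_i (a i 0 - b i 0) ^+ 2 < r ^+ 2).
Proof.
move=> r0; rewrite /Defs.edist /enorm -[r in LHS]gtr0_norm// -sqrtr_sqr ltr_sqrt ?exprn_gt0//.
by congr (_ < _); apply: eq_bigr => i _; rewrite !mxE.
Qed.

Lemma edist_eq a b (r : R) : 0 <= r -> Defs.edist a b = r ->
  \sum_i (a i 0 - b i 0) ^+ 2 = r ^+ 2.
Proof.
move=> r0 <-; rewrite /Defs.edist /enorm sqr_sqrtr ?sum_sq_ge0//.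
by apply: eq_bigr => i _; rewrite !mxE.
Qed.

End EuclideanDistance.

Section AdjacentRegions.
Variables (R : realType) (W : workspace R) (j j' : 'I_(nreg W)).
Hypothesis Wok : workspace_ok W.
Hypothesis jj' : adjacent_regions j j'.
Hypothesis ball_j : [set p | Defs.edist p (Defs.center j) < Lhat W + l0 W] `<=` region j `|` region j'.

Let h := Lhat W + l0 W.

(** The cells of a partition are nonempty, hence so is the half-open side of the cube. *)
Lemma half_side_gt0 : 0 < h.
Proof.
have [_ _ /(_ j I)[p [_ /(_ ord0) /andP[p1 p2]]]] := ws_partition Wok.
have := le_lt_trans p1 p2; rewrite -/h /h; lra.
Qed.

Lemma adjacent_sum_sq : \sum_i (Defs.center j' i 0 - Defs.center j i 0) ^+ 2 = (2 * h) ^+ 2.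
Proof.
have h0 := half_side_gt0.
rewrite -(@edist_eq _ (Defs.center j) (Defs.center j') (2 * h)); last 2 first.
- by rewrite mulr_ge0// ltW.
- by rewrite jj' /h; ring.
by apply: eq_bigr => i _; rewrite -sqrrN opprB.
Qed.

(* Otherwise the cubes overlap around the midpoint of their centres, and points
   of the ball around the first centre that are close to the midpoint lie in
   both regions. *)
Lemma adjacent_axis : exists k0 : 'I_3,
  `|Defs.center j' k0 0 - Defs.center j k0 0| = 2 * h /\
  forall k, k != k0 -> Defs.center j' k 0 = Defs.center j k 0.
Proof.
have h0 := half_side_gt0; have S := adjacent_sum_sq.
pose d k := Defs.center j' k 0 - Defs.center j k 0.
have h20 : 0 <= 2 * h by rewrite mulr_ge0// ltW.
have [[k0 k0P]|no] := pselect (exists k0, 2 * h <= `|d k0|).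
  have sq : (2 * h) ^+ 2 <= d k0 ^+ 2.
    by rewrite -[d k0 ^+ 2]real_normK ?num_real// ler_sqr ?nnegrE.
  have rest0 : 0 <= \sum_(k | k != k0) d k ^+ 2.
    by apply: sumr_ge0 => k _; exact: sqr_ge0.
  have SE : d k0 ^+ 2 + \sum_(k | k != k0) d k ^+ 2 = (2 * h) ^+ 2.
    by rewrite -S [in RHS](bigD1 k0).
  have rest : \sum_(k | k != k0) d k ^+ 2 = 0 by lra.
  exists k0; split.
    apply/eqP; rewrite eq_le k0P andbT -square_le_norm//.
    by rewrite -SE lerDl.
  move=> k kk0; apply/eqP; rewrite -subr_eq0 -sqrf_eq0.
  have /psumr_eq0P/(_ rest) -> // : forall i, i != k0 -> 0 <= d i ^+ 2.
  by move=> i _; exact: sqr_ge0.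
exfalso.
have dlt k : `|d k| < 2 * h.
  by rewrite ltNge; apply/negP => hk; apply: no; exists k.
(* There are finitely many coordinates, so the strict inequalities [dlt] hold with a common factor
   [m < 1]. *)
have [m /andP[m0 m1] mP] := @finite_lt1_bound R _ (fun k => `|d k| / (2 * h))
  (fun k => ltac:(by rewrite ltr_pdivrMr ?mul1r// mulr_gt0)).
have dm k : `|d k| <= m * (2 * h) by rewrite -ler_pdivrMr ?mP// mulr_gt0.
pose del := (1 - m) / 4; pose s := 2^-1 - del.
pose p : 'cV[R]_3 := \col_k (Defs.center j k 0 + s * d k).
have [s0 s1] : 0 < s /\ s < 2^-1 by rewrite /s /del; split; lra.
have sm : (1 - s) * (m * (2 * h)) < h.
  have m3 : 0 < (1 - m) * (2 - m) * h by rewrite !mulr_gt0//; lra.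
  by rewrite /s /del; lra.
have pball : Defs.edist p (Defs.center j) < h.
  rewrite edist_lt//.
  have -> : \sum_i (p i 0 - Defs.center j i 0) ^+ 2 = s ^+ 2 * \sum_i d i ^+ 2.
    by rewrite mulr_sumr; apply: eq_bigr => i _; rewrite mxE; ring.
  have s2 : 0 < (4^-1 - s ^+ 2) * h ^+ 2.
    by apply: mulr_gt0; [nra|exact: exprn_gt0].
  rewrite S; lra.
have wsp : ws_set W p.
  by have [[]|[]] := ball_j pball.
have regj : region j p.
  split=> // k; rewrite mxE; have hE : h = Lhat W + l0 W by [].
  have := dlt k; rewrite ltr_norml => /andP[d1 d2].
  have k1 : s * d k < s * (2 * h) by rewrite ltr_pM2l.
  have k2 : s * - (2 * h) < s * d k by rewrite ltr_pM2l.
  have k3 : 0 < (2^-1 - s) * h by rewrite mulr_gt0 ?subr_gt0.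
  by apply/andP; split; lra.
have regj' : region j' p.
  split=> // k; rewrite mxE; have hE : h = Lhat W + l0 W by [].
  have -> : Defs.center j k 0 = Defs.center j' k 0 - d k by rewrite /d; ring.
  have := dm k; rewrite ler_norml => /andP[d1 d2].
  have s0' : 0 <= 1 - s by lra.
  have k1 := ler_wpM2l s0' d1; have k2 := ler_wpM2l s0' d2.
  by apply/andP; split; lra.
have [_ triv _] := ws_partition Wok.
(* Disjointness identifies the two regions, so their centres coincide, against a distance
   [2 * h > 0]. *)
have E : j = j' by apply: (triv j j' I I); exists p.
have := dlt ord0; move: S; rewrite -E.
rewrite big1 => [|i _]; last by rewrite subrr expr0n.
by move/esym/eqP; rewrite sqrf_eq0 mulf_eq0 pnatr_eq0/= => /eqP hE; move: h0; rewrite hE ltxx.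
Qed.

(** Across the axis [k0] both cubes have the same sides; along it their half-open sides abut without
    a gap, and a box centred on the segment cannot reach past either far end. *)
Lemma box_in_regions (a : R) (p : 'cV[R]_3) : 0 <= a <= 1 -> ws_set W p ->
  (forall k, `|p k 0 - (Defs.center j + a *: (Defs.center j' - Defs.center j)) k 0| < h) ->
  (region j `|` region j') p.
Proof.
move=> /andP[a0 a1] wsp pP; have h0 := half_side_gt0.
have [k0 [k0P kP]] := adjacent_axis.
have pk k : k != k0 -> Defs.center j k 0 - h <= p k 0 < Defs.center j k 0 + h.
  move=> kk0; have := pP k; rewrite !mxE kP// subrr mulr0 addr0 ltr_norml.
  by move=> /andP[h1 h2]; apply/andP; split; lra.
have := pP k0; rewrite !mxE ltr_norml => /andP[h1 h2].
have side : Defs.center j k0 0 - h <= p k0 0 < Defs.center j k0 0 + h \/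
    Defs.center j' k0 0 - h <= p k0 0 < Defs.center j' k0 0 + h.
  set x := Defs.center j k0 0 in k0P h1 h2 *; set y := Defs.center j' k0 0 in k0P h1 h2 *.
  (* The common face belongs to the cube on its upper side, so the comparison is strict or not
     according to the direction of the transition. *)
  have [yx|yx] := leP x y.
    have E : y = x + 2 * h by move: k0P; rewrite ger0_norm ?subr_ge0// => <-; ring.
    rewrite E in h1 h2 *.
    have [pl|pr] := ltP (p k0 0) (x + h); [left|right]; apply/andP; split; nra.
  have E : y = x - 2 * h by move: k0P; rewrite ltr0_norm ?subr_lt0// => <-; ring.
  rewrite E in h1 h2 *.
  have [pl|pr] := leP (x - h) (p k0 0); [left|right]; apply/andP; split; nra.
have cube (i : 'I_(nreg W)) : (forall k, Defs.center i k 0 - h <= p k 0 < Defs.center i k 0 + h) ->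
    region i p.
  move=> H; split=> // k; have /andP[p1 p2] := H k.
  by have hE : h = Lhat W + l0 W by []; apply/andP; split; lra.
case: side => side; [left|right]; apply: cube => k.
  by have [->|/pk] := eqVneq k k0.
by have [->|kk0] := eqVneq k k0; rewrite // kP//; exact: pk.
Qed.

End AdjacentRegions.

(** * The transition *)

Section BoundedSignals.
Variables (R : realType) (N : nat) (nq : 'I_N -> nat) (s : manip_system R nq).
Variables (c : control_params R N) (t0 : R) (xd : R -> 'cV[R]_(3 + 3)).
Variables (Bd th : R) (x v : R -> 'cV[R]_(3 + 3)).
Implicit Types (t : R) (k : 'I_(3 + 3)).
Hypothesis ok : manip_system_ok s.
Hypothesis rs_range : forall k, 0 < rho_sinf c k < rho_s0 c k.
Hypothesis ls_gt0 : forall k, 0 < l_s c k.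
Hypothesis gs_gt0 : forall k, 0 < g_s c k.
Hypothesis rv_range : forall k, 0 < rho_vinf c k < rho_v0 c k.
Hypothesis lv_gt0 : forall k, 0 < l_v c k.
Hypothesis gv_gt0 : 0 < g_v c.
Hypothesis xd_position : forall t, t0 <= t -> `|position (xd t)| <= Bd.
Hypothesis th01 : 0 < th < 1.
Hypothesis confined : forall t, t0 <= t -> forall k,
  `|zs c t0 xd t (x t) k| <= th /\ `|zv c t0 xd t (x t) (v t) k| <= th.
Hypothesis nonsingular : forall t, t0 <= t -> \det (JO s (angles (x t))) != 0.
Hypothesis dynamics : forall t, t0 < t ->
  MR s (x t) *m 'D_1 v t + drift s t (x t) (v t) =
  - g_v c *: feedback c t0 xd t (x t) (v t).

Lemma confined_signals_bounded : bounded_signals s c t0 xd x v.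
Proof.
have [th0 th1] := andP th01; have th1' := ltW th1.
pose A := [set t | t0 <= t].
have [B B0 BP] := velocity_bound rs_range ls_gt0 gs_gt0 rv_range lv_gt0 xd_position th01.
have xvB t : A t -> `|position (x t)| <= B /\ `|v t| <= B.
  move=> t0t; apply: (BP t) => // k; have [h1 h2] := confined t0t k => //.
  exact: le_trans h2 th1'.
have xB t : A t -> `|position (x t)| <= B by move=> /xvB[].
have vb : mbdd A v by exists B => t /xvB[].
have JRb i : mbdd A (fun t => JR s i (x t)).
  by apply: (mbdd_sub (h := x) (mbdd_JR ok i B)) => t /xB.
have lth0 : 0 <= log_ratio th.
  have h : `|th| <= th by rewrite gtr0_norm.
  exact: le_trans (normr_ge0 (log_ratio th)) (log_ratio_le h th1).
have epsb : mbdd A (fun t => eps_s c t0 xd t (x t)).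
  apply/mbddP; exists (log_ratio th) => // t t0t k i; rewrite mxE xi_sE.
  by apply: log_ratio_le => //; have [] := confined t0t k.
have refb : mbdd A (fun t => xd_dot_ref c t0 xd t (x t)).
  move/mbddP: epsb => [E E0 EP]; have [G G0 GP] := finite_bound (g_s c).
  apply/mbddP; exists (G * E); first exact: mulr_ge0.
  move=> t t0t k i; rewrite mxE mulNr normrN normrM (gtr0_norm (gs_gt0 k)).
  by apply: ler_pM => //; [exact: ltW|exact: EP].
have xivb : mbdd A (fun t => xi_v c t0 xd t (x t) (v t)).
  apply/mbddP; exists th; first exact: ltW.
  by move=> t t0t k i; rewrite ord1 xi_vE//; have [] := confined t0t k.
have fbb : mbdd A (fun t => feedback c t0 xd t (x t) (v t)).
  have [F F0 FP] := feedback_bounded t0 xd rv_range lv_gt0 th01.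
  by exists F => t t0t; apply: FP => // k; have [] := confined t0t k.
split.
- by apply: mbdd_bounded; exists B => t /xB.
- move=> i; apply: mbdd_bounded.
  have cp : continuous (fun x => position (fO s i x)).
    by apply: cts_usubmx; exact: continuous_fO.
  have pp : pose_fun (fun x => position (fO s i x)).
    by move=> y k; rewrite fO_shift// position_shift.
  by apply: (mbdd_sub (h := x) (pose_field_mbdd B (pose_field_pose cp pp))) => t /xB.
- exact: mbdd_bounded.
- move=> i; apply: mbdd_bounded; apply: mbddM => //.
  by apply: (eq_mbdd _ (JRb i)) => t At; rewrite JOi_JR//; exact: nonsingular.
- have [D D0 DP] := acceleration_bounded ok rs_range ls_gt0 gs_gt0 rv_range lv_gt0
    gv_gt0 xd_position th01.
  apply: mbdd_bounded; exists D => t /= t0t.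
  by apply: (DP t (x t) (v t)); [exact: ltW|exact: confined (ltW t0t)|exact: dynamics].
- have [S S0 SP] := finite_bound (rho_s0 c).
  apply: mbdd_bounded; apply/mbddP; exists S => // t t0t k i; rewrite ord1 !mxE.
  apply: le_trans (SP k); have [h1 _] := confined t0t k.
  apply: le_trans (zs_bound_inv (perf_gt0 _ _ _ (rs_range k)) h1) _.
  have /andP[_ r2] := perf_bounds (rs_range k) (ls_gt0 k) t0t.
  apply: le_trans r2; rewrite ler_piMl//; apply: ltW; exact: perf_gt0.
- apply: mbdd_bounded; apply/mbddP; exists th; first exact: ltW.
  by move=> t t0t k i; rewrite ord1 xi_sE; have [] := confined t0t k.
- exact: mbdd_bounded.
- exact: mbdd_bounded.
- by apply: mbdd_bounded; exact: mbddB.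
- exact: mbdd_bounded.
- apply: mbdd_bounded; apply/mbddP; exists (2 / (1 - th ^+ 2)).
    by rewrite divr_ge0//; nra.
  move=> t t0t k l; rewrite mxE; have [_ h2] := confined t0t k.
  have zsq : zv c t0 xd t (x t) (v t) k ^+ 2 <= th ^+ 2 by rewrite square_le_norm// ltW.
  have th2 : 0 < 1 - th ^+ 2 by nra.
  have zl : `|2 / (1 - zv c t0 xd t (x t) (v t) k ^+ 2)| <= 2 / (1 - th ^+ 2).
    rewrite ger0_norm; last by rewrite divr_ge0//; lra.
    by rewrite ler_wpM2l// lef_pV2 ?posrE//; lra.
  move: (xi_vE t0 xd rv_range t (x t) (v t) k).
  move: (xi_v _ _ _ _ _ _) => xi xiE; rewrite mxE xiE.
  case: eqP => _; rewrite ?mulr1n// mulr0n normr0.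
  by rewrite divr_ge0//; lra.
- apply: mbdd_bounded; apply/mbddP; exists (log_ratio th) => // t t0t k i.
  rewrite mxE; move: (xi_vE t0 xd rv_range t (x t) (v t) k) => ->.
  by apply: log_ratio_le => //; have [] := confined t0t k.
- apply: mbdd_bounded; apply: mbdd_mxcol => i.
  have Kb : mbdd A (fun t => (invmx (JR s i (x t)))^T).
    by apply: mbdd_tr; apply: (mbdd_sub (h := x) (mbdd_invJR ok i B)) => t /xB.
  apply: (@eq_mbdd _ _ _ _ _ (fun t => (- (share c i * g_v c))%:M *m
    ((invmx (JR s i (x t)))^T *m feedback c t0 xd t (x t) (v t)))).
    move=> t At; rewrite /control mul_scalar_mx; congr (_ *: _).
    rewrite -(feedbackE t0 xd rv_range) trmx_inv JOi_JR//; first by rewrite !mulmxA.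
    exact: nonsingular.
  by apply: mbddM; [exact: mbdd_cst|exact: mbddM].
Qed.

End BoundedSignals.

(** As solutions need not be unique, the closed-loop trajectory of the informal statement is
    rendered by existence, prolongation of every motion given on a finite horizon, and the
    transition for every joint trajectory. *)
Theorem theorem2 (R : realType) (N : nat) (nq : 'I_N -> nat)
    (s : manip_system R nq) (W : workspace R) (c : control_params R N)
    (t0 dt : R) (j j' : 'I_(nreg W)) (pd etad : R -> 'cV[R]_3)
    (q0 : 'cV[R]_(\sum_i nq i)) (v0 : 'cV[R]_(3 + 3)) :
  let xd := desired_pose pd etad in
  manip_system_ok s ->
  workspace_ok W ->
  body_ok W s ->
  0 <= t0 ->
  rigid_grasp s q0 ->
  in_region s q0 j ->
  adjacent_regions j j' ->
  0 <= dt ->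
  desired_ok j j' t0 dt pd etad ->
  params_ok c t0 xd (l0 W) (xO s q0) v0 ->
  funnel_in_ball c t0 (l0 W) (t0 + dt) ->
  away_from_singularities s c t0 xd (xO s q0) v0 ->
  [/\ (* the closed-loop system has a solution for all times *)
      exists x v : R -> 'cV[R]_(3 + 3),
        [/\ closed_loop s c t0 xd +oo%E x v, x t0 = xO s q0 & v t0 = v0],
      (* no closed-loop solution escapes in finite time *)
      forall (tau : R) (x v : R -> 'cV[R]_(3 + 3)), t0 < tau ->
        closed_loop s c t0 xd tau%:E x v -> x t0 = xO s q0 -> v t0 = v0 ->
        exists x' v' : R -> 'cV[R]_(3 + 3),
          closed_loop s c t0 xd +oo%E x' v' /\
          forall t, t0 <= t < tau -> x' t = x t /\ v' t = v t &
      (* every closed-loop trajectory performs the transition *)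
      forall (q : R -> 'cV[R]_(\sum_i nq i)) (v : R -> 'cV[R]_(3 + 3)),
        joint_closed_loop s c t0 xd +oo%E q v -> q t0 = q0 -> v t0 = v0 ->
        [/\ in_region s (q (t0 + dt)) j',
            forall t, t0 <= t <= t0 + dt ->
              body s (q t) `<=` region j `|` region j',
            bounded_signals s c t0 xd (xO s \o q) v &
            transition s t0 q0 v0 j j' dt]].
Proof.
move=> xd ok Wok bok t0_ge0 grasp0 [body0 dist0] adj dt0 dok pok funnel.
move=> [mu [mu0 /nonsingular_poseE-/(_ ok) start_ns stays]].
have rs_range := rho_s_range pok; have rv_range := rho_v_range pok.
have ls0 := l_s_gt0 pok; have gs0 := g_s_gt0 pok; have lv0 := l_v_gt0 pok.
have gv0 := g_v_gt0 pok; have sh1 := share_sum pok.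
have l00 := l0_gt0 Wok.
have smooth_derivable (p : R -> 'cV[R]_3) : smooth p -> forall t, derivable p t 1.
  by move=> /(_ 1%N)[dp _] t; apply: diff_derivable.
have xd_derivable t : derivable xd t 1.
  have dp : derivable pd t 1 by apply: smooth_derivable; exact: pd_smooth dok.
  have de : derivable etad t 1 by apply: smooth_derivable; exact: etad_smooth dok.
  by have [] := is_derive_col_mx (derivableP dp) (derivableP de).
have [D xd_rate] : exists D, forall t, t0 <= t -> `|'D_1 xd t| <= D.
  exact: bounded_mbdd (xd_bounded dok).
have xdE t : position (xd t) = pd t by rewrite /position /xd /desired_pose col_mxKu.
have [Bd xd_position] : exists Bd, forall t, t0 <= t -> `|position (xd t)| <= Bd.
  exists (`|Defs.center j| + `|Defs.center j' - Defs.center j|) => t t0t.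
  rewrite xdE; have [a /andP[a0 a1] ->] := pd_segment dok t0t.
  apply: le_trans (ler_normD _ _) _; rewrite lerD2l normrZ (ger0_norm a0).
  by rewrite ler_piMl.
have xd_coord t (k : 'I_3) : xd t (lshift 3 k) 0 = pd t k 0.
  by rewrite /xd /desired_pose col_mxEu.
clearbody xd.
(* The desired position starts at the centre of the region, so condition (ii) of [in_region] places
   the initial position errors below [l0], the initial width of the funnel. *)
have e_start k : `|xO s q0 k 0 - xd t0 k 0| < rho_s0 c k.
  have [k3|k3] := ltnP k 3.
    rewrite (rho_s0_pos pok k3).
    have -> : k = lshift 3 (Ordinal k3) by exact: val_inj.
    rewrite xd_coord (pd_start dok); apply: le_lt_trans dist0.
    have := coord_le_edist (position (xO s q0)) (Defs.center j) (Ordinal k3).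
    by rewrite {1}/position mxE.
  by have := rho_s0_ang pok k3; rewrite !mxE.
have zs_start k : `|zs c t0 xd t0 (xO s q0) k| < 1.
  have r0 : 0 < rho_s0 c k by exact: le_lt_trans (e_start k).
  rewrite /zs /rho_s perf_start normrM normfV (gtr0_norm r0) mulrC.
  by rewrite ltr_pdivrMr// mul1r.
have zv_start k : `|zv c t0 xd t0 (xO s q0) v0 k| < 1.
  have ek := rho_v0_gt pok k.
  have r0 : 0 < rho_v0 c k by exact: le_lt_trans ek.
  rewrite /zv /rho_v perf_start normrM normfV (gtr0_norm r0) mulrC.
  rewrite ltr_pdivrMr// mul1r; apply: le_lt_trans ek; rewrite !mxE.
  by rewrite mulNr opprK.
have ns_of (tau : \bar R) (x v : R -> 'cV[R]_(3 + 3)) : closed_loop s c t0 xd tau x v ->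
    x t0 = xO s q0 -> v t0 = v0 -> forall t, horizon t0 tau t ->
    mu <= `|\det (JO s (angles (x t)))|.
  move=> cl x0E v0E t tH.
  by have /(nonsingular_poseE ok) := stays tau x v cl x0E v0E t tH.
have det_neq0 (x : 'cV[R]_(3 + 3)) : mu <= `|\det (JO s (angles x))| ->
    \det (JO s (angles x)) != 0.
  by move=> mux; rewrite -normr_gt0; exact: lt_le_trans mux.
have ext (tau : R) (x v : R -> 'cV[R]_(3 + 3)) :=
  @prolongation R N nq s c t0 xd (xO s q0) v0 D Bd mu ok t0_ge0 rs_range ls0 gs0
    rv_range lv0 gv0 sh1 xd_derivable xd_rate xd_position zs_start zv_start mu0
    start_ns (fun T x v cl x0E v0E => ns_of T%:E x v cl x0E v0E) tau x v.
split.
(* On the empty time interval (t0, t0) the constant functions satisfy the dynamics vacuously, and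
   prolonging them yields existence. *)
- have sol0 : regular_solution s c t0 xd t0 (fun=> xO s q0) (fun=> v0).
    split; [exact: cvg_cst|exact: cvg_cst|].
    by move=> t /andP[t0t tt0]; have := lt_trans t0t tt0; rewrite ltxx.
  have [x [v [cl xt0 vt0 _]]] := ext t0 _ _ sol0 erefl erefl.
  by exists x, v.
- move=> tau x v t0tau cl xt0 vt0.
  have ns t : horizon t0 tau%:E t -> \det (JO s (angles (x t))) != 0.
    by move=> tH; apply: det_neq0; exact: (ns_of _ _ _ cl xt0 vt0 _ tH).
  have sol := closed_loop_regular ok t0_ge0 rv_range sh1 cl t0tau (lexx _) ns.
  by have [x' [v' [cl' _ _ xx']]] := ext tau x v sol xt0 vt0; exists x', v'.
- move=> q v jcl qt0 vt0.
  have [qc qg cl] := jcl.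
  have clq : closed_loop s c t0 xd +oo%E (xO s \o q) v by exact: cl.
  have xt0 : (xO s \o q) t0 = xO s q0 by rewrite /= qt0.
  have ns t : t0 <= t -> \det (JO s (angles ((xO s \o q) t))) != 0.
    move=> t0t; apply: det_neq0; apply: (ns_of +oo%E _ v clq xt0 vt0).
    by split=> //; rewrite ltry.
  have sol T : t0 < T -> regular_solution s c t0 xd T (xO s \o q) v.
    move=> t0T; apply: (closed_loop_regular ok t0_ge0 rv_range sh1 clq t0T (leey _)).
    by move=> t [t0t _]; exact: ns.
  have [th [th01 _ confined']] := funnel_confinement ok rs_range ls0 gs0
    rv_range lv0 gv0 xd_derivable xd_rate xd_position zs_start zv_start.
  have confined t : t0 <= t -> forall k,
      `|zs c t0 xd t (xO s (q t)) k| <= th /\ `|zv c t0 xd t (xO s (q t)) (v t) k| <= th.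
    move=> t0t; apply: (confined' (t + 1) (xO s \o q) v) => //.
      by apply: sol; apply: le_lt_trans t0t _; rewrite ltrDl.
    by rewrite t0t ltrDl ltr01.
  have [th0 th1] := andP th01.
  have err t (k : 'I_3) : t0 <= t ->
      `|position (xO s (q t)) k 0 - pd t k 0| < rho_s c t0 (lshift 3 k) t.
    move=> t0t; have [h1 _] := confined t t0t (lshift 3 k).
    have r0 : 0 < rho_s c t0 (lshift 3 k) t by exact: perf_gt0.
    have := zs_bound_inv r0 h1; rewrite xd_coord /position mxE => h.
    by apply: le_lt_trans h _; rewrite gtr_pMl.
  have body_near t p (k : 'I_3) : body s (q t) p ->
      `|p k 0 - position (xO s (q t)) k 0| <= Lhat W.
    by move=> bp; exact: le_trans (coord_le_edist _ _ _) (Lhat_sup bok bp).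
  have bounded : bounded_signals s c t0 xd (xO s \o q) v.
    apply: (confined_signals_bounded ok rs_range ls0 gs0 rv_range lv0 gv0 xd_position th01).
    - exact: confined.
    - exact: ns.
    - move=> t t0t; have t0t1 : t0 < t + 1 by apply: lt_trans t0t _; rewrite ltrDl.
      have [_ _ /(_ t)] := sol _ t0t1.
      by rewrite t0t ltrDl ltr01 => /(_ isT)[].
  have t0e : t0 <= t0 + dt by rewrite lerDl.
  have arrive : in_region s (q (t0 + dt)) j'.
    (* Each position error is strictly below its funnel, and [funnel_in_ball] bounds the sum of the
       squared widths by the square of [l0]. With the reach [Lhat] of the body this also yields the
       inclusion in the cube. *)
    have dist : Defs.edist (position (xO s (q (t0 + dt)))) (Defs.center j') < l0 W.
      rewrite edist_lt//; apply: lt_le_trans funnel.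
      rewrite big_split_ord/= [X in _ < _ + X]big1 ?addr0; last first.
        by move=> i; rewrite ltnNge leq_addr.
      rewrite [ltRHS](eq_bigl xpredT); last by move=> i /=; rewrite ltn_ord.
      apply: ltr_sum => [|i _]; first by apply/hasP; exists ord0; rewrite ?mem_index_enum.
      rewrite -(pd_end dok (lexx _)) -[X in X < _]real_normK ?num_real//.
      rewrite ltr_sqr ?nnegrE ?err// ltW//; exact: perf_gt0.
    split=> // p bp; split; first exact: (body_ws bok bp).
    move=> k; have b1 := body_near _ _ k bp.
    have b2 := le_lt_trans (coord_le_edist _ _ k) dist.
    move: b1 b2; rewrite ler_norml ltr_norml => /andP[? ?] /andP[? ?].
    by apply/andP; split; lra.
  (* A point of the body is within [Lhat] of [p_O], and [p_O] is strictly within [l0] of [p_d], in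
     each coordinate; the point thus lies in a box of half-side [Lhat + l0] centred on the
     segment. *)
  have during t : t0 <= t <= t0 + dt -> body s (q t) `<=` region j `|` region j'.
    move=> /andP[t0t _] p bp.
    have [a a01 pdE] := pd_segment dok t0t.
    have ball : [set p | Defs.edist p (Defs.center j) < Lhat W + l0 W]
        `<=` region j `|` region j'.
      by have := pd_ball dok (lexx t0); rewrite (pd_start dok).
    apply: (box_in_regions Wok adj ball a01 (body_ws bok bp)) => k; rewrite -pdE.
    have b1 := body_near _ _ k bp; have b2 := err t k t0t.
    have /andP[_ b3] := perf_bounds (rs_range (lshift 3 k)) (ls0 (lshift 3 k)) t0t.
    have b4 : rho_s0 c (lshift 3 k) = l0 W by apply: (rho_s0_pos pok) => /=; exact: ltn_ord.
    rewrite -/(rho_s c t0 (lshift 3 k) t) b4 in b3.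
    move: b1 b2; rewrite ler_norml !ltr_norml => /andP[? ?] /andP[? ?].
    by apply/andP; split; lra.
  split=> //; split=> //; exists +oo%E, (fun t => ubar s c t0 xd t (xO s (q t)) (v t)), q, v.
  split=> //; first exact: ltry.
  have := bounded_mbdd (u_bounded bounded) => -[M MP].
  by apply: mbdd_bounded; exists M => t [t0t _]; exact: MP.
Qed.
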